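(* Let $X$ be a complex Banach space, $L$ a complex solvable Lie algebra of finite dimension $n$, and $\rho\colon L\to\mathrm{L}(X)$ a representation of $L$ in $X$. Then the sets $\sigma_{\delta,k,e}(\rho)$, $0\le k\le n$, are compact non-void subsets of $L^*$ that have the projection property: for every ideal $I$ of $L$, and, if $L$ is nilpotent, for every subalgebra $I$ of $L$, $\pi(\sigma_{\delta,k,e}(\rho))=\sigma_{\delta,k,e}(\rho|_I)$, where $\pi\colon L^*\to I^*$ is the restriction map. In particular, $\sigma_e(\rho)$ is a compact non-void subset of $L^*$ that has the projection property.
   Context: Koszul complex. Let $X$ be a complex Banach space, $\mathrm{L}(X)$ the bounded linear operators on $X$ with Lie bracket $[S,T]=ST-TS$, and $L$ a complex solvable Lie algebra of finite dimension $n$ with dual space $L^*$. A representation $\rho\colon L\to\mathrm{L}(X)$ is a Lie algebra morphism. A character of $L$ is $f\in L^*$ with $f([L,L])=0$; $\rho-f$ denotes the representation $l\mapsto\rho(l)-f(l)I$. The Koszul complex $(X\otimes\wedge L,d(\rho))$ has spaces $X\otimes\wedge^pL$ (zero for $p<0$ or $p>n$) and differentials $d_p(\rho)\colon X\otimes\wedge^pL\to X\otimes\wedge^{p-1}L$, $$d_p(\rho)(x\otimes\langle l_1\wedge\dots\wedge l_p\rangle)=\sum_{k=1}^p(-1)^{k+1}\rho(l_k)(x)\otimes\langle l_1\wedge\dots\wedge\hat{l_k}\wedge\dots\wedge l_p\rangle+\sum_{1\le i<j\le p}(-1)^{i+j-1}x\otimes\langle[l_i,l_j]\wedge l_1\wedge\dots\wedge\hat{l_i}\wedge\dots\wedge\hat{l_j}\wedge\dots\wedge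 l_p\rangle,$$ where $\hat{\ }$ means deletion. Essential spectra. $\sigma_{p,e}(\rho)$ is the set of characters $f$ of $L$ with $\dim H_p(X\otimes\wedge L,d(\rho-f))=\infty$; for $k\ge0$, $\sigma_{\delta,k,e}(\rho)=\bigcup_{p=0}^k\sigma_{p,e}(\rho)$, and $\sigma_e(\rho)=\bigcup_{p=0}^n\sigma_{p,e}(\rho)=\sigma_{\delta,n,e}(\rho)$. $\rho|_I\colon I\to\mathrm{L}(X)$ is the restriction of $\rho$ to $I$, whose spectra are computed with the Koszul complex $X\otimes\wedge I$.
   Formalization: The claim that the sets are non-void is stated only for infinite-dimensional X: for finite-dimensional X all homology is finite-dimensional and every essential spectrum is empty. Compactness and the projection property are stated for all X. *)

(* Defs.v *)
From mathcomp Require Import all_boot all_order all_algebra.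
From mathcomp Require Import complex.
From mathcomp Require Import all_classical all_reals all_analysis.

Set Implicit Arguments.
Unset Strict Implicit.
Unset Printing Implicit Defensive.

Import Order.TTheory GRing.Theory Num.Theory.
Import numFieldNormedType.Exports.

Local Open Scope classical_set_scope.
Local Open Scope ring_scope.

Section LieAlgebra.
Variables (K : fieldType) (L : vectType K) (br : L -> L -> L).

Record is_lie_bracket : Prop := IsLieBracket {
  lie_linearl : forall c a b l, br (c *: a + b) l = c *: br a l + br b l;
  lie_linearr : forall c a b l, br l (c *: a + b) = c *: br l a + br l b;
  lie_alt : forall a, br a a = 0;
  lie_jacobi : forall a b c,
    br a (br b c) + br b (br c a) + br c (br a b) = 0 }.

(* [U, V]; by bilinearity, brackets of basis vectors span all brackets. *)
Definition lie_product (U V : {vspace L}) : {vspace L} :=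
  <<[seq br u v | u <- vbasis U, v <- vbasis V]>>%VS.

Definition lie_solvable : Prop :=
  exists m, iter m (fun U => lie_product U U) fullv = 0%VS.

Definition lie_nilpotent : Prop :=
  exists m, iter m (lie_product fullv) fullv = 0%VS.

Definition is_subalgebra (I : {vspace L}) : Prop :=
  forall a b, a \in I -> b \in I -> br a b \in I.

Definition is_ideal (I : {vspace L}) : Prop :=
  forall a b, b \in I -> br a b \in I.

Definition is_character (f : 'Hom(L, K^o)) : Prop := forall a b, f (br a b) = 0.

(* The bracket of a subalgebra I; vsproj I inverts vsval on I, so it has no
   effect besides the change of type (see sub_bracketE). *)
Definition sub_bracket (I : {vspace L}) (a b : subvs_of I) : subvs_of I :=
  vsproj I (br (vsval a) (vsval b)).

Lemma sub_bracketE (I : {vspace L}) (a b : subvs_of I) :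
  is_subalgebra I -> vsval (sub_bracket a b) = br (vsval a) (vsval b).
Proof. by move=> subI; rewrite vsprojK// subI ?subvsP. Qed.

Lemma ideal_subalgebra (I : {vspace L}) : is_ideal I -> is_subalgebra I.
Proof. by move=> idI a b _ /idI. Qed.

End LieAlgebra.

Arguments sub_bracket {K L} br I a b.

Section Dual.
Variables (K : fieldType) (L : vectType K).

Definition dual_restrict (I : {vspace L}) (f : 'Hom(L, K^o)) :
    'Hom(subvs_of I, K^o) :=
  (f \o linfun vsval)%VF.

End Dual.

(* Compactness for the vector space topology of L^*, which is transported from
   K^n by the coordinate isomorphism of the dual basis. *)
Definition dual_compact (K : numFieldType) (L : vectType K)
    (A : set 'Hom(L, K^o)) : Prop :=
  compact [set \row_(i < \dim {:L}) f (vbasis {:L})`_i | f in A].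

Section FiniteDimension.
Variables (K : fieldType) (V : lmodType K).

(* The quotient Z / B is finite-dimensional: it is spanned by the classes of
   finitely many elements of Z. *)
Definition fin_dim_quotient (Z B : set V) : Prop :=
  exists m (v : 'I_m -> V), (forall i, Z (v i)) /\
    forall z, Z z -> exists c : 'I_m -> K, B (z - \sum_(i < m) c i *: v i).

Definition fin_dim : Prop := fin_dim_quotient setT [set 0].

End FiniteDimension.

Section Koszul.
Variables (K : fieldType) (L : vectType K) (X : lmodType K).
Variables (br : L -> L -> L) (rho : L -> X -> X).

Local Notation n := (\dim {:L}).
Local Notation e := (vbasis {:L}).

(* X (x) /\L, where u : kchain stands for the sum over the sets
   S = {i_1 < ... < i_p} of u S (x) (e_i_1 /\ ... /\ e_i_p); the summand
   X (x) /\^p L consists of the u supported on the sets of cardinal p. *)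
Definition kchain := {ffun {set 'I_n} -> X}.

Definition kdegree (p : nat) : set kchain :=
  [set u : kchain | forall S : {set 'I_n}, #|S| <> p -> u S = 0].

(* x (x) (l_1 /\ ... /\ l_p) for s = [:: l_1; ...; l_p]: its coordinates are
   the p x p minors of the coordinates of the l_i. *)
Definition kwedge (x : X) (s : seq L) : kchain :=
  [ffun S : {set 'I_n} =>
    if #|S| == size s then
      \det (\matrix_(a < size s, b < size s)
              [seq coord e i s`_a | i <- enum S]`_b) *: x
    else 0].

Definition del (j : nat) (s : seq L) : seq L := take j s ++ drop j.+1 s.

(* Indices start at 0 here, whence the signs (-1)^k and (-1)^(i+j+1) in place
   of (-1)^(k+1) and (-1)^(i+j-1). *)
Definition koszul_formula (x : X) (s : seq L) : kchain :=
  \sum_(k < size s) (-1) ^+ k *: kwedge (rho s`_k x) (del k s)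
  + \sum_(j < size s) \sum_(i < j)
      (-1) ^+ (i + j).+1 *: kwedge x (br s`_i s`_j :: del i (del j s)).

Definition basis_seq (S : {set 'I_n}) : seq L :=
  [seq e`_(nat_of_ord i) | i <- enum S].

Lemma kwedge_basis (x : X) (S : {set 'I_n}) :
  kwedge x (basis_seq S) = [ffun S' => if S' == S then x else 0].
Proof.
apply/ffunP => S'; rewrite !ffunE size_map -cardE.
have [->|neS] := eqVneq S' S.
  rewrite eqxx (_ : \matrix_(a, b) _ = 1%:M) ?det1 ?scale1r//.
  apply/matrixP => a b; rewrite !mxE.
  have lt_enum (c : 'I_#|S|) : (c < size (enum S))%N by rewrite -cardE.
  have [x0 _] : exists x0, x0 \in S by apply/card_gt0P/(leq_ltn_trans _ (ltn_ord a)).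
  rewrite !(nth_map x0)// coord_free ?(basis_free (vbasisP _))//.
  by rewrite nth_uniq ?enum_uniq// eq_sym.
have [cS|//] := eqVneq #|S'| #|S|.
have /subsetPn[j jS' jS] : ~~ (S' \subset S).
  by apply: contra neS => sS; rewrite eqEcard sS cS leqnn.
have ltj : (index j (enum S') < #|S|)%N by rewrite -cS cardE index_mem mem_enum.
rewrite (expand_det_col _ (Ordinal ltj)) big1 ?scale0r// => a _.
rewrite !mxE/= (nth_map j) ?index_mem ?mem_enum// nth_index ?mem_enum//.
rewrite (nth_map j) -?cardE// coord_free ?(basis_free (vbasisP _))//.
case: eqP => [jE|]; last by rewrite mul0r.
by case/negP: jS; rewrite -mem_enum -jE mem_nth// -cardE.
Qed.

(* The linear extension of the Koszul formula from the elements x (x) e_S. *)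
Definition koszul_d (u : kchain) : kchain :=
  \sum_(S : {set 'I_n}) koszul_formula (u S) (basis_seq S).

Definition koszul_cycles (p : nat) : set kchain :=
  kdegree p `&` [set u : kchain | koszul_d u = 0].

Definition koszul_boundaries (p : nat) : set kchain :=
  koszul_d @` kdegree p.+1.

Definition fin_dim_homology (p : nat) : Prop :=
  fin_dim_quotient (koszul_cycles p) (koszul_boundaries p).

End Koszul.

Section Spectra.
Variables (K : numFieldType) (L : vectType K) (X : normedModType K).
Variables (br : L -> L -> L) (rho : L -> {linear X -> X}).

Record is_representation : Prop := IsRepresentation {
  rep_bounded : forall l, exists M : K, forall x, `|rho l x| <= M * `|x|;
  rep_linear : forall c a b x, rho (c *: a + b) x = c *: rho a x + rho b x;
  rep_bracket : forall a b x,
    rho (br a b) x = rho a (rho b x) - rho b (rho a x) }.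

Definition rep_shift (f : 'Hom(L, K^o)) (l : L) (x : X) : X :=
  rho l x - f l *: x.

Definition sigma_pe (p : nat) : set 'Hom(L, K^o) :=
  [set f | is_character br f /\ ~ fin_dim_homology br (rep_shift f) p].

Definition sigma_delta_e (k : nat) : set 'Hom(L, K^o) :=
  \bigcup_(p in [set p | (p <= k)%N]) sigma_pe p.

Definition sigma_e : set 'Hom(L, K^o) :=
  \bigcup_(p in [set p | (p <= \dim {:L})%N]) sigma_pe p.

End Spectra.

Definition rep_restrict (K : numFieldType) (L : vectType K)
    (X : normedModType K) (rho : L -> {linear X -> X}) (I : {vspace L})
    (a : subvs_of I) : {linear X -> X} :=
  rho (vsval a).

Arguments rep_restrict {K L X} rho I a.

(* Main.v *)
(* Chains of subspaces L > ... > I with each term an ideal of codimension one of the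
   preceding one exist for ideals of solvable algebras and for subalgebras of
   nilpotent ones: if J properly contains I then J <> I + [J, J]. This reduces the
   projection property to an ideal L1 of codimension one in L2 = L1 + C l.

   There the Koszul complex of L2 is the mapping cone of the action Theta of l on
   the complex of L1, so finiteness of H_p and H_(p-1) over L1 implies that of H_p
   over L2. Conversely let H_p over L1 be infinite-dimensional at the character f.
   First, f is invariant under ad l, because the characters f o exp(t ad l) have
   conjugate complexes and would otherwise tend to infinity along suitable t, where
   Cartan's formula makes the complex acyclic. Hence f has the extensions f_c,
   c = f_c(l). If H_p over L2 were finite-dimensional at every f_c, then (Theta - c)
   would have an image of finite codimension in H_p over L1 for every c. The essential
   spectrum of Theta on the (possibly non-Hausdorff) quotient of cycles by boundaries
   would thus be empty, which forces this quotient to be finite-dimensional.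

   For I = 0 the projection property gives nonemptiness. Compactness holds because
   finiteness of H_p and H_(p-1) is stable under small perturbations of the character,
   and because all homology is finite-dimensional at large characters. *)

From HB Require Import structures.
Require Import Defs.
From mathcomp Require Import all_boot all_order all_algebra.
From mathcomp Require Import complex.
From mathcomp Require Import all_classical all_reals all_analysis.
From mathcomp Require Import ring lra.

Set Implicit Arguments.
Unset Strict Implicit.
Unset Printing Implicit Defensive.

Import Order.TTheory GRing.Theory Num.Theory.
Import numFieldNormedType.Exports.

Local Open Scope classical_set_scope.
Local Open Scope ring_scope.

(** Boundaries need not be closed, so homology is never formed as a Banach space. Its finiteness is
    tested by finite nets: modulo [d] of a bounded set, the unit ball of the cycles lies within 1/4
    of a finite set ([net_fin_codim]). This test has room to spare, so it survives perturbations of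
    the character, and approximate cycles and preimages are enough to verify it. For the same reason
    operator exponentials are only truncated sums, with errors bounded by a scalar series.

    The spectrum of [Theta] on homology becomes that of composition with [Theta] on bounded maps,
    under a seminorm measuring noncompactness modulo boundaries. There one has only approximate
    inverses and no completeness, so Liouville's theorem gives way to estimates of dyadic powers: a
    bound on the inverses, uniform on a disc, lets the spectral radius be lowered in steps of fixed
    size.

    On the algebraic side, chains are generated from [X] by exterior multiplications, and Cartan's
    formula then determines the Koszul differential; the explicit alternating sums serve only to
    identify it. *)

Section ModuleExpressions.
Variables (K : comPzRingType) (V : lmodType K).

(** Reified linear combinations of atoms: an identity holds in every module as soon as the
    coefficients agree, and these lie in a commutative ring, where [ring] decides. *)
Inductive module_expr : Type :=
  | MVar of nat | MZero | MAdd of module_expr & module_expr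
  | MOpp of module_expr | MScale of K & module_expr.

Fixpoint meval (env : seq V) (e : module_expr) : V :=
  match e with
  | MVar i => nth 0 env i
  | MZero => 0
  | MAdd a b => meval env a + meval env b
  | MOpp a => - meval env a
  | MScale c a => c *: meval env a
  end.

Fixpoint mcoef (e : module_expr) (i : nat) : K :=
  match e with
  | MVar j => if eqn i j then 1 else 0
  | MZero => 0
  | MAdd a b => mcoef a i + mcoef b i
  | MOpp a => - mcoef a i
  | MScale c a => c * mcoef a i
  end.

(** A conjunction by recursion rather than a quantified statement, so that [cbn] unfolds it into
    finitely many ring equations. *)
Fixpoint mcoef_eq (a b : module_expr) (n : nat) : Prop :=
  if n is n'.+1 then mcoef a n' = mcoef b n' /\ mcoef_eq a b n' else True.

Lemma mevalE env e : meval env e = \sum_(i < size env) mcoef e i *: nth 0 env i.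
Proof.
elim: e => /= [j||a -> b ->|a ->|c a ->].
- have [lt_j|le_j] := ltnP j (size env).
    rewrite (bigD1 (Ordinal lt_j))//= big1 ?addr0 => [|i neq].
      by have -> : eqn j j = true by [apply/eqnP]; rewrite scale1r.
    by case: ifP => [/eqnP eqi|]; [rewrite -val_eqE /= eqi eqxx in neq | rewrite scale0r].
  rewrite nth_default// big1// => i _; case: ifP => [/eqnP eqi|]; last by rewrite scale0r.
  by have := ltn_ord i; rewrite eqi ltnNge le_j.
- by rewrite big1// => i _; rewrite scale0r.
- by rewrite -big_split/=; apply: eq_bigr => i _; rewrite scalerDl.
- by rewrite -sumrN; apply: eq_bigr => i _; rewrite scaleNr.
- by rewrite scaler_sumr; apply: eq_bigr => i _; rewrite scalerA.
Qed.

Lemma meval_eq env a b : mcoef_eq a b (size env) -> meval env a = meval env b.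
Proof.
move=> eq_ab; rewrite !mevalE; apply: eq_bigr => -[i lti] _ /=; congr (_ *: _).
elim: (size env) eq_ab lti => //= n IH [eqn /IH{}IH].
by rewrite ltnS leq_eqVlt => /orP[/eqP->|/IH].
Qed.

End ModuleExpressions.

(* Atoms are compared syntactically, or up to conversion if [conv] is [true]. *)
Ltac module_index conv x env :=
  match env with
  | cons x _ => constr:(0%N)
  | cons ?y _ =>
      lazymatch conv with
      | true => let _ := constr:(erefl x : x = y) in constr:(0%N)
      end
  | cons _ ?t => let n := module_index conv x t in constr:(S n)
  end.

Ltac module_atoms conv e env :=
  lazymatch e with
  | (@GRing.zero _) => env
  | (@GRing.add _ ?a ?b) =>
      let env' := module_atoms conv a env in module_atoms conv b env'
  | (@GRing.opp _ ?a) => module_atoms conv a env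
  | (@GRing.scale _ _ _ ?a) => module_atoms conv a env
  | _ =>
      match env with
      | _ => let _ := module_index conv e env in env
      | _ => constr:(cons e env)
      end
  end.

Ltac module_reify conv K e env :=
  lazymatch e with
  | (@GRing.zero _) => constr:(@MZero K)
  | (@GRing.add _ ?a ?b) =>
      let a' := module_reify conv K a env in
      let b' := module_reify conv K b env in constr:(MAdd a' b')
  | (@GRing.opp _ ?a) => let a' := module_reify conv K a env in constr:(MOpp a')
  | (@GRing.scale _ _ ?c ?a) =>
      let a' := module_reify conv K a env in constr:(@MScale K c a')
  | _ => let n := module_index conv e env in constr:(@MVar K n)
  end.

Ltac module_compare conv :=
  lazymatch goal with
  | |- @eq ?V ?a ?b =>
    let env := module_atoms conv a (@nil V) in
    let env := module_atoms conv b env in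
    let K := lazymatch type of (fun (c : _) (x : V) => c *: x) with ?C -> _ => C end in
    let a' := module_reify conv K a env in
    let b' := module_reify conv K b env in
    apply: (@meval_eq K _ env a' b'); cbn [mcoef mcoef_eq size eqn];
    repeat split; ring
  end.

(* Linear identities in a module, by comparison of the coefficients. *)
Ltac module := first [module_compare false | module_compare true].

(** * Norms and completeness *)

Section RealNorm.
Variable R : realType.
Local Open Scope complex_scope.
Local Notation C := R[i].

(** Norms over [R[i]] take values in [R[i]]. Their real parts lose nothing ([rnormE]) and lie in an
    ordered field, where [lra], [nra] and infima apply. *)
Definition rnorm (V : normedZmodType C) (x : V) : R := complex.Re `|x|.

Section Zmod.
Variable V : normedZmodType C.
Implicit Types x y : V.

Lemma rnormE x : `|x| = (rnorm x)%:C.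
Proof. by rewrite RRe_real// normr_real. Qed.

Lemma rnorm_ge0 x : 0 <= rnorm x.
Proof. by have := normr_ge0 x; rewrite rnormE lecR. Qed.

Lemma rnorm0 : rnorm (0 : V) = 0.
Proof. by rewrite /rnorm normr0. Qed.

Lemma rnorm_eq0 x : rnorm x = 0 -> x = 0.
Proof. by move=> x0; apply/eqP; rewrite -normr_eq0 rnormE x0. Qed.

Lemma rnormN x : rnorm (- x) = rnorm x.
Proof. by rewrite /rnorm normrN. Qed.

Lemma ler_rnormD x y : rnorm (x + y) <= rnorm x + rnorm y.
Proof. by have := ler_normD x y; rewrite !rnormE -rmorphD lecR. Qed.

End Zmod.

Lemma rnormM (a b : C) : rnorm (a * b) = rnorm a * rnorm b.
Proof. by apply: (@complexI R); rewrite rmorphM /= -!rnormE normrM. Qed.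

Lemma rnormZ (V : normedModType C) (a : C) (x : V) :
  rnorm (a *: x) = rnorm a * rnorm x.
Proof. by apply: (@complexI R); rewrite rmorphM /= -!rnormE normrZ. Qed.

Lemma rnorm1 : rnorm (1 : C) = 1.
Proof. by rewrite /rnorm normr1. Qed.

Lemma rnormX (a : C) n : rnorm (a ^+ n) = rnorm a ^+ n.
Proof. by elim: n => [|n IH]; rewrite ?expr0 ?rnorm1// !exprS rnormM IH. Qed.

Lemma rnormV (a : C) : rnorm a^-1 = (rnorm a)^-1.
Proof.
have [->|a0] := eqVneq a 0; first by rewrite invr0 rnorm0 invr0.
have ra0 : rnorm a != 0 by apply: contra_neq a0; exact: rnorm_eq0.
by apply: (mulfI ra0); rewrite -rnormM !divff// rnorm1.
Qed.

Lemma rnorm_real (r : R) : rnorm (r%:C : C) = `|r|.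
Proof. by apply: (@complexI R); rewrite -rnormE normc_def/= expr0n addr0 sqrtr_sqr. Qed.

Lemma rnorm_nat n : rnorm (n%:R : C) = n%:R.
Proof. by rewrite -(rmorph_nat (real_complex R)) rnorm_real normr_nat. Qed.

End RealNorm.

(** The structure on [Y] supplies the default value 0 outside [P]. *)
Lemma choice_on (T : Type) (Y : nmodType) (P : T -> Prop) (Q : T -> Y -> Prop) :
  (forall x, P x -> exists y, Q x y) -> exists f, forall x, P x -> Q x (f x).
Proof.
move=> PQ; have [|f fP] := @choice T Y (fun x y => P x -> Q x y).
  by move=> x; have [/PQ[y Qy]|nP] := pselect (P x); [exists y | exists 0].
by exists f.
Qed.

Section LinearMaps.
Variables (K : pzRingType) (V1 V2 : lmodType K) (T : V1 -> V2).
Hypothesis linT : linear T.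

Lemma linear_map0 : T 0 = 0.
Proof.
have := linT 1 0 0; rewrite !scale1r addr0 => /eqP.
by rewrite -subr_eq0 opprD addrA subrr sub0r oppr_eq0 => /eqP.
Qed.

Lemma linear_mapZ c u : T (c *: u) = c *: T u.
Proof. by rewrite -[c *: u]addr0 linT linear_map0 addr0. Qed.

Lemma linear_mapD u v : T (u + v) = T u + T v.
Proof. by rewrite -[u in LHS]scale1r linT scale1r. Qed.

Lemma linear_mapN u : T (- u) = - T u.
Proof. by rewrite -scaleN1r linear_mapZ scaleN1r. Qed.

Lemma linear_mapB u v : T (u - v) = T u - T v.
Proof. by rewrite linear_mapD linear_mapN. Qed.

Lemma linear_map_sum (I : Type) (r : seq I) (P : pred I) (F : I -> V1) :
  T (\sum_(i <- r | P i) F i) = \sum_(i <- r | P i) T (F i).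
Proof. by apply: big_morph; [exact: linear_mapD | exact: linear_map0]. Qed.

End LinearMaps.

Section Subspace.
Variables (K : pzRingType) (V : lmodType K).

Definition is_subspace (P : set V) : Prop :=
  P 0 /\ forall c u v, P u -> P v -> P (c *: u + v).

Variable P : set V.
Hypothesis subP : is_subspace P.

Lemma subspace0 : P 0. Proof. by case: subP. Qed.

Lemma subspaceD u v : P u -> P v -> P (u + v).
Proof. by move=> Pu Pv; rewrite -[u]scale1r; apply: subP.2. Qed.

Lemma subspaceZ c u : P u -> P (c *: u).
Proof. by move=> Pu; rewrite -[c *: u]addr0; apply: subP.2 => //; apply: subspace0. Qed.

Lemma subspaceN u : P u -> P (- u).
Proof. by move=> Pu; rewrite -scaleN1r; apply: subspaceZ. Qed.

Lemma subspaceB u v : P u -> P v -> P (u - v).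
Proof. by move=> Pu Pv; apply: subspaceD => //; apply: subspaceN. Qed.

Lemma subspace_sum (I : Type) (r : seq I) (Q : pred I) (F : I -> V) :
  (forall i, Q i -> P (F i)) -> P (\sum_(i <- r | Q i) F i).
Proof. by move=> PF; elim/big_rec: _ => [|i u Qi Pu]; [exact: subspace0|apply: subspaceD => //; exact: PF]. Qed.

End Subspace.

Section NormedSpaces.
Variable R : realType.
Local Notation C := R[i].

(** Norms, subspaces and completeness are predicates on bare modules, because the chains of each
    degree and the cycles of varying characters are subsets of one type and share one norm. *)
Record is_norm (V : lmodType C) (N : V -> R) : Prop := IsNorm {
  normD : forall u v, N (u + v) <= N u + N v;
  normZ : forall c u, N (c *: u) = rnorm c * N u;
  norm_eq0 : forall u, N u = 0 -> u = 0 }.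

(* Cauchy sequences are given at geometric speed. *)
Definition complete_on (V : lmodType C) (N : V -> R) (P : set V) : Prop :=
  forall (u : nat -> V) K, (forall n, P (u n)) ->
    (forall n, N (u n.+1 - u n) <= K * 2^-1 ^+ n) ->
    exists2 l, P l & forall eps, 0 < eps ->
      exists n0, forall n, (n0 <= n)%N -> N (u n - l) <= eps.

Record is_banach (V : lmodType C) (N : V -> R) (P : set V) : Prop := IsBanach {
  banach_norm : is_norm N;
  banach_subspace : is_subspace P;
  banach_complete : complete_on N P }.

Definition bounded_map (V1 V2 : lmodType C) (N1 : V1 -> R) (N2 : V2 -> R)
    (T : V1 -> V2) : Prop :=
  linear T /\ exists2 M, 0 <= M & forall u, N2 (T u) <= M * N1 u.

Lemma geometric_small (K eps : R) : 0 < eps ->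
  exists n0, forall n, (n0 <= n)%N -> K * 2^-1 ^+ n <= eps.
Proof.
move=> e0; have [K0|K0] := leP K 0.
  exists 0%N => n _; apply: le_trans (ltW e0).
  by rewrite mulr_le0_ge0// exprn_ge0// invr_ge0.
have q0 : 0 <= K / eps by rewrite divr_ge0// ltW.
exists (Num.truncn (K / eps)).+1 => n ltn; rewrite exprVn ler_pdivrMr ?exprn_gt0//.
rewrite mulrC -ler_pdivrMr//.
apply: (@le_trans _ _ n%:R).
  by apply/ltW/(lt_le_trans (truncnS_gt _)); rewrite ler_nat.
by rewrite -natrX ler_nat ltnW// ltn_expl.
Qed.

Section Norm.
Variables (V : lmodType C) (N : V -> R).
Hypothesis normN : is_norm N.

Lemma norm0 : N 0 = 0.
Proof. by rewrite -(scale0r 0) (normZ normN) rnorm0 mul0r. Qed.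

Lemma norm_opp u : N (- u) = N u.
Proof. by rewrite -scaleN1r (normZ normN) rnormN rnorm1 mul1r. Qed.

Lemma norm_ge0 u : 0 <= N u.
Proof.
have := normD normN u (- u); rewrite subrr norm0 norm_opp -mulr2n.
by rewrite pmulrn_lge0.
Qed.

Lemma norm_le0 u : N u <= 0 -> u = 0.
Proof. by move=> u0; apply: (norm_eq0 normN); apply/eqP; rewrite eq_le u0 norm_ge0. Qed.

Lemma norm_distC u v : N (u - v) = N (v - u).
Proof. by rewrite -norm_opp opprB. Qed.

Lemma normB u v : N (u - v) <= N u + N v.
Proof. by rewrite -(norm_opp v) (normD normN). Qed.

Lemma norm_split u v w : N (u - w) <= N (u - v) + N (v - w).
Proof. by have := normD normN (u - v) (v - w); rewrite addrA subrK. Qed.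

Lemma norm_le_dist u v : N u <= N v + N (u - v).
Proof. by have := normD normN v (u - v); rewrite addrC subrK. Qed.

Lemma norm_sum (I : Type) (r : seq I) (P : pred I) (F : I -> V) :
  N (\sum_(i <- r | P i) F i) <= \sum_(i <- r | P i) N (F i).
Proof.
elim/big_rec2: _ => [|i y u _ le_uy]; first by rewrite norm0.
by apply: (le_trans (normD normN _ _)); rewrite lerD2l.
Qed.

End Norm.

Section BoundedMaps.
Variables (V1 V2 : lmodType C) (N1 : V1 -> R) (N2 : V2 -> R).
Hypotheses (nN1 : is_norm N1) (nN2 : is_norm N2).
Variables (P1 : set V1) (P2 : set V2) (D : V1 -> V2).
Hypotheses (b1 : is_banach N1 P1) (sP2 : is_subspace P2).
Hypotheses (bD : bounded_map N1 N2 D) (DP : forall y, P1 y -> P2 (D y)).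

(** Solving approximately for the successive residuals [r k] halves them each time, so the
    corrections form a geometric series in [P1]; its sum is an exact preimage, at the price of a
    factor 2 in the bound. *)
Lemma approx_onto K : 0 <= K ->
  (forall z, P2 z ->
     exists y, [/\ P1 y, N1 y <= K * N2 z & N2 (z - D y) <= N2 z / 2]) ->
  forall z, P2 z -> exists y, [/\ P1 y, D y = z & N1 y <= 2 * K * N2 z].
Proof.
move=> K0 /(choice_on (Y := V1))[s sP] z Pz; have [linD [M M0 DM]] := bD.
pose r k := iter k (fun r => r - D (s r)) z.
pose w k := \sum_(i < k) s (r i).
have wS k : w k.+1 = w k + s (r k) by rewrite /w big_ord_recr.
have rP k : P2 (r k) /\ N2 (r k) <= N2 z * 2^-1 ^+ k.
  elim: k => [|k [Pr rk]]; first by rewrite expr0 mulr1.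
  have [Ps _ sk] := sP _ Pr; split; first by apply: subspaceB => //; apply: DP.
  apply: (le_trans sk); rewrite exprSr mulrA.
  by rewrite ler_pM2r ?invr_gt0.
have Dw k : D (w k) = z - r k.
  elim: k => [|k IH]; first by rewrite /w big_ord0 linear_map0// subrr.
  by rewrite wS linear_mapD// IH [r k.+1]/(_ - _) opprB addrA addrAC.
have Pw k : P1 (w k).
  apply: subspace_sum; first exact: banach_subspace b1.
  by move=> i _; have [] := sP _ (rP i).1.
have Nw k : N1 (w k) <= 2 * K * N2 z * (1 - 2^-1 ^+ k).
  elim: k => [|k IH]; first by rewrite /w big_ord0 norm0// expr0 subrr mulr0.
  rewrite wS; apply: (le_trans (normD nN1 _ _)).
  have [_ sk _] := sP _ (rP k).1.
  have := lerD IH (le_trans sk (ler_wpM2l K0 (rP k).2)).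
  move/le_trans; apply; rewrite exprS; set a := _ ^+ k; nra.
have [|l Pl lim] := banach_complete b1 (u := w) (K := K * N2 z) Pw.
  move=> k; rewrite wS addrC addKr.
  have [_ sk _] := sP _ (rP k).1.
  by apply: (le_trans sk); rewrite -mulrA; apply: ler_wpM2l => //; apply: (rP k).2.
have lime eps : 0 < eps -> exists k, N1 (w k - l) <= eps /\ N2 (r k) <= eps.
  move=> e0; have [n0 h0] := lim _ e0; have [n1 h1] := geometric_small (N2 z) e0.
  exists (maxn n0 n1); split; first by apply: h0; rewrite leq_maxl.
  by apply: (le_trans (rP _).2); apply: h1; rewrite leq_maxr.
exists l; split=> //.
  apply/eqP; rewrite -subr_eq0; apply/eqP/(norm_le0 nN2)/ler_addgt0Pr => eps e0.
  have M1 : 0 < M + 1 by rewrite ltr_wpDl.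
  have [|k [k1 k2]] := lime (eps / (M + 1)); first by rewrite divr_gt0.
  have -> : D l - z = D (l - w k) - r k.
    by rewrite linear_mapB// Dw opprB addrA addrAC addrK.
  rewrite add0r; apply: (le_trans (normB nN2 _ _)).
  have := DM (l - w k); rewrite (norm_distC nN1) => h.
  have h' := ler_wpM2l M0 k1.
  have : (M + 1) * (eps / (M + 1)) = eps by rewrite mulrC divfK// gt_eqF.
  lra.
apply/ler_addgt0Pr => eps e0; have [k [k1 _]] := lime _ e0.
have := norm_le_dist nN1 l (w k); rewrite (norm_distC nN1) => h.
have : 2 * K * N2 z * (1 - 2^-1 ^+ k) <= 2 * K * N2 z.
  apply: ler_piMr; first by rewrite !mulr_ge0// (norm_ge0 nN2).
  by rewrite gerBl exprn_ge0// invr_ge0.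
have := Nw k; lra.
Qed.

End BoundedMaps.

End NormedSpaces.

Section Completeness.
Variable R : realType.
Local Open Scope complex_scope.
Local Notation C := R[i].

Lemma cauchy_nat_cvg (K : numFieldType) (V : completeNormedModType K) (u : nat -> V) :
  (forall eps, 0 < eps -> exists n0, forall n, (n0 <= n)%N -> `|u n0 - u n| < eps) ->
  exists l, forall eps, 0 < eps -> exists n0, forall n, (n0 <= n)%N -> `|u n - l| <= eps.
Proof.
move=> cu; have /cauchy_cvg/cvg_ex[l ul] : cauchy (u @ \oo).
  apply: cauchy_exP => eps e0; have [n0 h] := cu _ e0; exists (u n0).
  by exists n0 => // n /= /h; rewrite -ball_normE.
exists l => eps e0; move/cvgrPdist_le: ul => /(_ _ e0)[n0 _ h].
by exists n0 => n /h; rewrite distrC.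
Qed.

Lemma geometric_cauchy (V : zmodType) (N : V -> R) (u : nat -> V) K :
  (forall u v w, N (u - w) <= N (u - v) + N (v - w)) -> (forall u, N (u - u) = 0) ->
  (forall u, 0 <= N u) ->
  (forall n, N (u n - u n.+1) <= K * 2^-1 ^+ n) -> forall eps, 0 < eps ->
  exists n0, forall n, (n0 <= n)%N -> N (u n0 - u n) < eps.
Proof.
move=> N3 N0 Nge0 uK eps e0; have K0 : 0 <= K.
  by have := uK 0%N; rewrite expr0 mulr1; apply: le_trans.
have e40 : 0 < eps / 4 by rewrite divr_gt0.
have [n0 h] := geometric_small K e40; exists n0 => n /subnKC <-.
have -> //: forall k, N (u n0 - u (n0 + k)%N) < eps.
move=> k; apply: (@le_lt_trans _ _ (2 * (K * 2^-1 ^+ n0) * (1 - 2^-1 ^+ k))).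
  elim: k => [|k IH]; first by rewrite addn0 N0 expr0 subrr mulr0.
  apply: (le_trans (N3 _ (u (n0 + k)%N) _)); rewrite addnS.
  apply: (le_trans (lerD IH (uK _))); rewrite exprD exprS.
  by set a := _ ^+ n0; set b := _ ^+ k; nra.
have := h _ (leqnn _); have : 0 <= K * 2^-1 ^+ n0.
  by rewrite mulr_ge0// exprn_ge0// invr_ge0.
have : (0 : R) <= 2^-1 ^+ k by rewrite exprn_ge0// invr_ge0.
set a := K * _; set b := _ ^+ k; nra.
Qed.

Lemma rnorm_is_norm (V : normedModType C) : is_norm (@rnorm R V).
Proof.
by split; [exact: ler_rnormD | exact: rnormZ | exact: rnorm_eq0].
Qed.

Lemma banach_rnorm (X : completeNormedModType C) : is_banach (@rnorm R X) setT.
Proof.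
have nX := @rnorm_is_norm X; split=> // u K _ uK.
have [|l ul] := @cauchy_nat_cvg _ X u.
  move=> eps e0; have er0 : 0 < complex.Re eps by move: e0; rewrite ltcE => /andP[].
  have eE : eps = (complex.Re eps)%:C by rewrite RRe_real// gtr0_real.
  have [||||n0 h] := @geometric_cauchy X (@rnorm R X) u K _ _ _ _ _ er0.
  - exact: norm_split nX.
  - by move=> v; rewrite subrr rnorm0.
  - exact: rnorm_ge0.
  - by move=> n; rewrite (norm_distC nX); apply: uK.
  by exists n0 => n /h; rewrite eE rnormE ltcR.
exists l => // eps e0; have [|n0 h] := ul eps%:C; first by rewrite ltcR.
by exists n0 => n /h; rewrite rnormE lecR.
Qed.

Lemma rnorm_complexE (c : C) : rnorm c = Num.sqrt (complex.Re c ^+ 2 + complex.Im c ^+ 2).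
Proof. by rewrite /rnorm normc_def. Qed.

Lemma Re_le_rnorm (c : C) : `|complex.Re c| <= rnorm c.
Proof. by have := normc_ge_Re c; rewrite rnormE lecR. Qed.

Lemma Im_le_rnorm (c : C) : `|complex.Im c| <= rnorm c.
Proof.
rewrite rnorm_complexE -sqrtr_sqr ler_wsqrtr// lerDr sqr_ge0 //.
Qed.

Lemma rnorm_le_ReIm (c : C) : rnorm c <= `|complex.Re c| + `|complex.Im c|.
Proof.
have -> : c = (complex.Re c)%:C + 'i * (complex.Im c)%:C by rewrite -complexE.
apply: (le_trans (ler_rnormD _ _)); rewrite rnormM !rnorm_real /=.
have -> : rnorm ('i : C) = 1 by rewrite rnorm_complexE /= expr0n expr1n add0r sqrtr1.
by rewrite mul1r; simpc; rewrite /= ?(mul0r,mul1r,mulr0,addr0,add0r,subr0).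
Qed.

Lemma complete_rnorm : complete_on (@rnorm R C) setT.
Proof.
move=> u K _ uK.
have cv (f : C -> R) : (forall x y, f (x - y) = f x - f y) -> (forall x, `|f x| <= rnorm x) ->
    exists l, forall eps, 0 < eps -> exists n0, forall n, (n0 <= n)%N -> `|f (u n) - l| <= eps.
  move=> fB fn; apply: cauchy_nat_cvg.
  apply: (@geometric_cauchy R (fun x => `|x|) _ K).
  - by move=> x y z; rewrite -[x - z](subrKA y) ler_normD.
  - by move=> x; rewrite subrr normr0.
  - exact: normr_ge0.
  - by move=> n; rewrite distrC -fB; apply: (le_trans (fn _)).
have [a ha] := cv (@complex.Re R) (fun x y => raddfB _ x y) Re_le_rnorm.
have [b hb] := cv (@complex.Im R) (fun x y => raddfB _ x y) Im_le_rnorm.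
exists (a +i* b) => // eps e0; have e20 : 0 < eps / 2 by rewrite divr_gt0.
have [n0 h0] := ha _ e20; have [n1 h1] := hb _ e20.
exists (maxn n0 n1) => n; rewrite geq_max => /andP[/h0 k0 /h1 k1].
apply: (le_trans (rnorm_le_ReIm _)); rewrite !raddfB /=; lra.
Qed.

End Completeness.

(** * Open mappings and finite codimension *)

Section OpenMapping.
Variable R : realType.
Local Notation C := R[i].

Lemma complete_sum (I : finType) (u : nat -> I -> C) K :
  (forall n i, rnorm (u n.+1 i - u n i) <= K * 2^-1 ^+ n) ->
  exists l : I -> C, forall eps, 0 < eps ->
    exists n0, forall n, (n0 <= n)%N -> \sum_i rnorm (u n i - l i) <= eps.
Proof.
move=> uK; have /choice[l lP] : forall i, exists l, forall eps, 0 < eps ->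
    exists n0, forall n, (n0 <= n)%N -> rnorm (u n i - l) <= eps.
  by move=> i; have [l _] := @complete_rnorm R (fun n => u n i) K (fun=> Logic.I) (fun n => uK n i); exists l.
exists l => eps e0; have c0 : 0 < #|I|.+1%:R :> R by rewrite ltr0n.
have /choice[n0 n0P] : forall i, exists n0, forall n, (n0 <= n)%N ->
    rnorm (u n i - l i) <= eps / #|I|.+1%:R.
  by move=> i; apply: lP; rewrite divr_gt0.
exists (\max_i n0 i)%N => n len.
apply: (@le_trans _ _ (\sum_(i : I) eps / #|I|.+1%:R)).
  by apply: ler_sum => i _; apply: n0P; apply: leq_trans len; apply: leq_bigmax.
rewrite sumr_const -[X in X <= _]mulr_natr mulrAC ler_pdivrMr// ler_wpM2l// ?ler_nat ?leqW//.
exact: ltW.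
Qed.

Section Products.
Variables (V : lmodType C) (N : V -> R) (m : nat).

Definition prod_norm (x : V * 'rV[C]_m) : R := N x.1 + \sum_i rnorm (x.2 0 i).

Lemma banach_prod (P : set V) : is_banach N P -> is_banach prod_norm [set x | P x.1].
Proof.
case=> nN sP cP; split.
- split=> [[u a] [v b]|c [u a]|[u a]]; rewrite /prod_norm /=.
  + rewrite addrACA lerD ?(normD nN)// -big_split /= ler_sum// => i _.
    by rewrite mxE ler_rnormD.
  + rewrite (normZ nN) mulrDr mulr_sumr; congr (_ + _).
    by apply: eq_bigr => i _; rewrite mxE rnormM.
  + move=> h; have s0 : 0 <= \sum_i rnorm (a 0 i) by apply: sumr_ge0 => i _; apply: rnorm_ge0.
    have u0 := norm_ge0 nN u.
    have -> : u = 0 by apply: (norm_eq0 nN); lra.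
    have /eqP : \sum_i rnorm (a 0 i) = 0 by lra.
    rewrite psumr_eq0 => [/allP a0|i _]; last exact: rnorm_ge0.
    congr (_, _); apply/rowP => i; rewrite mxE.
    by apply/rnorm_eq0/eqP/a0; rewrite mem_index_enum.
- split=> /= [|c u v]; first exact: subspace0.
  exact: sP.2.
- move=> u K Pu uK.
  have nU n : N ((u n.+1).1 - (u n).1) <= K * 2^-1 ^+ n.
    apply: le_trans (uK n); rewrite lerDl; apply: sumr_ge0 => i _.
    exact: rnorm_ge0.
  have nA n i : rnorm ((u n.+1).2 0 i - (u n).2 0 i) <= K * 2^-1 ^+ n.
    apply: le_trans (uK n); rewrite /prod_norm (bigD1 i)//= !mxE addrCA lerDl.
    by rewrite addr_ge0 ?(norm_ge0 nN)//; apply: sumr_ge0 => j _; apply: rnorm_ge0.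
  have [l Pl hl] := cP (fun n => (u n).1) K Pu nU.
  have [a ha] := complete_sum nA.
  exists (l, \row_i a i) => // eps e0; have e20 : 0 < eps / 2 by rewrite divr_gt0.
  have [n0 h0] := hl _ e20; have [n1 h1] := ha _ e20.
  exists (maxn n0 n1) => n; rewrite geq_max => /andP[/h0 k0 /h1 k1].
  rewrite /prod_norm /= [eps]splitr lerD//.
  by under eq_bigr do rewrite !mxE.
Qed.

End Products.

Section Baire.
Variables (V : lmodType C) (N : V -> R) (P : set V).
Hypothesis bP : is_banach N P.
Let nN := banach_norm bP.

(** Baire's theorem. If it failed, every ball would contain a smaller one at positive distance from
    [F n]; balls nested in this way, with radii at least halved each time, would shrink to a point
    of [P] outside all [F n]. *)
Lemma baire_closure_ball (F : nat -> set V) : (forall z, P z -> exists n, F n z) ->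
  exists n z0 r, [/\ P z0, 0 < r & forall z, P z -> N (z - z0) <= r ->
    forall eps, 0 < eps -> exists2 y, F n y & N (z - y) <= eps].
Proof.
move=> covF; apply: contrapT => H.
have [|f fP] := choice_on (Y := (V * R)%type)
  (P := fun c : nat * (V * R) => P c.2.1 /\ 0 < c.2.2)
  (Q := fun c d => [/\ P d.1, 0 < d.2, d.2 <= c.2.2 / 2, N (d.1 - c.2.1) <= c.2.2 / 2 &
     forall y, F c.1 y -> d.2 < N (d.1 - y)]).
  move=> [n [z0 r]] /= [Pz0 r0]; have r20 : 0 < r / 2 by rewrite divr_gt0.
  have [z [Pz zr [eps [e0 he]]]] : exists z, [/\ P z, N (z - z0) <= r / 2 &
      exists eps, 0 < eps /\ forall y, F n y -> eps < N (z - y)].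
    apply: contrapT => H'; apply: H; exists n, z0, (r / 2); split=> // z Pz zr eps e0.
    apply: contrapT => H''; apply: H'; exists z; split=> //; exists eps; split=> // y Fy.
    by rewrite ltNge; apply/negP => le_y; apply: H''; exists y.
  exists (z, Num.min eps (r / 2)); rewrite /= lt_min e0 r20 ge_min lexx orbT; split=> //.
  by move=> y /he; apply: le_lt_trans; rewrite ge_min lexx.
pose c := fix c n := if n is n'.+1 then f (n', c n') else (0, 1).
have cP n : P (c n).1 /\ 0 < (c n).2.
  elim: n => [|n IH]; first by split => //=; apply: subspace0 (banach_subspace bP).
  by have [] := fP (n, c n) IH.
have cS n := fP (n, c n) (cP n).
have c2 n : (c n).2 <= 2^-1 ^+ n.
  elim: n => [|n IH]; first by rewrite expr0.
  have [_ _ h _ _] := cS n; apply: (le_trans h) => /=.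
  by rewrite exprSr ler_pM2r ?invr_gt0.
(* All later balls lie in the [n]-th one, hence so does the limit of the centres. *)
have cc n k : N ((c (n + k)%N).1 - (c n).1) + (c (n + k)%N).2 <= (c n).2.
  elim: k => [|k IH]; first by rewrite addn0 subrr norm0// add0r.
  rewrite addnS; have [_ _ /= h1 h2 _] := cS (n + k)%N.
  have := norm_split nN (c (n + k).+1).1 (c (n + k)%N).1 (c n).1.
  by move: h1 h2 IH; rewrite [f _]/(c (n + k).+1); lra.
have [|l Pl lim] := banach_complete bP (u := fun n => (c n).1) (K := 1) (fun n => (cP n).1).
  move=> n; rewrite mul1r; have [_ _ _ /= h _] := cS n; apply: (le_trans h).
  by have := c2 n; have := (cP n).2; lra.
have [n Fl] := covF _ Pl; have [_ _ _ _ /(_ _ Fl)] := cS n.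
rewrite -/(c n.+1) => lt_l; suff : N ((c n.+1).1 - l) <= (c n.+1).2.
  by move=> /(lt_le_trans lt_l); rewrite ltxx.
apply/ler_addgt0Pr => eps e0.
have [n0 h] := lim _ e0; have := h (n.+1 + n0)%N (leq_addl _ _).
have := cc n.+1 n0; have := (cP (n.+1 + n0)%N).2.
have := norm_split nN (c n.+1).1 (c (n.+1 + n0)%N).1 l.
rewrite (norm_distC nN (c n.+1).1 (c (n.+1 + n0)%N).1); lra.
Qed.

End Baire.

Section Maps.
Variables (V1 V2 : lmodType C) (N1 : V1 -> R) (N2 : V2 -> R).
Variables (P1 : set V1) (P2 : set V2) (D : V1 -> V2).
Hypotheses (b1 : is_banach N1 P1) (b2 : is_banach N2 P2).
Hypotheses (bD : bounded_map N1 N2 D) (DP : forall y, P1 y -> P2 (D y)).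
Let n1 := banach_norm b1.
Let n2 := banach_norm b2.
Let s1 := banach_subspace b1.
Let s2 := banach_subspace b2.

(** Baire's theorem for the images of the balls of integer radius gives approximate preimages, which
    [approx_onto] makes exact. *)
Lemma open_mapping : (forall z, P2 z -> exists2 y, P1 y & D y = z) ->
  exists2 K, 0 <= K & forall z, P2 z -> exists y, [/\ P1 y, D y = z & N1 y <= K * N2 z].
Proof.
move=> ontoD; have [linD [M M0 DM]] := bD.
have [|n [z0 [r [Pz0 r0 hr]]]] := baire_closure_ball b2
    (F := fun n => [set D y | y in [set y | P1 y /\ N1 y <= n%:R]]).
  move=> z /ontoD[y Py <-]; exists (Num.truncn (N1 y)).+1; exists y => //=.
  by split=> //; apply/ltW/truncnS_gt.
have [K0 K0P] : exists K, 0 <= K /\ forall z, P2 z ->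
    exists y, [/\ P1 y, N1 y <= K * N2 z & N2 (z - D y) <= N2 z / 2].
  exists (2 * n%:R / r); split; first by rewrite !mulr_ge0// invr_ge0 ltW.
  move=> z Pz; have [z00|z00] := eqVneq (N2 z) 0.
    exists 0; rewrite z00 mulr0 mul0r (norm0 n1) linear_map0// subr0 z00.
    by split=> //; apply: subspace0.
  have zp : 0 < N2 z by rewrite lt_neqAle eq_sym z00 (norm_ge0 n2).
  (* [t z] has norm [r], so [t z + z0] and [z0] both lie in the ball of Baire's theorem. Images of
     vectors of norm at most [n] approximate each of them up to [r / 4]; the difference approximates
     [t z] up to [r / 2], with a preimage of norm at most [2 n]. *)
  pose t := r / N2 z; have tp : 0 < t by rewrite divr_gt0.
  have tzE : rnorm t%:C%C * N2 z = r by rewrite rnorm_real gtr0_norm// divfK.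
  have e0 : 0 < r / 4 by rewrite divr_gt0.
  have Ptz : P2 (t%:C%C *: z) by apply: subspaceZ.
  have [||_ [a [Pa Na] <-] ha] := hr (t%:C%C *: z + z0) _ _ _ e0.
  - exact: subspaceD.
  - by rewrite addrK (normZ n2) tzE.
  have [|_ [b [Pb Nb] <-] hb] := hr z0 Pz0 _ _ e0.
    by rewrite subrr norm0// ltW.
  have tC : t%:C%C != 0 :> C by apply/eqP => /(congr1 (@complex.Re R))/= t0; rewrite t0 ltxx in tp.
  exists ((t%:C%C)^-1 *: (a - b)); split.
  - by apply: subspaceZ => //; apply: subspaceB.
  - rewrite (normZ n1) rnormV rnorm_real gtr0_norm// invf_div.
    have := normB n1 a b => ab.
    have : N1 (a - b) <= 2 * n%:R by lra.
    have q0 : 0 <= N2 z / r by rewrite divr_ge0 ?ltW.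
    move=> /(ler_wpM2l q0)/le_trans; apply.
    by rewrite le_eqVlt; apply/orP; left; apply/eqP; field; rewrite gt_eqF.
  - have -> : z - D ((t%:C%C)^-1 *: (a - b)) =
        (t%:C%C)^-1 *: ((t%:C%C *: z + z0 - D a) - (z0 - D b)).
      rewrite linear_mapZ// linear_mapB// -{1}[z](scalerK tC) -scalerBr.
      by module.
    rewrite (normZ n2) rnormV rnorm_real gtr0_norm//.
    have := normB n2 (t%:C%C *: z + z0 - D a) (z0 - D b) => ab.
    have : N2 ((t%:C%C *: z + z0 - D a) - (z0 - D b)) <= r / 2 by lra.
    have q0 : 0 <= t^-1 by rewrite invr_ge0 ltW.
    move=> /(ler_wpM2l q0)/le_trans; apply; rewrite invf_div.
    by rewrite mulrA divfK ?gt_eqF.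
exists (2 * K0); first by rewrite mulr_ge0//; have [] := K0P.
have [K00 KP] := K0P; exact: (approx_onto n1 n2 b1 s2 bD DP K00 KP).
Qed.

End Maps.
End OpenMapping.

(** * Finite-dimensional quotients and finite nets *)

Section FiniteQuotients.
Variable K : fieldType.

(** Modulo the preimage of [B'], which lies in [B], the space [Z] embeds into [Z' / B']. The vectors
    spanning the latter need not come from [Z], so a family in [Z] is extracted from them by
    Gaussian elimination. *)
Lemma fin_dim_quotient_sub (V V' : lmodType K) (g : V -> V') (Z B : set V)
    (Z' B' : set V') :
  linear g -> is_subspace Z -> is_subspace B' -> fin_dim_quotient Z' B' ->
  (forall z, Z z -> Z' (g z)) -> (forall z, Z z -> B' (g z) -> B z) ->
  fin_dim_quotient Z B.
Proof.
move=> ling subZ subB [m [v [_ spanv]]] gZ.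
have {gZ spanv} : forall z, Z z -> exists c : 'I_m -> K, B' (g z - \sum_(i < m) c i *: v i).
  by move=> z /gZ /spanv.
elim: m Z subZ v => [|m IH] Z subZ v spanv BB.
  exists 0%N, (fun=> 0); split=> [[]//|z Zz]; exists (fun=> 0).
  rewrite big_ord0 subr0; apply: BB => //.
  by have [c] := spanv z Zz; rewrite big_ord0 subr0.
pose Z1 : set V := [set z | Z z /\ exists c : 'I_m -> K,
  B' (g z - \sum_(i < m) c i *: v (lift ord0 i))].
have subZ1 : is_subspace Z1.
  split.
    split; first exact: subspace0.
    exists (fun=> 0); rewrite (linear_map0 ling) big1 ?subr0; first exact: subspace0.
    by move=> i _; rewrite scale0r.
  move=> a x y [Zx [c cP]] [Zy [d dP]]; split; first exact: subZ.2.
  exists (fun i => a * c i + d i).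
  have -> : g (a *: x + y) - \sum_(i < m) (a * c i + d i) *: v (lift ord0 i) =
      a *: (g x - \sum_(i < m) c i *: v (lift ord0 i)) +
      (g y - \sum_(i < m) d i *: v (lift ord0 i)).
    have -> : \sum_(i < m) (a * c i + d i) *: v (lift ord0 i) =
        a *: (\sum_(i < m) c i *: v (lift ord0 i)) + \sum_(i < m) d i *: v (lift ord0 i).
      rewrite scaler_sumr -big_split; apply: eq_bigr => i _.
      by rewrite scalerDl scalerA.
    by rewrite (linear_mapD ling) (linear_mapZ ling); module.
  exact: subB.2.
have [k [u [uZ uP]]] : fin_dim_quotient Z1 B.
  apply: (IH _ subZ1 (fun i => v (lift ord0 i))); first by move=> z [].
  by move=> z [Zz _]; apply: BB.
(* A pivot [z0], if there is one: subtracting a multiple of it moves every element of [Z] into [Z1],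
   where the first spanning vector does not occur. *)
have [[z0 [c [Zz0 c0 cP]]]|no] := pselect (exists z0 (c : 'I_m.+1 -> K),
    [/\ Z z0, c ord0 != 0 & B' (g z0 - \sum_(i < m.+1) c i *: v i)]).
  exists k.+1, (fun i => if unlift ord0 i is Some j then u j else z0); split.
    by move=> i; case: unliftP => [j _|_//]; have [] := uZ j.
  move=> z Zz; have [d dP] := spanv z Zz.
  have /uP[e eP] : Z1 (z - (d ord0 / c ord0) *: z0).
    split; first by apply: subspaceB => //; apply: subspaceZ.
    exists (fun i => d (lift ord0 i) - d ord0 / c ord0 * c (lift ord0 i)).
    have := subB.2 (- (d ord0 / c ord0)) _ _ cP dP; congr (B' _).
    rewrite !big_ord_recl (linear_mapB ling) (linear_mapZ ling).
    have -> : \sum_(i < m) (d (lift ord0 i) - d ord0 / c ord0 * c (lift ord0 i)) *: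
          v (lift ord0 i) =
        \sum_(i < m) d (lift ord0 i) *: v (lift ord0 i) -
        (d ord0 / c ord0) *: \sum_(i < m) c (lift ord0 i) *: v (lift ord0 i).
      rewrite scaler_sumr -sumrB; apply: eq_bigr => i _.
      by rewrite scalerBl scalerA.
    have -> : d ord0 *: v ord0 = (d ord0 / c ord0) *: (c ord0 *: v ord0).
      by rewrite scalerA divfK.
    by set a := d ord0 / c ord0; module.
  exists (fun i => if unlift ord0 i is Some j then e j else d ord0 / c ord0).
  move: eP; congr (B _); rewrite big_ord_recl unlift_none opprD addrA; congr (_ - _).
  by apply: eq_bigr => i _; rewrite liftK.
exists k, u; split=> [i|z Zz]; first by have [] := uZ i.
apply: uP; split=> //; have [c cP] := spanv z Zz.
exists (fun i => c (lift ord0 i)); move: (cP); rewrite big_ord_recl.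
have -> : c ord0 = 0 by apply: contrapT => /eqP c0; apply: no; exists z, c.
by rewrite scale0r add0r.
Qed.

Lemma fin_dim_quotient_trans (V : lmodType K) (Z Z1 B : set V) m (v : 'I_m -> V) :
  fin_dim_quotient Z Z1 -> (forall i, Z (v i)) ->
  (forall z, Z1 z -> exists c : 'I_m -> K, B (z - \sum_(i < m) c i *: v i)) ->
  fin_dim_quotient Z B.
Proof.
move=> [k [u [uZ uP]]] vZ vP.
pose glue T (f : 'I_k -> T) (h : 'I_m -> T) i :=
  match fintype.split i with inl j => f j | inr j => h j end.
have gluel T f h i : @glue T f h (lshift m i) = f i.
  by rewrite /glue (unsplitK (inl i)).
have gluer T f h i : @glue T f h (rshift k i) = h i.
  by rewrite /glue (unsplitK (inr i)).
exists (k + m)%N, (glue V u v); split.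
  by move=> i; rewrite /glue; case: fintype.split.
move=> z /uP[c /vP[d dP]]; exists (glue K c d); move: dP; congr (B _).
rewrite big_split_ord/= opprD addrA; congr (_ - _ - _).
  by apply: eq_bigr => i _; rewrite !gluel.
by apply: eq_bigr => i _; rewrite !gluer.
Qed.

Lemma fin_dim_quotient_full (V : lmodType K) (Z B : set V) :
  (forall z, Z z -> B z) -> fin_dim_quotient Z B.
Proof.
move=> ZB; exists 0%N, (fun=> 0); split=> [[]//|z /ZB Bz].
by exists (fun=> 0); rewrite big_ord0 subr0.
Qed.

End FiniteQuotients.

Section Nets.
Variable R : realType.
Local Notation C := R[i].

Lemma interval_net (K e : R) : 0 < e ->
  exists l : seq R, forall x, `|x| <= K -> exists2 y, y \in l & `|x - y| <= e.
Proof.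
move=> e0; exists [seq e * n%:R - K | n <- iota 0 (Num.truncn (2 * K / e)).+1] => x.
rewrite ler_norml => /andP[x1 x2]; pose n := Num.truncn ((x + K) / e).
have q0 : 0 <= (x + K) / e by rewrite divr_ge0 ?(ltW e0)//; lra.
exists (e * n%:R - K).
  apply/mapP; exists n => //; rewrite mem_iota /= add0n ltnS.
  by apply: le_truncn; rewrite ler_pM2r ?invr_gt0//; lra.
have /andP[n1 n2] := truncn_itv q0.
move: n1 n2; rewrite -/n ler_pdivlMr// ltr_pdivrMr// -natr1 => n1 n2.
by rewrite ler_norml; apply/andP; split; lra.
Qed.

Lemma disc_net (K e : R) : 0 < e ->
  exists l : seq C, forall c, rnorm c <= K -> exists2 c', c' \in l & rnorm (c - c') <= e.
Proof.
move=> e0; have e20 : 0 < e / 2 by rewrite divr_gt0.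
have [l lP] := @interval_net K _ e20.
exists [seq (a +i* b)%C | a <- l, b <- l] => c cK.
have [a la ha] := lP _ (le_trans (Re_le_rnorm c) cK).
have [b lb hb] := lP _ (le_trans (Im_le_rnorm c) cK).
exists (a +i* b)%C; first by apply/allpairsP; exists (a, b).
by apply: (le_trans (rnorm_le_ReIm _)); rewrite !raddfB /=; lra.
Qed.

Lemma combination_net (V : lmodType C) (N : V -> R) (nN : is_norm N) (P : set V)
    (sP : is_subspace P) m (v : 'I_m -> V) (K e : R) : (forall i, P (v i)) -> 0 < e ->
  exists l : seq V, (forall w, w \in l -> P w) /\
    forall c : 'I_m -> C, (forall i, rnorm (c i) <= K) ->
    exists2 w, w \in l & N (\sum_(i < m) c i *: v i - w) <= e.
Proof.
elim: m v e => [|m IH] v e Pv e0.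
  exists [:: 0]; split=> [w|c _]; first by rewrite inE => /eqP->; apply: subspace0.
  exists 0; rewrite ?inE//.
  by rewrite big_ord0 subr0 norm0// ltW.
have e20 : 0 < e / 2 by rewrite divr_gt0.
have v0 : 0 < N (v ord0) + 1 by rewrite ltr_wpDl ?norm_ge0.
have [l [Pl lP]] := IH (fun i => v (lift ord0 i)) _ (fun i => Pv _) e20.
have [|l' lP'] := @disc_net K (e / 2 / (N (v ord0) + 1)); first by rewrite divr_gt0.
exists [seq a *: v ord0 + w | a <- l', w <- l]; split=> [_ /allpairsP[[a w] [_ /= lw ->]]|c cK].
  by apply: subspaceD => //; [exact: subspaceZ | exact: Pl].
have [a la ha] := lP' _ (cK ord0).
have [w lw hw] := lP (fun i => c (lift ord0 i)) (fun i => cK _).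
exists (a *: v ord0 + w); first by apply/allpairsP; exists (a, w).
rewrite big_ord_recl /=; set s := \sum_(i < m) _.
have -> : c ord0 *: v ord0 + s - (a *: v ord0 + w) = (c ord0 - a) *: v ord0 + (s - w).
  by module.
apply: (le_trans (normD nN _ _)); rewrite (normZ nN).
have : rnorm (c ord0 - a) * N (v ord0) <= e / 2.
  move: ha; rewrite ler_pdivlMr// mulrDr mulr1 => ha.
  by have := rnorm_ge0 (c ord0 - a); lra.
lra.
Qed.

End Nets.

Section FiniteCodimension.
Variable R : realType.
Local Notation C := R[i].
Variables (V1 V2 : lmodType C) (N1 : V1 -> R) (N2 : V2 -> R).
Variables (P1 : set V1) (P2 : set V2) (D : V1 -> V2).
Hypotheses (b1 : is_banach N1 P1) (b2 : is_banach N2 P2).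
Hypotheses (bD : bounded_map N1 N2 D) (DP : forall y, P1 y -> P2 (D y)).
Let n1 := banach_norm b1.
Let n2 := banach_norm b2.
Let s1 := banach_subspace b1.
Let s2 := banach_subspace b2.
Let linD : linear D. Proof. by case: bD. Qed.

(** With [m] vectors adjoined to the range of [D], finite codimension becomes surjectivity, to which
    the open mapping theorem applies. *)
Definition extend_map m (v : 'I_m -> V2) (x : V1 * 'rV[C]_m) : V2 :=
  D x.1 + \sum_(i < m) x.2 0 i *: v i.

Lemma bounded_extend_map m (v : 'I_m -> V2) :
  bounded_map (prod_norm N1 (m := m)) N2 (extend_map v).
Proof.
have [_ [M M0 DM]] := bD; split.
  move=> c [x a] [y b]; rewrite /extend_map /= linD scalerDr addrACA; congr (_ + _).
  rewrite scaler_sumr -big_split /=; apply: eq_bigr => i _.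
  by rewrite !mxE scalerDl scalerA.
have S0 : 0 <= \sum_(i < m) N2 (v i) by apply: sumr_ge0 => i _; apply: norm_ge0.
exists (M + \sum_(i < m) N2 (v i)); first by rewrite addr_ge0.
move=> [x a]; rewrite /extend_map /prod_norm /=.
apply: (le_trans (normD n2 _ _)); rewrite mulrDl lerD//.
  apply: (le_trans (DM x)); apply: ler_wpM2l => //; rewrite lerDl.
  by apply: sumr_ge0 => i _; apply: rnorm_ge0.
apply: (le_trans (norm_sum n2 _ _ _)); rewrite mulr_suml; apply: ler_sum => i _.
rewrite (normZ n2) mulrC ler_wpM2l ?norm_ge0// (bigD1 i)//= addrCA lerDl.
by rewrite addr_ge0 ?norm_ge0//; apply: sumr_ge0 => j _; apply: rnorm_ge0.
Qed.

Lemma fin_codim_open m (v : 'I_m -> V2) : (forall i, P2 (v i)) ->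
  (forall z, P2 z -> exists c : 'I_m -> C, (D @` P1) (z - \sum_(i < m) c i *: v i)) ->
  exists2 K, 0 <= K & forall z, P2 z -> exists y (c : 'I_m -> C),
    [/\ P1 y, z = D y + \sum_(i < m) c i *: v i, N1 y <= K * N2 z &
        forall i, rnorm (c i) <= K * N2 z].
Proof.
move=> Pv spanv.
have [|z Pz|K K0 KP] := open_mapping (banach_prod m b1) b2 (bounded_extend_map v).
- move=> [y c] /= Py; apply: subspaceD => //; first exact: DP.
  by apply: subspace_sum => // i _; apply: subspaceZ.
- have [c [y Py Dy]] := spanv z Pz; exists (y, \row_i c i) => //.
  rewrite /extend_map /= Dy; under [X in _ - _ + X]eq_bigr do rewrite mxE.
  by rewrite subrK.
exists K => // z /KP[[y c] [/= Py zE]]; rewrite /prod_norm /= => le_K.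
have s0 : 0 <= \sum_(i < m) rnorm (c 0 i) by apply: sumr_ge0 => i _; apply: rnorm_ge0.
exists y, (fun i => c 0 i); split=> //; first by apply: le_trans le_K; rewrite lerDl.
move=> i; apply: le_trans le_K; rewrite (bigD1 i)//= addrCA lerDl addr_ge0 ?norm_ge0//.
by apply: sumr_ge0 => j _; apply: rnorm_ge0.
Qed.

(* Up to a bounded part of the range of D, the unit ball of P2 is within e of
   the finite set l. *)
Definition has_net (K : R) (l : seq V2) (e : R) : Prop :=
  forall z, P2 z -> N2 z <= 1 -> exists y w,
    [/\ P1 y, N1 y <= K, w \in l & N2 (z - D y - w) <= e].

Lemma fin_codim_net : fin_dim_quotient P2 (D @` P1) ->
  exists2 K, 0 <= K & forall e, 0 < e -> exists l, has_net K l e.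
Proof.
move=> [m [v [Pv spanv]]]; have [K K0 KP] := fin_codim_open Pv spanv.
exists K => // e e0; have [l [_ lP]] := combination_net n2 s2 K Pv e0.
exists l => z Pz z1; have [y [c [Py zE yK cK]]] := KP z Pz.
have Kz : K * N2 z <= K by rewrite ler_piMr.
have [w lw hw] := lP c (fun i => le_trans (cK i) Kz).
exists y, w; split=> //; first exact: le_trans Kz.
rewrite zE; move: hw; set s := \sum_(_ < _) _ => hw.
by have -> : D y + s - D y - w = s - w by module.
Qed.

(* Each element of the net is replaced by a point of the unit ball that it
   approximates; together with D these points cover P2 up to a contraction. *)
Lemma net_fin_codim K l : has_net K l 4^-1 -> fin_dim_quotient P2 (D @` P1).
Proof.
move=> lP; pose S w z := [/\ P2 z, N2 z <= 1 &
  exists y, [/\ P1 y, N1 y <= K & N2 (z - D y - w) <= 4^-1]].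
have [|g gP] := choice_on (Y := V2) (P := fun=> True)
    (Q := fun w z => P2 z /\ ((exists z', S w z') -> S w z)).
  move=> w _; have [[z Sz]|no] := pselect (exists z', S w z').
    by exists z; split=> //; case: Sz.
  by exists 0; split=> //; apply: subspace0.
pose v (i : 'I_(size l)) := g (nth 0 l i).
have Pv i : P2 (v i) by have [] := gP (nth 0 l i) Logic.I.
have K0 : 0 <= K.
  have [||y [w [_ yK _ _]]] := lP 0; first exact: subspace0.
    by rewrite norm0.
  exact: le_trans (norm_ge0 n1 y) yK.
have K20 : 0 <= K * 2 + 1 by rewrite addr_ge0 ?mulr_ge0.
(* The normalized [z] and the chosen point [v j] are both within 1/4 of the same [w] modulo [D].
   Hence [z / N2 z - v j] is within 1/2 of [D (y - y')], the factor required by [approx_onto]; the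
   bound is [2 K] for [y - y'] plus 1 for the coefficient of [v j]. *)
have approx z : P2 z -> exists x, [/\ P1 x.1,
    prod_norm N1 (m := size l) x <= (K * 2 + 1) * N2 z &
    N2 (z - extend_map v x) <= N2 z / 2].
  move=> Pz; have [z0|z0] := eqVneq (N2 z) 0.
    exists 0; rewrite /= z0 mulr0 mul0r; split; first exact: subspace0.
      by rewrite (norm0 (banach_norm (banach_prod _ b1))).
    by rewrite (linear_map0 (bounded_extend_map v).1) subr0 z0.
  have zp : 0 < N2 z by rewrite lt_neqAle eq_sym z0 (norm_ge0 n2).
  set t : C := ((N2 z)%:C)%C.
  have t0 : t != 0 by apply/eqP => /(congr1 (@complex.Re R)) /= h; rewrite h ltxx in zp.
  have tn : rnorm t = N2 z by rewrite rnorm_real gtr0_norm.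
  have Pu : P2 (t^-1 *: z) by apply: subspaceZ.
  have Nu : N2 (t^-1 *: z) <= 1 by rewrite (normZ n2) rnormV tn mulVf.
  have [y [w [Py yK lw hw]]] := lP _ Pu Nu.
  have ltw : (index w l < size l)%N by rewrite index_mem.
  pose j := Ordinal ltw.
  have [_ _ [y' [Py' y'K hy']]] : S w (v j).
    rewrite /v nth_index//; apply: (gP w Logic.I).2.
    by exists (t^-1 *: z); split=> //; exists y.
  exists (t *: (y - y'), t *: delta_mx 0 j); split=> /=.
  - by apply: subspaceZ => //; apply: subspaceB.
  - rewrite /prod_norm /= (bigD1 j)//= big1 => [|i neq]; last first.
      by rewrite !mxE eqxx (negbTE neq) mulr0 rnorm0.
    rewrite !mxE !eqxx mulr1 addr0 (normZ n1) tn mulrC -{2}[N2 z]mul1r -mulrDl.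
    by rewrite ler_pM2r//; have := normB n1 y y'; lra.
  - have -> : z - extend_map v (t *: (y - y'), t *: delta_mx 0 j) =
        t *: ((t^-1 *: z - D y - w) - (v j - D y' - w)).
      rewrite /extend_map /= (bigD1 j)//= big1 => [|i neq]; last first.
        by rewrite !mxE eqxx (negbTE neq) mulr0 scale0r.
      rewrite !mxE !eqxx mulr1 addr0 (linear_mapZ linD) (linear_mapB linD).
      by rewrite -[in LHS](scalerKV t0 z); module.
    rewrite (normZ n2) tn ler_pM2l//.
    by have := normB n2 (t^-1 *: z - D y - w) (v j - D y' - w); lra.
exists (size l), v; split=> // z Pz.
have extP x : P1 x.1 -> P2 (extend_map v x).
  move=> Px; apply: subspaceD => //; first exact: DP.
  by apply: subspace_sum => // i _; apply: subspaceZ.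
have bp := banach_prod (size l) b1.
have [[y c] [/= Py <- _]] := approx_onto (banach_norm bp) n2 bp s2
    (bounded_extend_map v) extP K20 approx Pz.
by exists (fun i => c 0 i), y => //; rewrite /extend_map /= addrK.
Qed.

(* A finite-dimensional complement of the range meets it only in 0 when its
   dimension is minimal, so that the open mapping provides bounded preimages. *)
Lemma fin_codim_lift : fin_dim_quotient P2 (D @` P1) ->
  exists2 K, 0 <= K & forall y, P1 y ->
    exists y', [/\ P1 y', D y' = D y & N1 y' <= K * N2 (D y)].
Proof.
pose spans m := `[< exists v : 'I_m -> V2, (forall i, P2 (v i)) /\
  forall z, P2 z -> exists c : 'I_m -> C, (D @` P1) (z - \sum_(i < m) c i *: v i) >].
move=> [m0 m0P]; have exm : exists m, spans m by exists m0; apply/asboolP.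
have [m /asboolP[v [Pv spanv]] minm] := ex_minnP exm.
have [K K0 KP] := fin_codim_open Pv spanv; exists K => // y Py.
have [y' [c [Py' DyE y'K _]]] := KP _ (DP Py); exists y'; split=> //.
rewrite DyE [X in _ = _ + X](_ : _ = 0) ?addr0//; apply: big1 => i _.
have [-> //|ci] := eqVneq (c i) 0; first by rewrite scale0r.
move: v Pv spanv minm KP c DyE i ci.
case: m => [|m] v Pv spanv minm KP c DyE i ci; first by have := ltn_ord i.
(* [D (y - y')] equals the combination of the [v j] with coefficients [c j], so a nonzero [c i]
   expresses [v i] through the others modulo the range, and [v i] could be dropped. *)
have /minm : spans m; last by rewrite ltnn.
apply/asboolP; exists (fun j => v (lift i j)); split=> // z /spanv[d [x Px Dx]].
exists (fun j => d (lift i j) - d i / c i * c (lift i j)).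
exists (x + (d i / c i) *: (y - y')).
  by apply: subspaceD => //; apply: subspaceZ => //; apply: subspaceB.
rewrite (linear_mapD linD) (linear_mapZ linD) (linear_mapB linD) DyE Dx.
rewrite !(bigD1_ord i)//=.
have -> : \sum_(j < m) (d (lift i j) - d i / c i * c (lift i j)) *: v (lift i j) =
    \sum_(j < m) d (lift i j) *: v (lift i j) -
    (d i / c i) *: \sum_(j < m) c (lift i j) *: v (lift i j).
  by rewrite scaler_sumr -sumrB; apply: eq_bigr => j _; rewrite scalerBl scalerA.
have -> : d i *: v i = (d i / c i) *: (c i *: v i) by rewrite scalerA divfK.
by set a := d i / c i; module.
Qed.

End FiniteCodimension.

Section ComplexDisc.
Variable R : realType.
(* The topology of R[i] is only available through its numFieldType structure. *)
Local Notation C := (Num.NumField.sort (R[i] : numFieldType)).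

Lemma compact_disc (r : R) : compact [set c : C | rnorm c <= r].
Proof.
pose f (x : R * R) : C := (x.1 +i* x.2)%C.
have cf : continuous f.
  move=> [a b]; apply/cvgrPdist_le => e e0.
  have er0 : 0 < complex.Re e by move: e0; rewrite ltcE => /andP[].
  have eE : e = (complex.Re e)%:C%C by rewrite RRe_real// gtr0_real.
  have e20 : 0 < complex.Re e / 2 by rewrite divr_gt0.
  exists (ball a (complex.Re e / 2), ball b (complex.Re e / 2)).
    by split; apply: nbhsx_ballx.
  move=> [x y] [/= ax yb]; rewrite eE rnormE lecR; apply: (le_trans (rnorm_le_ReIm _)).
  rewrite !raddfB /=; move: ax yb; rewrite /ball /= => ax yb; lra.
apply: (@subclosed_compact _ _ (f @` (`[- r, r]%classic `*` `[- r, r]%classic))).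
- rewrite -[X in closed X]setCK; apply: open_closedC; rewrite openE => c /= /negP.
  rewrite -ltNge => ltr; apply/nbhs_ballP.
  exists (rnorm c - r)%:C%C; first by rewrite /= ltcR subr_gt0.
  move=> c'; rewrite -ball_normE /= rnormE ltcR => cc'; apply/negP; rewrite -ltNge.
  by have := norm_le_dist (rnorm_is_norm (R[i] : numFieldType)) c c'; lra.
- apply: continuous_compact; first exact: continuous_subspaceT.
  by apply: compact_setX; apply: segment_compact.
- move=> c /= cr; exists (complex.Re c, complex.Im c); last by case: c cr.
  split; rewrite /= in_itv /= -ler_norml; apply: le_trans cr.
    exact: Re_le_rnorm.
  exact: Im_le_rnorm.
Qed.

(** Compactness of the disc, in the form that turns locally uniform constants into a single one. *)
Lemma locally_bounded_disc (r : R) (P : nat -> C -> Prop) :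
  (forall n m c, (n <= m)%N -> P n c -> P m c) ->
  (forall c, exists n d, 0 < d /\ forall c', rnorm (c' - c) <= d -> P n c') ->
  exists n, forall c, rnorm c <= r -> P n c.
Proof.
move=> monoP locP; have /compact_near_coveringP := @compact_disc r.
move=> /(_ nat (\oo : set_system nat) P _).
case.
  move=> c _; have [n [d [d0 Pn]]] := locP c.
  exists ([set c' | rnorm (c' - c) <= d], [set m | (n <= m)%N]); last first.
    by move=> [c' m] [/= /Pn + nm]; apply: monoP.
  split; last by exists n.
  have dc : 0 < d%:C%C :> C by rewrite ltcR.
  apply/nbhs_ballP; exists d%:C%C => //= c'.
  by rewrite -ball_normE /= rnormE ltcR -rnormN opprB => /ltW.
by move=> n _ /(_ n (leqnn n)) h; exists n => c; apply: h.
Qed.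

End ComplexDisc.

(** * A spectral criterion for finite codimension *)

Section BoundedResolvent.
Variable R : realType.
Local Notation C := R[i].
Variables (V : lmodType C) (W : set V) (q : V -> R) (A : V -> V) (M : R).
Hypotheses (subW : is_subspace W) (linA : linear A) (AW : forall u, W u -> W (A u)).
Hypotheses (q_ge0 : forall u, 0 <= q u).
Hypotheses (qD : forall u v, W u -> W v -> q (u + v) <= q u + q v).
Hypotheses (qZ : forall c u, W u -> q (c *: u) = rnorm c * q u).
Hypotheses (M_gt0 : 0 < M) (qA : forall u, W u -> q (A u) <= M * q u).

Local Notation T c := (fun u : V => A u - c *: u).

Let linT c : linear (T c).
Proof. by move=> a u v /=; rewrite linA; module. Qed.

Let TW c u : W u -> W (T c u).
Proof. by move=> Wu; apply: subspaceB => //; [exact: AW | exact: subspaceZ]. Qed.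

Let qN u : W u -> q (- u) = q u.
Proof. by move=> Wu; rewrite -scaleN1r qZ// rnormN rnorm1 mul1r. Qed.

Let qB u v : W u -> W v -> q (u - v) <= q u + q v.
Proof. by move=> Wu Wv; rewrite -(qN Wv) qD//; apply: subspaceN. Qed.

(** Plays the role of a right inverse of [A - c] of norm at most [K] on the completion of [W] modulo
    the kernel of [q], without forming this space. *)
Definition approx_inverse (K : R) (c : C) : Prop := forall e, 0 < e ->
  forall v, W v -> exists u, [/\ W u, q u <= K * q v & q (v - T c u) <= e].

Definition bounded_below (K : R) (c : C) : Prop :=
  forall u, W u -> q u <= K * q (T c u).

(** The iteration of [approx_onto], stopped after finitely many steps: [W] has no limits, and any
    prescribed error suffices. *)
Lemma approx_inverse_iter K c : 0 <= K ->
  (forall v, W v -> exists u, [/\ W u, q u <= K * q v & q (v - T c u) <= q v / 2]) ->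
  approx_inverse (2 * K) c.
Proof.
move=> K0 half e e0 v Wv; have [n hn] := geometric_small (q v) e0.
have [u [Wu uK uv]] : exists u, [/\ W u, q u <= 2 * K * (1 - 2^-1 ^+ n) * q v &
    q (v - T c u) <= q v * 2^-1 ^+ n].
  elim: (n) => [|k [u [Wu uK uv]]].
    exists 0; split; first exact: subspace0.
      by rewrite -(scale0r v) qZ// rnorm0 mul0r expr0 subrr mulr0 mul0r.
    by rewrite (linear_map0 (linT c)) subr0 expr0 mulr1.
  have Wr : W (v - T c u) by apply: subspaceB => //; apply: TW.
  have [w [Ww wK wr]] := half _ Wr; exists (u + w); split; first exact: subspaceD.
    apply: (le_trans (qD Wu Ww)); apply: (le_trans (lerD uK wK)).
    have := ler_wpM2l K0 uv; rewrite exprS; set a := _ ^+ k; lra.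
  have -> : v - T c (u + w) = v - T c u - T c w.
    by rewrite (linear_mapD (linT c)) opprD addrA.
  by apply: (le_trans wr); rewrite exprS; lra.
exists u; split=> //; last exact: le_trans (hn _ (leqnn n)).
apply: (le_trans uK); apply: ler_wpM2r => //; apply: ler_piMr; first by rewrite mulr_ge0.
by rewrite gerBl exprn_ge0// invr_ge0.
Qed.

Lemma approx_inverse_weaken K K' c : K <= K' -> approx_inverse K c -> approx_inverse K' c.
Proof.
move=> KK' inv e e0 v Wv; have [u [Wu uK uv]] := inv e e0 v Wv.
by exists u; split=> //; apply: (le_trans uK); apply: ler_wpM2r.
Qed.

Lemma approx_inverse_near K c : 0 <= K ->
  (forall v, W v -> exists u, [/\ W u, q u <= K * q v & q (v - T c u) <= q v / 4]) ->
  exists d, 0 < d /\ forall c', rnorm (c' - c) <= d -> approx_inverse (2 * K) c'.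
Proof.
move=> K0 inv; have K1 : 0 < 4 * (K + 1) by lra.
(* This radius makes [rnorm (c' - c) * K] at most 1/4, which together with the given 1/4 is the 1/2
   that [approx_inverse_iter] asks for. *)
exists (4 * (K + 1))^-1; split=> [|c' cc']; first by rewrite invr_gt0.
apply: approx_inverse_iter => // v Wv; have [u [Wu uK uv]] := inv v Wv.
exists u; split=> //.
have -> : v - T c' u = (v - T c u) + (c' - c) *: u by module.
have Wr : W (v - T c u) by apply: subspaceB => //; apply: TW.
apply: (le_trans (qD Wr (subspaceZ subW _ Wu))); rewrite qZ//.
have dK : rnorm (c' - c) * K <= 4^-1.
  move: cc'; rewrite -[_^-1]mul1r ler_pdivlMr//; have := rnorm_ge0 (c' - c).
  by nra.
have := ler_wpM2l (rnorm_ge0 (c' - c)) uK; have := ler_wpM2r (q_ge0 v) dK.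
lra.
Qed.

(** Some lower bound, however poor, forces approximate preimages of [A u - c u] to be close to [u];
    the constant of the approximate inverse then takes over. This keeps the constant from doubling
    at each step of a path. *)
Lemma bounded_below_improve K K' c : 0 <= K' -> approx_inverse K c ->
  bounded_below K' c -> bounded_below K c.
Proof.
move=> K'0 inv below u Wu; apply/ler_addgt0Pr => e e0.
have K1 : 0 < K' + 1 by lra.
have [|u' [Wu' u'K hu']] := inv (e / (K' + 1)) _ _ (TW c Wu); first by rewrite divr_gt0.
have Wd : W (u - u') by apply: subspaceB.
have := below _ Wd; rewrite (linear_mapB (linT c)) => le_d.
have : K' * q (T c u - T c u') <= e.
  by move: hu'; rewrite ler_pdivlMr// => hu'; have := q_ge0 (T c u - T c u'); nra.
have := qD Wu' Wd; rewrite addrC subrK; lra.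
Qed.

Lemma bounded_below_far c : M + 1 <= rnorm c -> bounded_below 1 c.
Proof.
move=> Mc u Wu; have := qB (AW Wu) (TW c Wu).
have -> : A u - T c u = c *: u by module.
by rewrite qZ// => h; have := qA Wu; have := q_ge0 u; nra.
Qed.

Lemma bounded_below_near K c c' : 0 <= K -> K * rnorm (c' - c) <= 2^-1 ->
  bounded_below K c -> bounded_below (2 * K) c'.
Proof.
move=> K0 cc' below u Wu; have := qD (TW c' Wu) (subspaceZ subW (c' - c) Wu).
have -> : T c' u + (c' - c) *: u = T c u by module.
rewrite qZ// => /(ler_wpM2l K0) h; have := below u Wu.
have := ler_wpM2r (q_ge0 u) cc'; lra.
Qed.

Let r0 := M + 1.
Let r0_gt0 : 0 < r0. Proof. exact: addr_gt0. Qed.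

(* The bound is moved from the boundary of the disc to its points along segments. *)
Lemma bounded_below_disc K : 1 <= K ->
  (forall c, rnorm c <= r0 -> approx_inverse K c) ->
  forall c, rnorm c <= r0 -> bounded_below K c.
Proof.
move=> K1 inv c cr; have K0 : 0 <= K by apply: le_trans K1.
have r00 := ltW r0_gt0.
(* The segment from [r0] to [c] has length at most [2 r0]; cut into [n] pieces, each has length at
   most [1 / (2 K)], as [bounded_below_near] requires. *)
pose n := (Num.truncn (4 * K * r0)).+1.
pose p (k : nat) : C := (1 - (k%:R / n%:R)%:C%C) * r0%:C%C + (k%:R / n%:R)%:C%C * c.
have pE k : p k.+1 - p k = (n%:R^-1)%:C%C * (c - r0%:C%C).
  by rewrite /p -natr1 mulrDl mul1r !rmorphD /=; ring.
have pr k : (k <= n)%N -> rnorm (p k) <= r0.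
  move=> kn; have k1 : k%:R / n%:R <= 1 :> R.
    by rewrite ler_pdivrMr ?ltr0n// mul1r ler_nat.
  have k0 : 0 <= k%:R / n%:R :> R by rewrite divr_ge0.
  apply: (le_trans (ler_rnormD _ _)); rewrite !rnormM.
  rewrite -(rmorph1 (real_complex R)) -rmorphB !rnorm_real.
  rewrite (ger0_norm k0) ger0_norm ?subr_ge0// (ger0_norm r00).
  have := ler_wpM2l k0 cr; lra.
have pstep k : K * rnorm (p k.+1 - p k) <= 2^-1.
  rewrite pE rnormM rnorm_real ger0_norm ?invr_ge0//.
  have := ler_rnormD c (- r0%:C%C); rewrite rnormN rnorm_real (ger0_norm r00) => h.
  have hn : 4 * K * r0 <= n%:R by apply/ltW/truncnS_gt.
  rewrite mulrCA mulrC ler_pdivrMr ?ltr0n//.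
  have : K * rnorm (c - r0%:C%C) <= K * (r0 + r0).
    by apply: ler_wpM2l => //; apply: (le_trans h); rewrite lerD2r.
  lra.
have -> : c = p n.
  by rewrite /p divff ?pnatr_eq0// subrr mul0r mul1r add0r.
have : forall k, (k <= n)%N -> bounded_below K (p k); last by apply.
elim=> [_|k IH kn].
  apply: (bounded_below_improve ler01); first by apply: inv; apply: pr.
  apply: bounded_below_far; rewrite /p mul0r subr0 mul1r mul0r addr0.
  by rewrite rnorm_real ger0_norm.
apply: (@bounded_below_improve _ (2 * K)); first by rewrite mulr_ge0.
  by apply: inv; apply: pr.
by apply: (bounded_below_near K0 (pstep k)); apply: IH; apply: ltnW.
Qed.

(** The power of [A] of exponent [2 ^ m]. Repeated squaring needs only the factorization of a
    difference of two squares. *)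
Definition dyadic_power m : V -> V := iter m (fun f => f \o f) A.
Local Notation B := dyadic_power.

Let BW m u : W u -> W (B m u).
Proof.
elim: m u => [|m IHm] u Wu; first exact: AW.
by apply: (IHm); apply: IHm.
Qed.

Let linB m : linear (B m).
Proof. by elim: m => [|m IH]; [exact: linA | move=> c u v /=; rewrite IH IH]. Qed.

Let dyadic_root_of_m1 m : exists2 z : C, z ^+ (2 ^ m) = -1 & rnorm z = 1.
Proof.
have [z zm] : exists z : C, z ^+ (2 ^ m) = -1.
  elim: m => [|m [z zm]]; first by exists (-1); rewrite expr1.
  by exists (sqrtC z); rewrite expnS exprM sqrtCK.
exists z => //; apply/eqP.
rewrite -(@pexpr_eq1 _ _ (2 ^ m)) ?expn_gt0 ?rnorm_ge0// -rnormX zm.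
by rewrite rnormN rnorm1.
Qed.

(* Difference quotients of [t^n / (t^n - A^n)]: for [n = 2^(m+1)] this function
   is the average of its analogues for [n = 2^m] at [t] and at [z t], where
   [z^(2^m) = -1], so the Lipschitz constant on the disc does not depend on [m]. *)
Lemma dyadic_resolvent_lipschitz K m s t x : 0 <= K ->
  (forall c, rnorm c <= r0 -> bounded_below K c) ->
  rnorm s <= r0 -> rnorm t <= r0 -> W x ->
  rnorm (t ^+ (2 ^ m) - s ^+ (2 ^ m)) * q (B m x) <= M * K ^+ 2 * rnorm (t - s) *
    q (B m (B m x - s ^+ (2 ^ m) *: x) - t ^+ (2 ^ m) *: (B m x - s ^+ (2 ^ m) *: x)).
Proof.
move=> K0 below; elim: m s t x => [|m IH] s t x sr tr Wx.
  rewrite !expn0 !expr1 /= mulrC mulrAC; apply: ler_wpM2r; first exact: rnorm_ge0.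
  apply: (le_trans (qA Wx)); rewrite -mulrA ler_pM2l//.
  apply: (le_trans (below s sr x Wx)); rewrite expr2 -mulrA; apply: ler_wpM2l => //.
  exact: (below t tr _ (TW s Wx)).
have [z zm z1] := dyadic_root_of_m1 m.
set k := M * K ^+ 2 * rnorm (t - s).
rewrite !expnS !exprM ![(_ ^+ 2) ^+ _]exprAC.
have := IH (z * s) (z * t).
rewrite -mulrBr rnormM z1 mul1r !rnormM !z1 !mul1r !exprMn zm !mulN1r => /(_ _ sr tr) IH'.
have {}IH := fun x => IH s t x sr tr; rewrite -/k in IH IH'.
set S := s ^+ (2 ^ m) in IH IH' *; set U := t ^+ (2 ^ m) in IH IH' *.
(* With [B = B m], [x1 = (B + U)(B + S) x] and [x2 = (B - U)(B - S) x]. The induction hypotheses for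
   [x1] at [S, U] and for [x2] at [-S, -U] have the same right-hand side, that of
   [y = (B^2 - U^2)(B^2 - S^2) x], and the left-hand sides combine because
   [x1 - x2 = 2 (U + S) B x]. *)
pose x1 := B m (B m x + S *: x) + U *: (B m x + S *: x).
pose x2 := B m (B m x - S *: x) - U *: (B m x - S *: x).
have Wx1 : W x1.
  have W1 : W (B m x + S *: x).
    by apply: subspaceD => //; [exact: BW | exact: subspaceZ].
  by apply: subspaceD => //; [exact: BW | exact: subspaceZ].
have Wx2 : W x2.
  have W1 : W (B m x - S *: x).
    by apply: subspaceB => //; [exact: BW | exact: subspaceZ].
  by apply: subspaceB => //; [exact: BW | exact: subspaceZ].
set y := (X in _ <= k * q X).
have y1 : B m (B m x1 - S *: x1) - U *: (B m x1 - S *: x1) = y.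
  rewrite /y /x1 /= !(linear_mapD (linB m), linear_mapN (linB m), linear_mapZ (linB m)).
  by module.
have y2 : B m (B m x2 - - S *: x2) - - U *: (B m x2 - - S *: x2) = y.
  rewrite /y /x2 /= !(linear_mapD (linB m), linear_mapN (linB m), linear_mapZ (linB m)).
  by module.
have := IH x1 Wx1; have := IH' x2 Wx2; rewrite y1 y2 => h2 h1.
have W1 := subspaceZ subW (U - S) (BW m Wx1).
have W2 := subspaceZ subW (- U - - S) (BW m Wx2).
have := qD W1 W2; rewrite !qZ; try exact: BW.
have -> : (U - S) *: B m x1 + (- U - - S) *: B m x2 =
    (2 * (U ^+ 2 - S ^+ 2)) *: B m.+1 x.
  rewrite /x1 /x2 /= !(linear_mapD (linB m), linear_mapN (linB m), linear_mapZ (linB m)).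
  by module.
rewrite qZ; last exact: BW.
rewrite rnormM rnorm_nat; lra.
Qed.

Let spectral_radius_le (r : R) := exists m0, forall m, (m0 <= m)%N ->
  forall x, W x -> q (B m x) <= r ^+ (2 ^ m) * q x.

Let spectral_radius_M : spectral_radius_le M.
Proof.
exists 0%N => m _; elim: m => [|m IH] x Wx; first by rewrite expn0 expr1 qA.
rewrite /= (le_trans (IH _ (BW m Wx)))// expnS mulnC exprM expr2 -mulrA.
by apply: ler_wpM2l; [apply/exprn_ge0/ltW | exact: IH].
Qed.

Let small_power (a : R) : 0 <= a -> a < 1 ->
  exists m0, forall m, (m0 <= m)%N -> a ^+ (2 ^ m) <= 2^-1.
Proof.
move=> a0 a1; have cva : a ^+ n @[n --> \oo] --> 0 by apply: cvg_expr; rewrite ger0_norm.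
have h0 : 0 < 2^-1 :> R by rewrite invr_gt0.
move/cvgrPdist_le: cva => /(_ _ h0)[n0 _ hn]; exists n0 => m nm.
have : (n0 <= 2 ^ m)%N by apply: (leq_trans nm); apply/ltnW/ltn_expl.
by move=> /hn /=; rewrite sub0r normrN ger0_norm// exprn_ge0.
Qed.

(** The Lipschitz estimate is used at [s = r - d] and [t = r + d]. For large [n = 2 ^ m], [t ^ n] is
    at least twice [s ^ n] and twice the bound [r ^ n] of the [n]-th power; since
    [M K^2 (2 d) <= 1/16], this leaves [1/2 q (B m x) <= 3/32 (q (B m x) + s^n q x)], whence the
    bound [s ^ n]. The size of [d] is tied to [M] and [K], so finitely many steps reach any positive
    radius. *)
Lemma spectral_radius_decrease K r d : 0 <= K -> 0 < d -> 0 < r - d -> r + d <= r0 ->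
  32 * (M * K ^+ 2) * d <= 1 -> (forall c, rnorm c <= r0 -> bounded_below K c) ->
  spectral_radius_le r -> spectral_radius_le (r - d).
Proof.
move=> K0 d0 rd0 rdr0 dK below [m0 hm0].
set s := r - d in rd0 *; set t := r + d in rdr0.
have t0 : 0 < t by rewrite /t; move: rd0; rewrite /s; lra.
have r_ge0 : 0 <= r by move: rd0; rewrite /s; lra.
have [||m1 hm1] := small_power (a := r / t); first by rewrite divr_ge0// ltW.
  by rewrite ltr_pdivrMr// mul1r /t; lra.
have [||m2 hm2] := small_power (a := s / t); first by rewrite divr_ge0// ltW.
  by rewrite ltr_pdivrMr// mul1r /s /t; lra.
exists (maxn m0 (maxn m1 m2)) => m; rewrite !geq_max => /and3P[mm0 mm1 mm2] x Wx.
have := hm1 m mm1; have := hm2 m mm2.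
rewrite !expr_div_n !ler_pdivrMr ?exprn_gt0//.
have := @dyadic_resolvent_lipschitz K m s%:C%C t%:C%C x K0 below.
rewrite -!rmorphXn -!rmorphB !rnorm_real.
have tn0 : 0 < t ^+ (2 ^ m) by rewrite exprn_gt0.
have sn0 : 0 < s ^+ (2 ^ m) by rewrite exprn_gt0.
have hm := hm0 m mm0.
set n := (2 ^ m)%N in hm tn0 sn0 *.
rewrite (gtr0_norm t0) (gtr0_norm rd0) => + sn rn.
have sr0 : s <= r0 by move: rdr0; rewrite /s /t; lra.
move=> /(_ sr0 rdr0 Wx).
have -> : t - s = 2 * d by rewrite /t /s; lra.
rewrite [ `|2 * d|]gtr0_norm ?mulr_gt0// ger0_norm; last by rewrite subr_ge0; lra.
set y := B m x - (s ^+ n)%:C%C *: x.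
have Wy : W y by apply: subspaceB => //; [exact: BW | exact: subspaceZ].
have qy : q y <= q (B m x) + s ^+ n * q x.
  apply: (le_trans (qB (BW m Wx) (subspaceZ subW _ Wx))).
  by rewrite qZ// rnorm_real gtr0_norm.
have qz : q (B m y - (t ^+ n)%:C%C *: y) <= 3 / 2 * t ^+ n * q y.
  apply: (le_trans (qB (BW m Wy) (subspaceZ subW _ Wy))).
  rewrite qZ// rnorm_real gtr0_norm//.
  have := hm y Wy; have := ler_wpM2r (q_ge0 y) rn; lra.
move=> h.
have k0 : 0 <= M * K ^+ 2 * (2 * d) by rewrite !mulr_ge0// ?exprn_ge0// ltW.
have k1 : M * K ^+ 2 * (2 * d) <= 16^-1 by lra.
have := ler_wpM2l k0 qz; move/(le_trans h).
have z0 : 0 <= 3 / 2 * t ^+ n * q y by rewrite !mulr_ge0// ltW.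
have := ler_wpM2r z0 k1 => h1 /le_trans/(_ h1).
have : 3 / 2 * t ^+ n * q y <= 3 / 2 * t ^+ n * (q (B m x) + s ^+ n * q x).
  by apply: ler_wpM2l => //; rewrite mulr_ge0// ltW.
have : 2^-1 * t ^+ n * q (B m x) <= (t ^+ n - s ^+ n) * q (B m x).
  by apply: ler_wpM2r => //; lra.
move=> h2 h3 h4; have : t ^+ n * q (B m x) <= t ^+ n * (s ^+ n * q x).
  have : 0 <= t ^+ n * (s ^+ n * q x) by rewrite !mulr_ge0// ltW.
  by move: h1 h2 h3 h4; rewrite !mulrDr; lra.
by rewrite ler_pM2l.
Qed.

(** A seminormed form of the nonemptiness of the spectrum of a bounded operator. A bound [K] of the
    inverses, uniform on the disc, brings the spectral radius down to [1 / (2 K)], while the lower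
    bound at [c = 0], iterated, keeps the powers of exponent [n] above [K ^ (-n)] unless [q]
    vanishes. *)
Theorem bounded_resolvent_trivial :
  (forall c, exists2 K, 0 <= K & forall v, W v ->
     exists u, [/\ W u, q u <= K * q v & q (v - (A u - c *: u)) <= q v / 4]) ->
  forall v, W v -> q v = 0.
Proof.
move=> inv.
have [n hn] : exists n, forall c : C, rnorm c <= r0 -> approx_inverse n%:R c.
  apply: (@locally_bounded_disc R r0 (fun n c => approx_inverse n%:R c)).
    by move=> n m c nm; apply: approx_inverse_weaken; rewrite ler_nat.
  move=> c; have [K K0 hK] := inv c; have [d [d0 hd]] := approx_inverse_near K0 hK.
  exists (Num.truncn (2 * K)).+1, d; split=> // c' /hd.
  by apply: approx_inverse_weaken; apply/ltW/truncnS_gt.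
pose K : R := n.+1%:R; have K1 : 1 <= K by rewrite ler1n.
have Kp : 0 < K by apply: lt_le_trans K1.
have below : forall c, rnorm c <= r0 -> bounded_below K c.
  apply: bounded_below_disc => // c /hn.
  by apply: approx_inverse_weaken; rewrite ler_nat.
have radius_small : spectral_radius_le (2 * K)^-1.
  have K2 : 0 < (2 * K)^-1 by rewrite invr_gt0 mulr_gt0.
  have [leM|ltM] := leP M (2 * K)^-1.
    have [m0 h] := spectral_radius_M; exists m0 => m mm x Wx.
    apply: (le_trans (h m mm x Wx)); apply: ler_wpM2r => //.
    by apply: lerXn2r => //; rewrite nnegrE ltW.
  pose D := M - (2 * K)^-1; have D0 : 0 < D by rewrite subr_gt0.
  (* The three summands ensure, for [d = D / k], that the Lipschitz term is small, that
     [d < 1 / (2 K)] so that radii stay positive, and that [d <= 1] so that [r + d] stays within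
     [r0 = M + 1]. *)
  pose k := (Num.truncn (D * (32 * (M * K ^+ 2) + 4 * K + 1))).+1.
  pose d := D / k%:R; have d0 : 0 < d by rewrite divr_gt0// ltr0n.
  have MK0 : 0 <= M * K ^+ 2 by rewrite mulr_ge0 ?exprn_ge0 ?ltW.
  have dE : d * (32 * (M * K ^+ 2) + 4 * K + 1) <= 1.
    rewrite /d mulrAC ler_pdivrMr ?ltr0n// mul1r; apply/ltW/truncnS_gt.
  have d1 : 32 * (M * K ^+ 2) * d <= 1 by nra.
  have d2 : d <= 1 by nra.
  have d3 : d < (2 * K)^-1.
    by rewrite -[_^-1]mul1r ltr_pdivlMr ?mulr_gt0//; nra.
  have kd : k%:R * d = D by rewrite /d mulrC divfK ?pnatr_eq0.
  have -> : (2 * K)^-1 = M - k%:R * d by rewrite kd /D opprB addrC subrK.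
  have : forall j, (j <= k)%N -> spectral_radius_le (M - j%:R * d); last by apply.
  elim=> [|j IH] jk; first by rewrite mul0r subr0.
  have jr : (2 * K)^-1 + d <= M - j%:R * d.
    have : j.+1%:R * d <= k%:R * d by rewrite ler_pM2r// ler_nat.
    by rewrite kd -natr1 /D; set a := (2 * K)^-1; lra.
  have -> : M - j.+1%:R * d = M - j%:R * d - d by rewrite -natr1; lra.
  apply: (spectral_radius_decrease (ltW Kp) d0 _ _ d1 below (IH (ltnW jk))).
    by move: jr K2; set a := (2 * K)^-1; lra.
  have : 0 <= j%:R * d by rewrite mulr_ge0// ltW.
  by rewrite /r0; lra.
move=> v Wv; apply/eqP; rewrite eq_le q_ge0 andbT.
have [m hm] := radius_small.
have below0 u : W u -> q u <= K * q (A u).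
  move=> Wu; have := below 0 _ u Wu; rewrite scale0r subr0; apply.
  by rewrite rnorm0 ltW.
have belowm k u : W u -> q u <= K ^+ (2 ^ k) * q (B k u).
  elim: k u => [|k IH] u Wu; first by rewrite expn0 expr1 below0.
  apply: (le_trans (IH u Wu)); rewrite expnS mulnC exprM expr2 -mulrA.
  by apply: ler_wpM2l; [apply/exprn_ge0/ltW | apply: IH; apply: BW].
(* Together with [radius_small] this gives [q v <= 2 ^ (-n) q v] with [n = 2 ^ m >= 1]. *)
have := belowm m v Wv; have Kn : 0 <= K ^+ (2 ^ m) by rewrite exprn_ge0// ltW.
move=> /le_trans/(_ (ler_wpM2l Kn (hm m (leqnn m) v Wv))).
rewrite mulrA -exprMn invfM mulrCA divff ?gt_eqF// mulr1.
have : 2^-1 ^+ (2 ^ m) <= 2^-1 :> R.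
  rewrite -(prednK (expn_gt0 2 m)) exprS ler_piMr ?invr_ge0//.
  by rewrite exprn_ile1 ?invr_ge0// invf_le1 ?ler1n.
have := q_ge0 v; nra.
Qed.

End BoundedResolvent.

Section PairNorm.
Variable R : realType.
Local Notation C := R[i].
Variables (V1 V2 : lmodType C) (N1 : V1 -> R) (N2 : V2 -> R).

Definition pair_norm (x : V1 * V2) : R := N1 x.1 + N2 x.2.

Lemma banach_pair (P1 : set V1) (P2 : set V2) : is_banach N1 P1 -> is_banach N2 P2 ->
  is_banach pair_norm [set x | P1 x.1 /\ P2 x.2].
Proof.
case=> n1 s1 c1 [n2 s2 c2]; split.
- split=> [[u a] [v b]|c [u a]|[u a]]; rewrite /pair_norm /=.
  + by rewrite addrACA lerD ?(normD n1) ?(normD n2).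
  + by rewrite (normZ n1) (normZ n2) mulrDr.
  + move=> h; have := norm_ge0 n1 u; have := norm_ge0 n2 a => a0 u0.
    by rewrite (norm_le0 n1 (u := u)) 1?(norm_le0 n2 (u := a))//; lra.
- split=> [|c u v [u1 u2] [v1 v2]]; first by split; apply: subspace0.
  by split; [apply: s1.2 | apply: s2.2].
- move=> u K Pu uK.
  have nU n : N1 ((u n.+1).1 - (u n).1) <= K * 2^-1 ^+ n.
    by apply: le_trans (uK n); rewrite lerDl (norm_ge0 n2).
  have nA n : N2 ((u n.+1).2 - (u n).2) <= K * 2^-1 ^+ n.
    by apply: le_trans (uK n); rewrite lerDr (norm_ge0 n1).
  have [l Pl hl] := c1 _ K (fun n => (Pu n).1) nU.
  have [a Pa ha] := c2 _ K (fun n => (Pu n).2) nA.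
  exists (l, a) => // eps e0; have e20 : 0 < eps / 2 by rewrite divr_gt0.
  have [n0 h0] := hl _ e20; have [m0 h1] := ha _ e20.
  exists (maxn n0 m0) => n; rewrite geq_max => /andP[/h0 k0 /h1 k1].
  by rewrite /pair_norm /= [eps]splitr lerD.
Qed.

End PairNorm.

Section FiniteCodimensionSpectrum.
Variable R : realType.
Local Notation C := R[i].
Variables (V1 V2 : lmodType C) (N1 : V1 -> R) (N2 : V2 -> R).
Variables (P1 : set V1) (P2 : set V2) (D : V1 -> V2).
Hypotheses (b1 : is_banach N1 P1) (b2 : is_banach N2 P2).
Hypotheses (bD : bounded_map N1 N2 D) (DP : forall y, P1 y -> P2 (D y)).
Variables (A1 : V1 -> V1) (A2 : V2 -> V2).
Hypotheses (bA1 : bounded_map N1 N1 A1) (bA2 : bounded_map N2 N2 A2).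
Hypotheses (A1P : forall y, P1 y -> P1 (A1 y)) (A2P : forall z, P2 z -> P2 (A2 z)).
Hypothesis A2D : forall y, P1 y -> A2 (D y) = D (A1 y).
Let n1 := banach_norm b1.
Let n2 := banach_norm b2.
Let s1 := banach_subspace b1.
Let s2 := banach_subspace b2.
Let linD : linear D. Proof. by case: bD. Qed.
Let linA2 : linear A2. Proof. by case: bA2. Qed.

(** Arbitrary maps rather than linear ones: the approximate inverses below choose bounded preimages
    point by point, and such a choice need not be linear. *)
Let bounded_fun (v : V2 -> V2) : Prop :=
  exists K, forall z, P2 z -> N2 z <= 1 -> P2 (v z) /\ N2 (v z) <= K.

Let near_net (v : V2 -> V2) (e : R) : Prop :=
  exists K (l : seq V2), (forall w, w \in l -> P2 w) /\
  forall z, P2 z -> N2 z <= 1 -> exists y w,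
    [/\ P1 y, N1 y <= K, w \in l & N2 (v z - D y - w) <= e].

(* A measure of noncompactness, modulo the range of D, of the image of the unit
   ball under v. *)
Let q (v : V2 -> V2) : R := inf [set e | 0 <= e /\ near_net v e].

Let bounded_fun_subspace : is_subspace (bounded_fun : set (V2 -> V2)).
Proof.
split.
  by exists 0 => z _ _ /=; rewrite norm0//; split=> //; apply: subspace0.
move=> c u v [K uK] [K' vK']; exists (rnorm c * K + K') => z Pz z1.
have [Pu Nu] := uK z Pz z1; have [Pv Nv] := vK' z Pz z1; split; first exact: s2.2.
rewrite fctE; apply: (le_trans (normD n2 _ _)); rewrite lerD//.
by rewrite fctE (normZ n2) ler_wpM2l ?rnorm_ge0.
Qed.

Let near_net_le v e e' : e <= e' -> near_net v e -> near_net v e'.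
Proof.
move=> ee' [K [l [Pl h]]]; exists K, l; split=> // z Pz z1.
have [y [w [Py yK lw hw]]] := h z Pz z1; exists y, w; split=> //.
exact: le_trans ee'.
Qed.

Let near_net_bounded v K : 0 <= K ->
  (forall z, P2 z -> N2 z <= 1 -> N2 (v z) <= K) -> near_net v K.
Proof.
move=> K0 h; exists 0, [:: 0]; split=> [w|z Pz z1].
  by rewrite inE => /eqP->; apply: subspace0.
exists 0, 0; rewrite inE eqxx norm0// (linear_map0 linD) !subr0; split=> //.
  exact: subspace0.
exact: h.
Qed.

Let q_le v e : 0 <= e -> near_net v e -> q v <= e.
Proof. by move=> e0 ve; apply: ge_inf => //; exists 0 => x []. Qed.

Let q_near v e : bounded_fun v -> q v < e -> near_net v e.
Proof.
move=> [K vK] qe; have [] := @inf_lt _ [set e | 0 <= e /\ near_net v e] e.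
- exists `|K|; split=> //; apply: near_net_bounded => // z Pz z1.
  by apply: (le_trans (vK z Pz z1).2); rewrite ler_norm.
- exact: qe.
by move=> x [x0 vx] /ltW xe; apply: near_net_le vx.
Qed.

Let q_ge0 v : 0 <= q v.
Proof.
have [ne|empty] := pselect ([set e | 0 <= e /\ near_net v e] !=set0).
  by apply: lb_le_inf => // y [].
by rewrite /q (_ : [set e | _] = set0) ?inf0//; apply/eqP/negPn/negP => /set0P.
Qed.

Let q_small v (b : R) : (forall e, 0 < e -> near_net v (b + e)) -> 0 <= b -> q v <= b.
Proof.
move=> h b0; apply/ler_addgt0Pr => e e0; apply: q_le; last exact: h.
by rewrite addr_ge0// ltW.
Qed.

Let qD u v : bounded_fun u -> bounded_fun v -> q (u + v) <= q u + q v.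
Proof.
move=> bu bv; apply: q_small; last by rewrite addr_ge0.
move=> e e0; have e2 : 0 < e / 2 by rewrite divr_gt0.
have [|K [l [Pl h]]] := @q_near u (q u + e / 2) bu; first by rewrite ltrDl.
have [|K' [l' [Pl' h']]] := @q_near v (q v + e / 2) bv; first by rewrite ltrDl.
exists (K + K'), [seq w + w' | w <- l, w' <- l']; split.
  move=> _ /allpairsP[[w w'] [/= lw lw' ->]].
  by apply: subspaceD => //; [exact: Pl | exact: Pl'].
move=> z Pz z1; have [y [w [Py yK lw hw]]] := h z Pz z1.
have [y' [w' [Py' yK' lw' hw']]] := h' z Pz z1.
exists (y + y'), (w + w'); split.
- exact: subspaceD.
- by apply: (le_trans (normD n1 _ _)); rewrite lerD.
- by apply/allpairsP; exists (w, w').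
- have -> : (u + v) z - D (y + y') - (w + w') = (u z - D y - w) + (v z - D y' - w').
    by rewrite fctE (linear_mapD linD); module.
  by apply: (le_trans (normD n2 _ _)); lra.
Qed.

Let near_netZ c v e : near_net v e -> near_net (c *: v) (rnorm c * e).
Proof.
move=> [K [l [Pl h]]]; exists (rnorm c * K), [seq c *: w | w <- l]; split.
  by move=> _ /mapP[w lw ->]; apply: subspaceZ => //; apply: Pl.
move=> z Pz z1; have [y [w [Py yK lw hw]]] := h z Pz z1.
exists (c *: y), (c *: w); split.
- exact: subspaceZ.
- by rewrite (normZ n1) ler_wpM2l ?rnorm_ge0.
- by apply/mapP; exists w.
- have -> : (c *: v) z - D (c *: y) - c *: w = c *: (v z - D y - w).
    by rewrite fctE (linear_mapZ linD); module.
  by rewrite (normZ n2) ler_wpM2l ?rnorm_ge0.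
Qed.

Let q_leZ c v : bounded_fun v -> q (c *: v) <= rnorm c * q v.
Proof.
move=> bv; apply: q_small; last by rewrite mulr_ge0 ?rnorm_ge0.
move=> e e0; have c1 : 0 < rnorm c + 1 by rewrite ltr_wpDl ?rnorm_ge0.
have [|] := @near_netZ c v (q v + e / (rnorm c + 1)).
  by apply: q_near => //; rewrite ltrDl divr_gt0.
move=> K h; apply: near_net_le (ex_intro _ K h); rewrite mulrDr lerD2l.
by rewrite mulrA ler_pdivrMr// mulrC ler_wpM2l ?lerDl// ltW.
Qed.

Let qZ c v : bounded_fun v -> q (c *: v) = rnorm c * q v.
Proof.
move=> bv; apply/eqP; rewrite eq_le q_leZ//=.
have [->|c0] := eqVneq c 0; first by rewrite rnorm0 mul0r.
have rc0 : 0 < rnorm c.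
  by rewrite lt_neqAle rnorm_ge0 andbT eq_sym; apply: contra_neq c0; exact: rnorm_eq0.
rewrite -ler_pdivlMl// -rnormV -[v in q v](scalerK c0).
by apply: q_leZ; apply: subspaceZ.
Qed.

(** [bounded_resolvent_trivial] for the seminorm [q] and composition with [A2], which is bounded for
    [q] because [A2] carries the range of [D] into itself. Finite codimension at [c] inverts
    [A2 - c] up to the range of [D] and a finite-dimensional error, both invisible to [q]. The
    conclusion [q id = 0] is a net of the unit ball with error 1/4. *)
Lemma fin_codim_spectrum :
  (forall c : C, fin_dim_quotient P2
     ((fun x : V2 * V1 => A2 x.1 - c *: x.1 + D x.2) @` [set x | P2 x.1 /\ P1 x.2])) ->
  fin_dim_quotient P2 (D @` P1).
Proof.
move=> fin; have [_ [M1 M10 A1M]] := bA1; have [_ [M2 M20 A2M]] := bA2.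
have [_ [MD MD0 DM]] := bD.
have qid : q id = 0.
  apply: (bounded_resolvent_trivial (V := V2 -> V2) (W := bounded_fun)
      (A := fun v z => A2 (v z)) (M := M2 + 1)) => //.
  - by move=> c u v; apply: funext => z; rewrite !fctE linA2.
  - move=> u [K uK]; exists (M2 * K) => z Pz z1; have [Pu Nu] := uK z Pz z1.
    by split; [exact: A2P | apply: (le_trans (A2M _)); rewrite ler_wpM2l].
  - by rewrite ltr_wpDl.
  - move=> u bu; apply: q_small; last by rewrite mulr_ge0// addr_ge0.
    move=> e e0; have M21 : 0 < M2 + 1 by rewrite ltr_wpDl.
    have [|K [l [Pl h]]] := @q_near u (q u + e / (M2 + 1)) bu.
      by rewrite ltrDl divr_gt0.
    exists (M1 * K), [seq A2 w | w <- l]; split.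
      by move=> _ /mapP[w lw ->]; apply: A2P; apply: Pl.
    move=> z Pz z1; have [y [w [Py yK lw hw]]] := h z Pz z1.
    exists (A1 y), (A2 w); split.
    + exact: A1P.
    + by apply: (le_trans (A1M _)); rewrite ler_wpM2l.
    + by apply/mapP; exists w.
    + rewrite -A2D// -!(linear_mapB linA2); apply: (le_trans (A2M _)).
      have : (M2 + 1) * (q u + e / (M2 + 1)) = (M2 + 1) * q u + e.
        by rewrite mulrDr [_ * (e / _)]mulrC divfK ?gt_eqF.
      have := ler_wpM2l M20 hw; have := norm_ge0 n2 (u z - D y - w).
      have : 0 <= q u + e / (M2 + 1) by rewrite addr_ge0// divr_ge0// ltW.
      set b := q u + _; set a := N2 _; nra.
  - move=> c.
    pose Dc (x : V2 * V1) := A2 x.1 - c *: x.1 + D x.2.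
    have bDc : bounded_map (pair_norm N2 N1) N2 Dc.
      split.
        by move=> a [x y] [x' y']; rewrite /Dc /= linA2 linD; module.
      exists (M2 + rnorm c + MD); first by rewrite !addr_ge0 ?rnorm_ge0.
      move=> [x y]; rewrite /Dc /pair_norm /=.
      apply: (le_trans (normD n2 _ _)); have := normB n2 (A2 x) (c *: x).
      rewrite (normZ n2); have := A2M x; have := DM y; have := rnorm_ge0 c.
      have := norm_ge0 n2 x; have := norm_ge0 n1 y; nra.
    have DcP x : P2 x.1 /\ P1 x.2 -> P2 (Dc x).
      move=> [Px Py]; apply: subspaceD => //; last exact: DP.
      by apply: subspaceB => //; [exact: A2P | exact: subspaceZ].
    have [m [w [Pw spanw]]] := fin c.
    have [K K0 KP] := fin_codim_open (banach_pair b2 b1) b2 bDc DcP Pw spanw.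
    exists (2 * K); first by rewrite mulr_ge0.
    (* The infimum [q v] need not be attained. If it is positive, some net has error [2 q v]; if it
       is 0, the approximate preimage 0 will do. *)
    move=> v bv; have [qv0|qv0] := eqVneq (q v) 0.
      exists 0; split; first exact: subspace0.
        by rewrite -(scale0r v) qZ// rnorm0 mul0r mulr_ge0 ?mulr_ge0.
      have -> : v - ((fun z => A2 ((0 : V2 -> V2) z)) - c *: 0) = v.
        by apply: funext => z; rewrite !fctE (linear_map0 linA2) scaler0 !subr0.
      by rewrite qv0 mul0r.
    have qv : 0 < q v by rewrite lt_neqAle eq_sym qv0 q_ge0.
    have q2 : q v < 2 * q v by lra.
    have [L [l [Pl h]]] := q_near bv q2.
    have q4 : 0 < q v / 4 by rewrite divr_gt0.
    (* The residual of [v z] has norm at most [2 q v], so it is [Dc] of a bounded pair plus a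
       combination of the [w] with coefficients at most [K (2 q v)]. Such combinations have a finite
       net, and only its error [q v / 4] counts. *)
    have [l' [Pl' h']] := combination_net n2 s2 (K * (2 * q v)) Pw q4.
    have /(choice_on (Y := V2))[u uP] : forall z, P2 z /\ N2 z <= 1 -> exists u,
        [/\ P2 u, N2 u <= K * (2 * q v) & exists y x, [/\ P1 y,
          N1 y <= L + K * (2 * q v), x \in [seq x + x' | x <- l, x' <- l'] &
          N2 (v z - (A2 u - c *: u) - D y - x) <= q v / 4]].
      move=> z [Pz z1]; have [y [x [Py yL lx hx]]] := h z Pz z1.
      have Pr : P2 (v z - D y - x).
        have [K' vK'] := bv; have [Pv _] := vK' z Pz z1.
        apply: subspaceB; rewrite //; last exact: Pl.
        by apply: subspaceB => //; apply: DP.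
      have [[u y'] [a [[/= Pu Py'] rE uK aK]]] := KP _ Pr.
      have rK := ler_wpM2l K0 hx.
      have [x' lx' hx'] := h' a (fun i => le_trans (aK i) rK).
      have := le_trans uK rK; rewrite /pair_norm /= => uyK.
      have u0 := norm_ge0 n2 u; have y0 := norm_ge0 n1 y'.
      exists u; split=> //; first by lra.
      exists (y + y'), (x + x'); split.
      + exact: subspaceD.
      + by apply: (le_trans (normD n1 _ _)); lra.
      + by apply/allpairsP; exists (x, x').
      + move: rE hx'; set s := \sum_(_ < _) _ => rE hx'.
        suff -> : v z - (A2 u - c *: u) - D (y + y') - (x + x') = s - x' by [].
        have -> : s = v z - D y - x - Dc (u, y') by rewrite rE addrAC subrr add0r.
        by rewrite /Dc /= (linear_mapD linD); module.
    exists u; split.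
    + by exists (K * (2 * q v)) => z Pz z1; have [] := uP z (conj Pz z1).
    + rewrite [2 * K]mulrC -mulrA; apply: q_le; first by rewrite !mulr_ge0.
      apply: near_net_bounded; first by rewrite !mulr_ge0.
      by move=> z Pz z1; have [] := uP z (conj Pz z1).
    + apply: q_le; first exact: ltW.
      exists (L + K * (2 * q v)), [seq x + x' | x <- l, x' <- l']; split.
        move=> _ /allpairsP[[x x'] [/= lx lx' ->]].
        by apply: subspaceD => //; [exact: Pl | exact: Pl'].
      by move=> z Pz z1; have [] := uP z (conj Pz z1).
  - by exists 1 => z Pz z1.
have bid : bounded_fun id by exists 1 => z Pz z1.
have [|K [l [_ h]]] := q_near (e := 4^-1) bid; first by rewrite qid invr_gt0.
by apply: (net_fin_codim b1 b2 bD DP (K := K) (l := l)) => z Pz z1; apply: h.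
Qed.

End FiniteCodimensionSpectrum.

(** * Creation and annihilation operators on Koszul chains *)

Section OrdinalSets.
Variable n : nat.
Implicit Types (S : {set 'I_n}) (i j : 'I_n).

Lemma enum_ord_sorted S : sorted (fun i j : 'I_n => (i < j)%N) (enum S).
Proof.
rewrite /enum_mem; apply: sorted_filter; first by move=> i j k; apply: ltn_trans.
by rewrite -enumT -(sorted_map (e' := ltn) (f := val)) val_enum_ord iota_ltn_sorted.
Qed.

Lemma enum_setD1 S i : i \in S ->
  enum (S :\ i) = take (index i (enum S)) (enum S) ++ drop (index i (enum S)).+1 (enum S).
Proof.
move=> iS; rewrite -remE rem_filter ?enum_uniq// /enum_mem -filter_predI.
by apply: eq_filter => j; rewrite !inE.
Qed.

Lemma card_lt_index S i : i \in S -> #|[set j in S | (j < i)%N]| = index i (enum S).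
Proof.
rewrite -mem_enum => iS.
have -> : #|[set j in S | (j < i)%N]| = count (fun j : 'I_n => (j < i)%N) (enum S).
  rewrite -size_filter cardE; congr size; rewrite /enum_mem -filter_predI.
  by apply: eq_filter => j; rewrite !inE andbC.
elim: (enum S) (enum_ord_sorted S) iS => //= j s IH js.
rewrite inE; have [->|neq] := eqVneq i j => /= [_|iis].
  rewrite ltnn add0n; apply/eqP; rewrite -leqn0 leqNgt -has_count.
  apply/hasPn => k ks; rewrite -leqNgt ltnW//.
  have := order_path_min _ js => /(_ (fun a b c : 'I_n => @ltn_trans _ _ _)) /allP.
  exact.
rewrite (IH (path_sorted js) iis).
have := order_path_min _ js => /(_ (fun a b c : 'I_n => @ltn_trans _ _ _)) /allP.
by move=> /(_ i iis) ->.
Qed.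

End OrdinalSets.

Section FockSpace.
Variables (K : numFieldType) (L : vectType K) (X : lmodType K).
Local Notation n := (\dim {:L}).
Local Notation e := (vbasis {:L}).
Local Notation kchain := (kchain L X).
Implicit Types (u v : kchain) (S : {set 'I_n}) (i j : 'I_n) (x : X) (a b l m : L).

Definition sign_at i S : K := (-1) ^+ #|[set j in S | (j < i)%N]|.

(** Exterior multiplication by the [i]-th basis vector; [annihilate i] is the interior product with
    the [i]-th coordinate form. Their anticommutation relations replace most computations with index
    sets. *)
Definition create i u : kchain :=
  [ffun S : {set 'I_n} => if i \in S then sign_at i S *: u (S :\ i) else 0].

Definition annihilate i u : kchain :=
  [ffun S : {set 'I_n} => if i \in S then 0 else sign_at i S *: u (i |: S)].

Lemma sign_atM i S : sign_at i S * sign_at i S = 1.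
Proof. by rewrite /sign_at -expr2 sqrr_sign. Qed.

Lemma sign_atU i j S : j \notin S ->
  sign_at i (j |: S) = (if (j < i)%N then -1 else 1) * sign_at i S.
Proof.
move=> jS; rewrite /sign_at; case: ifP => [ji|ji].
  have -> : [set k in j |: S | (k < i)%N] = j |: [set k in S | (k < i)%N].
    by apply/setP => k; rewrite !inE; case: eqVneq => [->|].
  by rewrite cardsU1 inE (negbTE jS) exprS.
rewrite mul1r; congr (_ ^+ #|pred_of_set _|); apply/setP => k; rewrite !inE.
by case: eqVneq => [->|]; rewrite ?ji ?andbF.
Qed.

Lemma sign_atD i j S : j \in S ->
  sign_at i S = (if (j < i)%N then -1 else 1) * sign_at i (S :\ j).
Proof.
move=> jS; have := @sign_atU i j (S :\ j); rewrite finset.setD1K// => -> //.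
by rewrite !inE eqxx.
Qed.

Lemma sign_atU1 i S : sign_at i (i |: S) = sign_at i S.
Proof.
rewrite /sign_at; congr (_ ^+ #|pred_of_set _|); apply/setP => k; rewrite !inE.
by case: eqVneq => [->|]; rewrite ?ltnn ?andbF.
Qed.

Lemma sign_atD1 i S : sign_at i (S :\ i) = sign_at i S.
Proof.
rewrite /sign_at; congr (_ ^+ #|pred_of_set _|); apply/setP => k; rewrite !inE.
by case: eqVneq => [->|]; rewrite ?ltnn ?andbF.
Qed.

Lemma linear_create i : linear (create i).
Proof.
move=> c u v; apply/ffunP => S; rewrite !ffunE; case: ifP => _.
  by rewrite scalerDr !scalerA mulrC.
by rewrite scaler0 addr0.
Qed.
HB.instance Definition _ i := GRing.isLinear.Build K kchain kchain *:%R (create i) (linear_create i).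

Lemma linear_annihilate i : linear (annihilate i).
Proof.
move=> c u v; apply/ffunP => S; rewrite !ffunE; case: ifP => _.
  by rewrite scaler0 addr0.
by rewrite scalerDr !scalerA mulrC.
Qed.
HB.instance Definition _ i :=
  GRing.isLinear.Build K kchain kchain *:%R (annihilate i) (linear_annihilate i).

Lemma lt_sign i j : i != j ->
  (if (j < i)%N then -1 else 1 : K) = - (if (i < j)%N then -1 else 1).
Proof. by rewrite -val_eqE; case: ltngtP => //= _ _; rewrite ?opprK. Qed.

Lemma createC i j u : create i (create j u) = - create j (create i u).
Proof.
apply/ffunP => S; rewrite !ffunE !inE; have [<-|ij] := eqVneq i j.
  by rewrite /=; case: ifP => _; rewrite ?scaler0 oppr0.
rewrite /=; case: ifP => [iS|]; case: ifP => [jS|]; rewrite ?scaler0 ?oppr0//.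
rewrite !scalerA -scaleNr [S :\ j :\ i]finset.setDDl [S :\ i :\ j]finset.setDDl finset.setUC; congr (_ *: _).
by rewrite (sign_atD i jS) (sign_atD j iS) (lt_sign ij); ring.
Qed.

Lemma annihilate_create i j u :
  annihilate i (create j u) = (i == j)%:R *: u - create j (annihilate i u).
Proof.
apply/ffunP => S; rewrite !ffunE !inE; have [<-|ij] := eqVneq i j.
  rewrite scale1r /=; case: ifP => iS.
    by rewrite finset.setD1K// scalerA sign_atD1 sign_atM scale1r subrr.
  by rewrite finset.setU1K ?iS// scalerA sign_atU1 sign_atM scale1r subr0.
rewrite scale0r add0r /=.
case: ifP => [iS|/negbT iS]; case: ifP => [jS|/negbT jS]; rewrite ?scaler0 ?oppr0//.
have -> : (i |: S) :\ j = i |: (S :\ j).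
  by apply/setP => k; rewrite !inE; case: (eqVneq k i) => [->|]; rewrite ?andbT ?ij.
rewrite !scalerA -scaleNr; congr (_ *: _); rewrite (sign_atU j iS) (sign_atD i jS).
by move: ij; rewrite -val_eqE; case: ltngtP => //= _ _; ring.
Qed.

Definition wedge l u : kchain := \sum_i coord e i l *: create i u.

Definition contract (f : L -> K) u : kchain := \sum_(i < n) f e`_i *: annihilate i u.

(** The extension of [D] to a derivation of the exterior algebra; [derive_wedge_wedge] is its
    Leibniz rule. *)
Definition derive_wedge (D : L -> L) u : kchain := \sum_(j < n) wedge (D e`_j) (annihilate j u).

Definition on_coef (T : X -> X) u : kchain := [ffun S : {set 'I_n} => T (u S)].

Lemma linear_wedge l : linear (wedge l).
Proof.
move=> c u v; rewrite /wedge scaler_sumr -big_split; apply: eq_bigr => i _ /=.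
by rewrite linearP scalerDr !scalerA mulrC.
Qed.
HB.instance Definition _ l := GRing.isLinear.Build K kchain kchain *:%R (wedge l) (linear_wedge l).

Lemma linear_contract f : linear (contract f).
Proof.
move=> c u v; rewrite /contract scaler_sumr -big_split; apply: eq_bigr => i _ /=.
by rewrite linearP scalerDr !scalerA mulrC.
Qed.
HB.instance Definition _ f :=
  GRing.isLinear.Build K kchain kchain *:%R (contract f) (linear_contract f).

Lemma linear_derive_wedge D : linear (derive_wedge D).
Proof.
move=> c u v; rewrite /derive_wedge scaler_sumr -big_split; apply: eq_bigr => i _ /=.
by rewrite !linearP.
Qed.
HB.instance Definition _ D :=
  GRing.isLinear.Build K kchain kchain *:%R (derive_wedge D) (linear_derive_wedge D).

Lemma linear_on_coef T : linear T -> linear (on_coef T).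
Proof. by move=> linT c u v; apply/ffunP => S; rewrite !ffunE linT. Qed.

Lemma wedgeP c a b u : wedge (c *: a + b) u = c *: wedge a u + wedge b u.
Proof.
rewrite /wedge scaler_sumr -big_split; apply: eq_bigr => i _ /=.
by rewrite linearP scalerDl scalerA.
Qed.

Lemma wedgeN a u : wedge (- a) u = - wedge a u.
Proof.
have lin : linear (fun l => wedge l u) by move=> k a' b'; apply: wedgeP.
exact: (linear_mapN lin).
Qed.

Lemma wedge0 u : wedge 0 u = 0.
Proof. by rewrite /wedge big1// => i _; rewrite linear0 scale0r. Qed.

Lemma wedge_sum (I : finType) (c : I -> K) (a : I -> L) u :
  wedge (\sum_i c i *: a i) u = \sum_i c i *: wedge (a i) u.
Proof.
have lin : linear (fun l => wedge l u) by move=> k a' b'; apply: wedgeP.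
rewrite (linear_map_sum lin); apply: eq_bigr => i _; exact: (linear_mapZ lin).
Qed.

Lemma wedgeC a b u : wedge a (wedge b u) = - wedge b (wedge a u).
Proof.
have wedge2 a' b' : wedge a' (wedge b' u) =
    \sum_i \sum_j (coord e i a' * coord e j b') *: create i (create j u).
  rewrite {1}/wedge; apply: eq_bigr => i _; rewrite {1}/wedge linear_sum scaler_sumr.
  by apply: eq_bigr => j _; rewrite linearZ scalerA.
rewrite !wedge2 [in RHS]exchange_big -sumrN; apply: eq_bigr => i _ /=.
by rewrite -sumrN; apply: eq_bigr => j _; rewrite createC scalerN mulrC.
Qed.

Lemma wedge_wedge a u : wedge a (wedge a u) = 0.
Proof.
apply/eqP; have := wedgeC a a u => /eqP; rewrite -addr_eq0 -mulr2n -scaler_nat.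
by rewrite scaler_eq0 pnatr_eq0.
Qed.

Lemma annihilate_wedge i l u :
  annihilate i (wedge l u) = coord e i l *: u - wedge l (annihilate i u).
Proof.
rewrite /wedge linear_sum (eq_bigr (fun j =>
    (coord e j l * (i == j)%:R) *: u - coord e j l *: create j (annihilate i u))).
  rewrite big_split /= sumrN -scaler_suml; congr (_ *: _ - _).
  by rewrite (bigD1 i)//= eqxx mulr1 big1 ?addr0// => j /negbTE; rewrite eq_sym => ->; rewrite mulr0.
by move=> j _; rewrite linearZ /= annihilate_create scalerBr scalerA.
Qed.

Let coordK l : l = \sum_(i < n) coord e i l *: e`_i.
Proof. by rewrite -(coord_vbasis (memvf l)). Qed.

Lemma contract_wedge (f : L -> K) l u : scalar f ->
  contract f (wedge l u) = f l *: u - wedge l (contract f u).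
Proof.
move=> linf; rewrite {1}/contract (eq_bigr (fun i : 'I_n => (f e`_i * coord e i l) *: u -
    f e`_i *: wedge l (annihilate i u))).
  rewrite big_split /= sumrN -scaler_suml; congr (_ *: _ - _).
    rewrite [in RHS](coordK l) (linear_map_sum (V2 := K^o) linf); apply: eq_bigr => i _.
    by rewrite (linear_mapZ (V2 := K^o) linf) mulrC.
  by rewrite /contract linear_sum; apply: eq_bigr => i _; rewrite linearZ.
by move=> i _; rewrite annihilate_wedge scalerBr scalerA.
Qed.

Lemma derive_wedge_wedge (D : L -> L) l u : linear D ->
  derive_wedge D (wedge l u) = wedge l (derive_wedge D u) + wedge (D l) u.
Proof.
move=> linD; rewrite {1}/derive_wedge (eq_bigr (fun j =>
    coord e j l *: wedge (D e`_j) u + wedge l (wedge (D e`_j) (annihilate j u)))).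
  rewrite big_split /= addrC; congr (_ + _).
    by rewrite /derive_wedge linear_sum.
  rewrite -wedge_sum [in RHS](coordK l) (linear_map_sum linD).
  by congr wedge; apply: eq_bigr => i _; rewrite (linear_mapZ linD).
by move=> j _; rewrite annihilate_wedge linearB linearZ /= [wedge (D _) (wedge l _)]wedgeC opprK.
Qed.

Lemma on_coef_wedge T l u : linear T -> on_coef T (wedge l u) = wedge l (on_coef T u).
Proof.
move=> linT; apply/ffunP => S; rewrite ffunE /wedge !sum_ffunE (linear_map_sum linT).
apply: eq_bigr => i _; rewrite !ffunE (linear_mapZ linT); congr (_ *: _).
by case: ifP => _; rewrite ?(linear_mapZ linT) ?(linear_map0 linT).
Qed.

Definition scalars x : kchain := kwedge x [::].

Lemma scalarsE x S : scalars x S = if S == finset.set0 then x else 0.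
Proof.
by rewrite ffunE /= cards_eq0; case: eqP => // _; rewrite det_mx00 scale1r.
Qed.

Lemma annihilate_scalars i x : annihilate i (scalars x) = 0.
Proof.
apply/ffunP => S; rewrite !ffunE; case: ifP => // _.
have /negbTE -> : #|i |: S| != size (Nil L) by rewrite cards_eq0; apply/finset.set0Pn; exists i; rewrite !inE eqxx.
by rewrite scaler0.
Qed.

Lemma contract_scalars f x : contract f (scalars x) = 0.
Proof. by apply: big1 => i _; rewrite annihilate_scalars scaler0. Qed.

Lemma derive_wedge_scalars D x : derive_wedge D (scalars x) = 0.
Proof. by apply: big1 => i _; rewrite annihilate_scalars linear0. Qed.

Lemma on_coef_scalars T x : linear T -> on_coef T (scalars x) = scalars (T x).
Proof.
move=> linT; apply/ffunP => S; rewrite ffunE !scalarsE.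
by case: ifP => //; rewrite (linear_map0 linT).
Qed.

(* Laplace expansion of the minors along the row of l. *)
Lemma kwedge_cons x l (s : seq L) : kwedge x (l :: s) = wedge l (kwedge x s).
Proof.
apply/ffunP => S; rewrite /wedge sum_ffunE ffunE /=.
rewrite (eq_bigr (fun i => if i \in S then (coord e i l * sign_at i S) *: kwedge x s (S :\ i) else 0)); last first.
  by move=> i _; rewrite !ffunE; case: ifP => _; rewrite ?scaler0// !scalerA.
rewrite -big_mkcond /=; have [cS|cS] := eqVneq #|S| (size s).+1; last first.
  rewrite big1// => i iS; rewrite ffunE ifF ?scaler0//; apply/negbTE.
  by apply: contra_neq cS => <-; rewrite [LHS](cardsD1 i) iS.
rewrite (expand_det_row _ ord0) scaler_suml -[RHS]big_enum /=.
have [i0 i0S] : exists i0, i0 \in S by apply/card_gt0P; rewrite cS.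
rewrite (big_nth i0) big_mkord -cardE cS; apply: eq_bigr => j _.
have ltj : (j < size (enum S))%N by rewrite -cardE cS.
set i := nth i0 (enum S) j; have iS : i \in S by rewrite -mem_enum mem_nth.
have idx : index i (enum S) = j by rewrite index_uniq ?enum_uniq.
have cD : #|S :\ i| == size s by move: cS; rewrite (cardsD1 i) iS add1n => -[] ->.
rewrite !ffunE cD !scalerA !mxE /= (nth_map i0)// -/i; congr (_ *: _).
rewrite -mulrA; congr (_ * _); rewrite /cofactor /sign_at card_lt_index// idx.
congr (_ * \det _); apply/matrixP => a b; rewrite !mxE /=.
have ltb : (b < size (enum (S :\ i)))%N by rewrite -cardE (eqP cD).
rewrite !(nth_map i0)//; last first.
  by rewrite -cardE cS; apply: (ltn_ord (lift j b)).
congr (coord _ _ _); rewrite enum_setD1// idx nth_cat size_take ltj /bump.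
case: ltnP => bj; first by rewrite nth_take// leqNgt bj.
by rewrite nth_drop addSn subnKC.
Qed.

Lemma kchain_basis u : u = \sum_S kwedge (u S) (basis_seq S).
Proof.
apply/ffunP => S; rewrite sum_ffunE (bigD1 S)//= kwedge_basis ffunE eqxx.
rewrite big1 ?addr0// => S' neq; rewrite kwedge_basis ffunE.
by rewrite eq_sym (negbTE neq).
Qed.

Lemma kwedge_foldr x s : kwedge x s = foldr wedge (scalars x) s.
Proof. by elim: s => //= l s IH; rewrite kwedge_cons IH. Qed.

Lemma kchain_ind (P : kchain -> Prop) : P 0 -> (forall u v, P u -> P v -> P (u + v)) ->
  (forall x, P (scalars x)) -> (forall l u, P u -> P (wedge l u)) -> forall u, P u.
Proof.
move=> P0 PD Px Pl u; rewrite (kchain_basis u); elim/big_ind: _ => // S _.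
by rewrite kwedge_foldr; elim: (basis_seq S) => //= l s IH; apply: Pl.
Qed.

(** Exterior multiplications generate all chains from scalars. Identities between operators thus
    follow from their values on scalars and their exchange rules with [wedge]; this is the induction
    behind most identities below. *)
Lemma linear_eq (V : lmodType K) (T T' : kchain -> V) : linear T -> linear T' ->
  (forall x, T (scalars x) = T' (scalars x)) ->
  (forall l u, T u = T' u -> T (wedge l u) = T' (wedge l u)) -> T =1 T'.
Proof.
move=> linT linT' Tx Tl; apply: kchain_ind => //.
  by rewrite (linear_map0 linT) (linear_map0 linT').
by move=> u v Tu Tv; rewrite (linear_mapD linT) (linear_mapD linT') Tu Tv.
Qed.

Lemma kwedgeC x a b s : kwedge x (a :: b :: s) = - kwedge x (b :: a :: s).
Proof. by rewrite !kwedge_cons wedgeC. Qed.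

Lemma derive_wedge_kwedge (D : L -> L) x s : linear D ->
  derive_wedge D (kwedge x s) =
  \sum_(j < size s) (-1) ^+ j *: kwedge x (D s`_j :: del j s).
Proof.
move=> linD; elim: s => [|l s IH]; first by rewrite big_ord0 [LHS]derive_wedge_scalars.
rewrite kwedge_cons derive_wedge_wedge// IH big_ord_recl /= expr0 scale1r.
rewrite /del /= drop0 -kwedge_cons addrC; congr (_ + _).
rewrite linear_sum; apply: eq_bigr => j _; rewrite linearZ /= -kwedge_cons /=.
by rewrite kwedgeC exprS mulN1r scalerN scaleNr.
Qed.

End FockSpace.

(** * The Koszul differential and Cartan's formula *)

Section Koszul.
Variables (K : numFieldType) (L : vectType K) (X : lmodType K).
Variables (br : L -> L -> L) (rho : L -> X -> X).
Local Notation n := (\dim {:L}).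
Local Notation e := (vbasis {:L}).
Local Notation kchain := (kchain L X).
Hypothesis lie : is_lie_bracket br.
Hypotheses (rhoX : forall l, linear (rho l))
  (rhoL : forall c a b x, rho (c *: a + b) x = c *: rho a x + rho b x).
Implicit Types (u v : kchain) (S : {set 'I_n}) (i j : 'I_n) (x : X) (a b l m : L).

Lemma linear_br l : linear (br l).
Proof. by move=> c a b; apply: (lie_linearr lie). Qed.

Lemma linear_br_l l : linear (br^~ l).
Proof. by move=> c a b; apply: (lie_linearl lie). Qed.

Lemma lie_brC a b : br a b = - br b a.
Proof.
have := lie_alt lie (a + b); rewrite (linear_mapD (linear_br _)).
rewrite !(linear_mapD (linear_br_l _)) /= !(lie_alt lie) add0r addr0.
by move/eqP; rewrite addrC addr_eq0 => /eqP.
Qed.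

(** The second part unfolds to a sum of [[e_i, e_j] /\ annihilate j (annihilate i u)] over all
    ordered pairs; the factor 1/2 is there because each pair [i < j] is counted twice. *)
Definition koszul_op u : kchain :=
  \sum_(i < n) (on_coef (rho e`_i) (annihilate i u) +
    2^-1 *: derive_wedge (br e`_i) (annihilate i u)).

Definition lie_derivative (T : X -> X) (D : L -> L) u : kchain :=
  on_coef T u + derive_wedge D u.

Lemma linear_lie_derivative T D : linear T -> linear (lie_derivative T D).
Proof.
move=> linT c u v; rewrite /lie_derivative linearP /= (linear_on_coef linT).
by module.
Qed.

Lemma linear_koszul_op : linear koszul_op.
Proof.
move=> c u v; rewrite /koszul_op scaler_sumr -big_split; apply: eq_bigr => i _ /=.
by rewrite !linearP /= (linear_on_coef (rhoX _)); module.
Qed.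

Lemma lie_derivative_wedge T D l u : linear T -> linear D ->
  lie_derivative T D (wedge l u) = wedge l (lie_derivative T D u) + wedge (D l) u.
Proof.
move=> linT linD; rewrite /lie_derivative on_coef_wedge// derive_wedge_wedge// linearD.
by rewrite addrA.
Qed.

Lemma lie_derivative_scalars T D x : linear T ->
  lie_derivative T D (scalars L x) = scalars L (T x).
Proof. by move=> linT; rewrite /lie_derivative derive_wedge_scalars addr0 on_coef_scalars. Qed.

Local Notation theta l := (lie_derivative (rho l) (br l)).

Lemma koszul_op_scalars x : koszul_op (scalars L x) = 0.
Proof.
apply: big1 => i _; rewrite annihilate_scalars linear0 scaler0 addr0.
exact: (linear_map0 (linear_on_coef (rhoX _))).
Qed.

Lemma on_coef_sum (I : finType) (c : I -> K) (a : I -> L) u :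
  on_coef (rho (\sum_i c i *: a i)) u = \sum_i c i *: on_coef (rho (a i)) u.
Proof.
have lin : linear (fun l => on_coef (rho l) u).
  by move=> k l m; apply/ffunP => S; rewrite !ffunE rhoL.
rewrite (linear_map_sum lin); apply: eq_bigr => i _; exact: (linear_mapZ lin).
Qed.

Lemma derive_wedge_sum (I : finType) (c : I -> K) (a : I -> L) u :
  derive_wedge (br (\sum_i c i *: a i)) u = \sum_i c i *: derive_wedge (br (a i)) u.
Proof.
have lin : linear (fun l => derive_wedge (br l) u).
  move=> k l m; rewrite /derive_wedge scaler_sumr -big_split /=; apply: eq_bigr => j _.
  by rewrite (linear_br_l e`_j) wedgeP.
rewrite (linear_map_sum lin); apply: eq_bigr => i _; exact: (linear_mapZ lin).
Qed.

Let coordK l : l = \sum_(i < n) coord e i l *: e`_i.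
Proof. by rewrite -(coord_vbasis (memvf l)). Qed.

(* Cartan's formula. *)
Lemma koszul_op_wedge l u : koszul_op (wedge l u) = theta l u - wedge l (koszul_op u).
Proof.
(* The two terms with [2^-1] outside the last one are the two halves of [derive_wedge (br l) u]: one
   arises when [annihilate i] meets [l], the other when the derivation does, with
   [br e_i l = - br l e_i]. *)
rewrite {1}/koszul_op (eq_bigr (fun i : 'I_n =>
    coord e i l *: on_coef (rho e`_i) u +
    2^-1 *: (coord e i l *: derive_wedge (br e`_i) u) +
    2^-1 *: wedge (br l e`_i) (annihilate i u) -
    wedge l (on_coef (rho e`_i) (annihilate i u) +
      2^-1 *: derive_wedge (br e`_i) (annihilate i u)))).
  rewrite !big_split /= sumrN -!scaler_sumr -on_coef_sum -derive_wedge_sum -coordK.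
  rewrite -linear_sum /= -/(koszul_op u); congr (_ - _).
  rewrite /lie_derivative -addrA -scalerDr -/(derive_wedge (br l) u).
  congr (_ + _); set w := derive_wedge _ _.
  have -> : w + w = 2%:R *: w by rewrite scaler_nat mulr2n.
  by rewrite scalerA mulVf ?scale1r// pnatr_eq0.
move=> i _; rewrite annihilate_wedge !linearB !linearZ /=.
rewrite (linear_mapB (linear_on_coef (rhoX _))) (linear_mapZ (linear_on_coef (rhoX _))).
rewrite on_coef_wedge// derive_wedge_wedge; last exact: linear_br.
rewrite [br l _]lie_brC wedgeN [wedge l (_ + _ *: _)]linearD /= [wedge l (2^-1 *: _)]linearZ /=.
by module.
Qed.

(** The explicit formula obeys the same recursion as Cartan's formula: the terms that involve the
    new first vector make up [theta l], and in the others every index that moves by one, or every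
    exchange with [l], accounts for the sign. *)
Lemma koszul_formula_cons x l (s : seq L) :
  koszul_formula br rho x (l :: s) =
  theta l (kwedge x s) - wedge l (koszul_formula br rho x s).
Proof.
have th : theta l (kwedge x s) = kwedge (rho l x) s +
    \sum_(j < size s) (-1) ^+ j *: kwedge x (br l s`_j :: del j s).
  rewrite /lie_derivative derive_wedge_kwedge; last exact: linear_br.
  congr (_ + _); apply/ffunP => S; rewrite !ffunE; case: ifP => _.
    by rewrite (linear_mapZ (rhoX _)).
  by rewrite (linear_map0 (rhoX _)).
rewrite th /koszul_formula /= !big_ord_recl /= expr0 scale1r.
have -> : del 0 (l :: s) = s by rewrite /del /= drop0.
rewrite big_ord0 add0r (eq_bigr (fun k : 'I_(size s) =>
    - wedge l ((-1) ^+ k *: kwedge (rho s`_k x) (del k s)))); last first.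
  move=> k _; rewrite linearZ /= -kwedge_cons /bump /= add1n exprS mulN1r scaleNr.
  by congr (- (_ *: _)).
rewrite [X in _ + _ + X = _](eq_bigr (fun j : 'I_(size s) =>
    (-1) ^+ j *: kwedge x (br l s`_j :: del j s) - wedge l (\sum_(i < j)
      (-1) ^+ (i + j).+1 *: kwedge x (br s`_i s`_j :: del i (del j s))))).
  rewrite big_split /= !sumrN -!linear_sum /= linearD /=.
  by module.
move=> j _; rewrite /= big_ord_recl /= /bump /= !add1n !add0n; congr (_ + _).
  rewrite !exprS !mulN1r opprK; congr (_ *: kwedge x (_ :: _)).
  by rewrite /del /= drop0.
rewrite [wedge l _]linear_sum /= -sumrN; apply: eq_bigr => i _; rewrite linearZ /= -kwedge_cons.
rewrite [kwedge x [:: l, _ & _]]kwedgeC scalerN opprK; congr (_ *: _).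
by rewrite /bump /= add1n addSn addnS !exprS !mulN1r opprK.
Qed.

Lemma koszul_op_kwedge x s : koszul_op (kwedge x s) = koszul_formula br rho x s.
Proof.
elim: s => [|l s IH].
  by rewrite [LHS]koszul_op_scalars /koszul_formula !big_ord0 addr0.
by rewrite kwedge_cons koszul_op_wedge IH koszul_formula_cons.
Qed.

Lemma koszul_dE u : koszul_d br rho u = koszul_op u.
Proof.
rewrite [in RHS](kchain_basis u) (linear_map_sum linear_koszul_op).
by apply: eq_bigr => S _; rewrite koszul_op_kwedge.
Qed.

(** By Cartan's formula it is enough to know the commutator with each [theta l], and compatibility
    of [T] and [D] makes it [theta (D l)]. *)
Lemma lie_derivative_comm T D u : linear T -> linear D ->
  (forall l x, T (rho l x) = rho (D l) x + rho l (T x)) ->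
  (forall a b, D (br a b) = br (D a) b + br a (D b)) ->
  lie_derivative T D (koszul_op u) = koszul_op (lie_derivative T D u).
Proof.
move=> linT linD Trho Dbr; have linLD := linear_lie_derivative D linT.
have linLK := linear_koszul_op.
have thetaP l v : lie_derivative T D (theta l v) =
    theta l (lie_derivative T D v) + theta (D l) v.
  have linth m := linear_lie_derivative (br m) (rhoX m).
  move: v; apply: linear_eq.
  - by move=> c y z; rewrite linth linLD.
  - by move=> c y z; rewrite linLD !linth; module.
  - by move=> x; rewrite !lie_derivative_scalars// Trho addrC; apply/ffunP => S; rewrite !ffunE; case: ifP => _; rewrite ?addr0// scalerDr.
  - move=> m v IH; have lb := linear_br.
    rewrite !lie_derivative_wedge// (linear_mapD linLD) !lie_derivative_wedge//.
    rewrite (linear_mapD (linth l)) !lie_derivative_wedge// IH Dbr linearD /=.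
    have -> : wedge (br (D l) m + br l (D m)) v = wedge (br (D l) m) v + wedge (br l (D m)) v.
      by rewrite -[br (D l) m]scale1r wedgeP !scale1r.
    by module.
move: u; apply: linear_eq.
- by move=> c y z; rewrite linLK linLD.
- by move=> c y z; rewrite linLD linLK.
- by move=> x; rewrite lie_derivative_scalars// !koszul_op_scalars (linear_map0 linLD).
- move=> l v IH; rewrite koszul_op_wedge (linear_mapB linLD) thetaP.
  rewrite !lie_derivative_wedge// (linear_mapD linLK) !koszul_op_wedge IH.
  by module.
Qed.

End Koszul.

(** * Functoriality of the exterior algebra and of the Koszul complex *)

Section Functoriality.
Variables (K : numFieldType) (L1 L2 : vectType K) (X : lmodType K).
Variable g : L1 -> L2.
Hypothesis ling : linear g.
Local Notation n1 := (\dim {:L1}).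
Local Notation e1 := (vbasis {:L1}).
Local Notation chain1 := (kchain L1 X).
Local Notation chain2 := (kchain L2 X).
Implicit Types (S : {set 'I_n1}) (x : X) (u : chain1).

Definition exterior_map u : chain2 := \sum_S kwedge (u S) (map g (basis_seq S)).

Lemma linear_kwedge (L : vectType K) (s : seq L) : linear (fun x : X => kwedge x s).
Proof.
move=> c x y; apply/ffunP => S; rewrite !ffunE; case: ifP => _; last by rewrite scaler0 addr0.
by rewrite scalerDr !scalerA mulrC.
Qed.

Lemma linear_exterior_map : linear exterior_map.
Proof.
move=> c u v; rewrite /exterior_map scaler_sumr -big_split; apply: eq_bigr => S _ /=.
by rewrite !ffunE linear_kwedge.
Qed.

Lemma exterior_map_basis x S :
  exterior_map (kwedge x (basis_seq S)) = kwedge x (map g (basis_seq S)).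
Proof.
rewrite /exterior_map (bigD1 S)//= kwedge_basis ffunE eqxx big1 ?addr0// => S' neq.
by rewrite ffunE (negbTE neq) (linear_map0 (linear_kwedge _)).
Qed.

Lemma exterior_map_scalars x : exterior_map (scalars L1 x) = scalars L2 x.
Proof.
have E : basis_seq (finset.set0 : {set 'I_n1}) = [::] by rewrite /basis_seq finset.enum_set0.
by have := exterior_map_basis x finset.set0; rewrite E.
Qed.

Lemma kwedge_insert (L : vectType K) (a b : seq L) (l : L) x :
  kwedge x (a ++ l :: b) = (-1) ^+ size a *: kwedge x (l :: a ++ b).
Proof.
elim: a => [|m a IH] /=; first by rewrite expr0 scale1r.
rewrite kwedge_cons IH linearZ /= -kwedge_cons kwedgeC exprS mulN1r.
by rewrite scalerN scaleNr.
Qed.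

Lemma kwedge_mem (L : vectType K) (s : seq L) (l : L) x : l \in s -> kwedge x (l :: s) = 0.
Proof.
move=> /path.splitPr[a b]; rewrite kwedge_cons kwedge_insert linearZ /=.
by rewrite kwedge_cons wedge_wedge scaler0.
Qed.

(** On a basis element, multiplication by [e_i] gives 0 if [e_i] already occurs, and otherwise a
    basis element up to the sign of moving [e_i] to its place. After [g] the same move costs the
    same sign. *)
Lemma exterior_map_wedge_basis i u :
  exterior_map (wedge e1`_i u) = wedge (g e1`_i) (exterior_map u).
Proof.
rewrite (kchain_basis u) [wedge _ _ in LHS]linear_sum /=.
rewrite !(linear_map_sum linear_exterior_map) [in RHS]linear_sum /=.
apply: eq_bigr => S _; set x := u S; rewrite exterior_map_basis -!kwedge_cons.
have [lt_i|ge_i] := ltnP i n1; last first.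
  rewrite nth_default ?size_tuple//.
  by rewrite (linear_map0 ling) !kwedge_cons !wedge0 (linear_map0 linear_exterior_map).
pose j := Ordinal lt_i; rewrite (_ : i = nat_of_ord j)//.
have [jS|jS] := boolP (j \in S).
  rewrite kwedge_mem ?(linear_map0 linear_exterior_map); last first.
    by apply/mapP; exists j; rewrite ?mem_enum.
  by rewrite kwedge_mem//; apply/map_f/mapP; exists j; rewrite ?mem_enum.
have [a [b [Ta Sa]]] : exists a b, basis_seq (j |: S) = a ++ e1`_j :: b /\
    basis_seq S = a ++ b.
  have jT : j \in j |: S by rewrite !inE eqxx.
  exists [seq e1`_(nat_of_ord k) | k <- take (index j (enum (j |: S))) (enum (j |: S))].
  exists [seq e1`_(nat_of_ord k) | k <- drop (index j (enum (j |: S))).+1 (enum (j |: S))].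
  split; last first.
    by rewrite -map_cat -enum_setD1// finset.setU1K.
  rewrite -[e1`_j]/((fun k : 'I_n1 => e1`_k) j) -map_cons -map_cat; congr map.
  have szj : (index j (enum (j |: S)) < size (enum (j |: S)))%N by rewrite index_mem mem_enum.
  by have := drop_nth j szj; rewrite nth_index ?mem_enum// => <-; rewrite cat_take_drop.
have -> : kwedge x (e1`_j :: basis_seq S) = (-1) ^+ size a *: kwedge x (basis_seq (j |: S)).
  by rewrite Sa Ta kwedge_insert scalerA -expr2 sqrr_sign scale1r.
rewrite (linear_mapZ linear_exterior_map) exterior_map_basis Sa Ta !map_cat /=.
by rewrite kwedge_insert size_map scalerA -expr2 sqrr_sign scale1r.
Qed.

Lemma exterior_map_wedge l u : exterior_map (wedge l u) = wedge (g l) (exterior_map u).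
Proof.
have linl : linear (fun m => exterior_map (wedge m u)).
  by move=> c a b; rewrite wedgeP linear_exterior_map.
have linr : linear (fun m => wedge (g m) (exterior_map u)).
  by move=> c a b; rewrite ling wedgeP.
have -> : l = \sum_(i < n1) coord e1 i l *: e1`_i by rewrite -(coord_vbasis (memvf l)).
rewrite (linear_map_sum linl) (linear_map_sum linr); apply: eq_bigr => i _.
by rewrite (linear_mapZ linl) (linear_mapZ linr) exterior_map_wedge_basis.
Qed.

End Functoriality.

Section ExteriorMaps.
Variables (K : numFieldType) (X : lmodType K).

Lemma exterior_mapK (L1 L2 : vectType K) (g : L1 -> L2) (h : L2 -> L1) :
  linear g -> linear h -> cancel g h ->
  cancel (exterior_map (X := X) g) (exterior_map (X := X) h).
Proof.
move=> ling linh ghK; apply: linear_eq.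
- by move=> c u v; rewrite (linear_exterior_map g) (linear_exterior_map h).
- by [].
- by move=> x; rewrite !exterior_map_scalars.
- by move=> l u IH; rewrite !exterior_map_wedge// IH ghK.
Qed.

Lemma exterior_map_lie_derivative (L1 L2 : vectType K) (g : L1 -> L2) (T : X -> X)
    (D1 : L1 -> L1) (D2 : L2 -> L2) u :
  linear g -> linear T -> linear D1 -> linear D2 -> (forall l, g (D1 l) = D2 (g l)) ->
  exterior_map g (lie_derivative T D1 u) = lie_derivative T D2 (exterior_map g u).
Proof.
move=> ling linT lin1 lin2 gD; have linJ := linear_exterior_map (X := X) g.
move: u; apply: linear_eq.
- by move=> c u v; rewrite (linear_lie_derivative _ linT) linJ.
- by move=> c u v; rewrite linJ (linear_lie_derivative _ linT).
- by move=> x; rewrite exterior_map_scalars !lie_derivative_scalars// exterior_map_scalars.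
- move=> l u IH; rewrite exterior_map_wedge// !lie_derivative_wedge// (linear_mapD linJ).
  by rewrite !exterior_map_wedge// IH gD.
Qed.

Lemma exterior_map_koszul_op (L1 L2 : vectType K) (g : L1 -> L2)
    (br1 : L1 -> L1 -> L1) (br2 : L2 -> L2 -> L2) (rho1 : L1 -> X -> X)
    (rho2 : L2 -> X -> X) u :
  linear g -> is_lie_bracket br1 -> is_lie_bracket br2 ->
  (forall l, linear (rho2 l)) ->
  (forall c a b x, rho2 (c *: a + b) x = c *: rho2 a x + rho2 b x) ->
  (forall a b, g (br1 a b) = br2 (g a) (g b)) -> (forall l, rho1 l = rho2 (g l)) ->
  exterior_map g (koszul_op br1 rho1 u) = koszul_op br2 rho2 (exterior_map g u).
Proof.
move=> ling lie1 lie2 rho2X rho2L gbr rhog.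
have rho1X l : linear (rho1 l) by rewrite rhog.
have rho1L c a b x : rho1 (c *: a + b) x = c *: rho1 a x + rho1 b x.
  by rewrite !rhog ling rho2L.
have linJ := linear_exterior_map (X := X) g.
have lin1 := linear_koszul_op br1 rho1X; have lin2 := linear_koszul_op br2 rho2X.
move: u; apply: linear_eq.
- by move=> c u v; rewrite lin1 linJ.
- by move=> c u v; rewrite linJ lin2.
- by move=> x; rewrite exterior_map_scalars !koszul_op_scalars// (linear_map0 linJ).
- move=> l u IH; rewrite exterior_map_wedge// !koszul_op_wedge// (linear_mapB linJ).
  rewrite exterior_map_wedge// IH (exterior_map_lie_derivative (D2 := br2 (g l))) ?rhog//.
  + exact: linear_br.
  + exact: linear_br.
Qed.

End ExteriorMaps.

(** * Homology and ideals of codimension one *)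

Section Degrees.
Variables (K : numFieldType) (L : vectType K) (X : lmodType K).
Local Notation n := (\dim {:L}).
Local Notation kchain := (kchain L X).
Local Notation kdegree := (@kdegree K L X).
Implicit Types (u v : kchain) (S : {set 'I_n}) (i : 'I_n) (p : nat).

Lemma subspace_kdegree p : is_subspace (kdegree p).
Proof.
split=> [S _|c u v Pu Pv S cS]; first by rewrite ffunE.
by rewrite !ffunE Pu// Pv// scaler0 addr0.
Qed.

Lemma create_degree p i u : kdegree p u -> kdegree p.+1 (create i u).
Proof.
move=> Pu S cS; rewrite ffunE; case: ifP => // iS; rewrite Pu ?scaler0// => cSi.
by apply: cS; rewrite (cardsD1 i) iS cSi.
Qed.

Lemma annihilate_degree p i u : kdegree p.+1 u -> kdegree p (annihilate i u).
Proof.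
move=> Pu S cS; rewrite ffunE; case: ifP => // /negbT iS; rewrite Pu ?scaler0//.
by rewrite cardsU1 iS add1n => -[].
Qed.

Lemma annihilate_degree0 i u : kdegree 0 u -> annihilate i u = 0.
Proof.
move=> Pu; apply/ffunP => S; rewrite !ffunE; case: ifP => // /negbT iS.
by rewrite Pu ?scaler0// cardsU1 iS.
Qed.

Lemma wedge_degree p (l : L) u : kdegree p u -> kdegree p.+1 (wedge l u).
Proof.
move=> Pu; apply: subspace_sum => [|i _]; first exact: subspace_kdegree.
by apply: (subspaceZ (subspace_kdegree _)); apply: create_degree.
Qed.

Lemma contract_degree p (f : L -> K) u : kdegree p.+1 u -> kdegree p (contract f u).
Proof.
move=> Pu; apply: subspace_sum => [|i _]; first exact: subspace_kdegree.
by apply: (subspaceZ (subspace_kdegree _)); apply: annihilate_degree.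
Qed.

Lemma contract_degree0 (f : L -> K) u : kdegree 0 u -> contract f u = 0.
Proof. by move=> Pu; apply: big1 => i _; rewrite annihilate_degree0// scaler0. Qed.

Lemma derive_wedge_degree p D u : kdegree p u -> kdegree p (derive_wedge D u).
Proof.
case: p => [|p] Pu; apply: subspace_sum => [|i _]; try exact: subspace_kdegree.
  rewrite annihilate_degree0// linear0; exact: (subspace_kdegree 0).1.
by apply: wedge_degree; apply: annihilate_degree.
Qed.

Lemma on_coef_degree p T u : linear T -> kdegree p u -> kdegree p (on_coef T u).
Proof. by move=> linT Pu S cS; rewrite ffunE Pu// (linear_map0 linT). Qed.

Lemma lie_derivative_degree p T D u : linear T -> kdegree p u ->
  kdegree p (lie_derivative T D u).
Proof.
move=> linT Pu; apply: (subspaceD (subspace_kdegree p)); first exact: on_coef_degree.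
exact: derive_wedge_degree.
Qed.

Lemma koszul_op_degree p br (rho : L -> X -> X) u : (forall l, linear (rho l)) ->
  kdegree p.+1 u -> kdegree p (koszul_op br rho u).
Proof.
move=> rhoX Pu; apply: subspace_sum => [|i _]; first exact: subspace_kdegree.
have Pa := annihilate_degree i Pu; apply: (subspaceD (subspace_kdegree p)).
  exact: on_coef_degree.
by apply: (subspaceZ (subspace_kdegree p)); apply: derive_wedge_degree.
Qed.

Lemma koszul_op_degree0 br (rho : L -> X -> X) u : (forall l, linear (rho l)) ->
  kdegree 0 u -> koszul_op br rho u = 0.
Proof.
move=> rhoX Pu; apply: big1 => i _; rewrite annihilate_degree0// linear0 scaler0 addr0.
exact: (linear_map0 (linear_on_coef (rhoX _))).
Qed.

Lemma kdegree_gt p u : (n < p)%N -> kdegree p u -> u = 0.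
Proof.
move=> np Pu; apply/ffunP => S; rewrite ffunE Pu// => cS.
by have := max_card (mem S); rewrite cS card_ord leqNgt np.
Qed.

End Degrees.

Lemma exterior_map_degree (K : numFieldType) (L1 L2 : vectType K) (X : lmodType K)
    (g : L1 -> L2) p (u : kchain L1 X) : kdegree p u -> kdegree p (exterior_map g u).
Proof.
move=> Pu; apply: subspace_sum => [|S _]; first exact: subspace_kdegree.
have [cS|cS] := eqVneq #|S| p; last first.
  rewrite Pu; last exact/eqP.
  rewrite (linear_map0 (linear_kwedge (X := X) _)); exact: (subspace_kdegree _ _ p).1.
move=> T cT; rewrite ffunE ifF//; apply/negbTE; apply/eqP => cT'; apply: cT.
by rewrite cT' size_map size_map -cardE.
Qed.

Record lie_module (K : numFieldType) (L : vectType K) (X : lmodType K)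
    (br : L -> L -> L) (rho : L -> X -> X) : Prop := LieModule {
  module_lie : is_lie_bracket br;
  module_linear : forall l, linear (rho l);
  module_linearl : forall c a b x, rho (c *: a + b) x = c *: rho a x + rho b x;
  module_bracket : forall a b x, rho (br a b) x = rho a (rho b x) - rho b (rho a x) }.

Section Homology.
Variables (K : numFieldType) (L : vectType K) (X : lmodType K).
Variables (br : L -> L -> L) (rho : L -> X -> X).
Hypothesis mod_rho : lie_module br rho.
Let lie := module_lie mod_rho.
Let rhoX := module_linear mod_rho.
Let rhoL := module_linearl mod_rho.
Local Notation d := (koszul_op br rho).
Local Notation theta l := (lie_derivative (rho l) (br l)).

Definition cycles p : set (kchain L X) := [set u | kdegree p u /\ d u = 0].

Lemma fin_dim_homologyE p :
  fin_dim_homology br rho p = fin_dim_quotient (cycles p) (d @` kdegree p.+1).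
Proof.
have dE : koszul_d br rho = d by apply: funext => u; apply: koszul_dE.
by rewrite /fin_dim_homology /koszul_cycles /koszul_boundaries dE.
Qed.

Lemma subspace_cycles p : is_subspace (cycles p).
Proof.
have lind := linear_koszul_op br rhoX; have [k0 kD] := subspace_kdegree L X p.
split=> [|c u v [Pu du] [Pv dv]]; first by split=> //; rewrite (linear_map0 lind).
by split; [exact: kD | rewrite lind du dv scaler0 addr0].
Qed.

Lemma subspace_boundaries p : is_subspace (d @` kdegree p).
Proof.
have lind := linear_koszul_op br rhoX; have [k0 kD] := subspace_kdegree L X p.
split=> [|c _ _ [u Pu <-] [v Pv <-]]; first by exists 0 => //; rewrite (linear_map0 lind).
by exists (c *: u + v); [exact: kD | rewrite lind].
Qed.

Lemma theta_comm l u : theta l (d u) = d (theta l u).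
Proof.
apply: lie_derivative_comm => //.
- exact: linear_br.
- by move=> m x; rewrite (module_bracket mod_rho) subrK.
- move=> a b; have := lie_jacobi lie l a b.
  rewrite [br b (br l a)](lie_brC lie) [br b l](lie_brC lie).
  rewrite (linear_mapN (linear_br lie a)) => /eqP.
  by rewrite subr_eq0 subr_eq addrC => /eqP ->.
Qed.

(** Cartan's formula, applied twice, gives [d (d (l /\ u)) = d (theta l u) - theta l (d u) + l /\ d
    (d u)]. *)
Lemma koszul_op_square u : d (d u) = 0.
Proof.
have lind := linear_koszul_op br rhoX; move: u; apply: linear_eq.
- by move=> c u v; rewrite !lind.
- by move=> c u v; rewrite scaler0 addr0.
- by move=> x; rewrite koszul_op_scalars// (linear_map0 lind).
- move=> l u IH; rewrite koszul_op_wedge// (linear_mapB lind) koszul_op_wedge// IH linear0.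
  by rewrite theta_comm subr0 subrr.
Qed.

Lemma boundary_cycle p u : kdegree p.+1 u -> cycles p (d u).
Proof. by move=> Pu; split; [exact: koszul_op_degree | exact: koszul_op_square]. Qed.

End Homology.

Section Retract.
Variables (K : numFieldType) (X : lmodType K) (L1 L2 : vectType K).
Variables (br1 : L1 -> L1 -> L1) (br2 : L2 -> L2 -> L2).
Variables (rho1 : L1 -> X -> X) (rho2 : L2 -> X -> X).
Hypotheses (mod1 : lie_module br1 rho1) (mod2 : lie_module br2 rho2).
Variables (g : L1 -> L2) (h : L2 -> L1).
Hypotheses (ling : linear g) (linh : linear h) (ghK : cancel g h).
Hypotheses (gbr : forall a b, g (br1 a b) = br2 (g a) (g b))
  (hbr : forall a b, h (br2 a b) = br1 (h a) (h b)).
Hypotheses (rhog : forall l, rho1 l = rho2 (g l)) (rhoh : forall l, rho2 l = rho1 (h l)).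

Lemma fin_dim_homology_retract p :
  fin_dim_homology br2 rho2 p -> fin_dim_homology br1 rho1 p.
Proof.
have [lie1 rho1X rho1L _] := mod1; have [lie2 rho2X rho2L _] := mod2.
have chain1 u : exterior_map g (koszul_op br1 rho1 u) = koszul_op br2 rho2 (exterior_map g u).
  exact: exterior_map_koszul_op.
have chain2 u : exterior_map h (koszul_op br2 rho2 u) = koszul_op br1 rho1 (exterior_map h u).
  exact: exterior_map_koszul_op.
rewrite !fin_dim_homologyE// => fin; apply: fin_dim_quotient_sub fin _ _.
- exact: (linear_exterior_map g).
- exact: subspace_cycles.
- exact: subspace_boundaries.
- move=> z [Pz dz]; split; first exact: exterior_map_degree.
  rewrite -chain1 dz.
  exact: (linear_map0 (linear_exterior_map g)).
- move=> z _ [w Pw dw]; exists (exterior_map h w); first exact: exterior_map_degree.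
  rewrite -chain2 dw.
  exact: exterior_mapK.
Qed.

End Retract.

Section CodimensionOne.
Variables (K : numFieldType) (X : lmodType K) (L1 L2 : vectType K).
Variables (br1 : L1 -> L1 -> L1) (br2 : L2 -> L2 -> L2).
Variables (rho1 : L1 -> X -> X) (rho2 : L2 -> X -> X).
Hypotheses (mod1 : lie_module br1 rho1) (mod2 : lie_module br2 rho2).
Variables (g : L1 -> L2) (h : L2 -> L1) (phi : L2 -> K) (l : L2).
Hypotheses (ling : linear g) (linh : linear h) (ghK : cancel g h) (hl : h l = 0)
  (linphi : scalar phi)
  (phig : forall a, phi (g a) = 0) (phil : phi l = 1)
  (dec : forall x, x = g (h x) + phi x *: l).
Hypotheses (gbr : forall a b, g (br1 a b) = br2 (g a) (g b))
  (phibr : forall a b, phi (br2 a b) = 0) (rhog : forall a, rho1 a = rho2 (g a)).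
Local Notation d1 := (koszul_op br1 rho1).
Local Notation d2 := (koszul_op br2 rho2).
Local Notation J := (exterior_map (X := X) g).
Local Notation Q := (exterior_map (X := X) h).

(** The action of [ad l] on [L1]. By [phibr], all brackets of [L2] lie in the image of [g], so the
    projection [h] loses nothing ([ad_restrictE]). *)
Definition ad_restrict (a : L1) : L1 := h (br2 l (g a)).
Local Notation Theta := (lie_derivative (rho2 l) ad_restrict).

Let lie1 := module_lie mod1.
Let lie2 := module_lie mod2.
Let rho1X := module_linear mod1.
Let rho2X := module_linear mod2.
Let rho2L := module_linearl mod2.
Let linJ := linear_exterior_map (X := X) g.
Let linQ := linear_exterior_map (X := X) h.
Let lind1 := linear_koszul_op br1 rho1X.
Let lind2 := linear_koszul_op br2 rho2X.

Let chain_exterior_map u : J (d1 u) = d2 (J u).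
Proof. exact: exterior_map_koszul_op. Qed.

Lemma linear_ad_restrict : linear ad_restrict.
Proof. by move=> c a b; rewrite /ad_restrict ling (linear_br lie2) linh. Qed.

Lemma ad_restrictE a : g (ad_restrict a) = br2 l (g a).
Proof. by rewrite [RHS]dec phibr scale0r addr0. Qed.

Lemma contract_exterior_map u : contract phi (J u) = 0.
Proof.
move: u; apply: linear_eq => [c u v|c u v|x|a u IH].
- by rewrite linJ linearP.
- by rewrite scaler0 addr0.
- by rewrite exterior_map_scalars contract_scalars.
- by rewrite exterior_map_wedge// contract_wedge// IH linear0 phig scale0r subr0.
Qed.

Lemma exterior_map_retract_wedge w : Q (wedge l w) = 0.
Proof.
rewrite exterior_map_wedge// hl.
exact: wedge0.
Qed.

(** A chain splits according to whether [l] occurs: [Q] kills [l] and keeps the part without it, and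
    contraction with [phi] strips [l] from the other part. *)
Lemma codim1_decomposition w : w = J (Q w) + wedge l (J (Q (contract phi w))).
Proof.
move: w; apply: linear_eq => [//|c u v|x|m w IH].
- by rewrite linQ linJ linearP linQ linJ linearP /=; module.
- rewrite contract_scalars !exterior_map_scalars (linear_map0 linQ) (linear_map0 linJ).
  by rewrite linear0 addr0.
- rewrite !exterior_map_wedge// contract_wedge// (linear_mapB linQ) (linear_mapZ linQ).
  rewrite exterior_map_wedge// (linear_mapB linJ) (linear_mapZ linJ) exterior_map_wedge//.
  rewrite linearB linearZ /= [wedge l (wedge (g (h m)) _)]wedgeC.
  have -> : wedge l (J (Q w)) = wedge l w by rewrite [in RHS]IH linearD /= wedge_wedge addr0.
  rewrite [in LHS](dec m) addrC wedgeP [in wedge (g _) w]IH linearD /=.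
  by module.
Qed.

Lemma codim1_injective u v : J u + wedge l (J v) = 0 -> u = 0 /\ v = 0.
Proof.
move=> uv0; split.
  have := congr1 Q uv0; rewrite (linear_mapD linQ) exterior_map_retract_wedge addr0.
  by rewrite (linear_map0 linQ) exterior_mapK.
have := congr1 (contract phi) uv0; rewrite linearD /= contract_exterior_map add0r.
rewrite contract_wedge// phil scale1r contract_exterior_map.
rewrite [wedge l 0]linear0 [contract _ 0]linear0 subr0.
by move=> /(congr1 Q); rewrite exterior_mapK// (linear_map0 linQ).
Qed.

(** The differential of the mapping cone of [Theta]; Cartan's formula for [wedge l] yields both the
    off-diagonal term and the sign of [d1 v]. *)
Lemma codim1_koszul_op u v :
  d2 (J u + wedge l (J v)) = J (d1 u + Theta v) + wedge l (J (- d1 v)).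
Proof.
rewrite (linear_mapD lind2) koszul_op_wedge// -!chain_exterior_map.
rewrite -(exterior_map_lie_derivative (D1 := ad_restrict))//.
- by rewrite [J (d1 u + _)](linear_mapD linJ) (linear_mapN linJ) linearN /= addrA.
- exact: linear_ad_restrict.
- exact: linear_br.
- exact: ad_restrictE.
Qed.

(** Exactness of the sequence of the cone: [V] maps homology over [L2] to degree [p] over [L1], and
    the cycles [W1] that it sends to boundaries are homologous to cycles over [L1] of degree
    [p.+1]. *)
Lemma codim1_homology_S p : fin_dim_homology br1 rho1 p.+1 -> fin_dim_homology br1 rho1 p ->
  fin_dim_homology br2 rho2 p.+1.
Proof.
rewrite !fin_dim_homologyE// => -[m [u [uZ uP]]] fin.
pose V w := Q (contract phi w).
have cyc w : d2 w = 0 -> d1 (Q w) + Theta (V w) = 0 /\ d1 (V w) = 0.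
  rewrite {1}(codim1_decomposition w) codim1_koszul_op => /codim1_injective[-> /eqP].
  by rewrite oppr_eq0 => /eqP.
pose W1 : set (kchain L2 X) := [set w | cycles br2 rho2 p.+1 w /\ (d1 @` kdegree p.+1) (V w)].
apply: (@fin_dim_quotient_trans _ _ _ W1 _ m (fun i => J (u i))).
- apply: (@fin_dim_quotient_sub _ _ _ V _ _ _ _ _ _ _ fin).
  + by move=> c w w'; rewrite /V linearP linQ.
  + exact: subspace_cycles.
  + exact: subspace_boundaries.
  + move=> w [Pw dw]; split; last by have [] := cyc w dw.
    by apply: exterior_map_degree; apply: contract_degree.
  + by move=> w Zw Bw.
- move=> i; have [Pu du] := uZ i; split; first exact: exterior_map_degree.
  by rewrite -chain_exterior_map du (linear_map0 linJ).
move=> w [[Pw dw] [y Py dy]].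
have linT := linear_lie_derivative ad_restrict (rho2X l).
have Pz : kdegree p.+1 (Q w + Theta y).
  apply: (subspaceD (subspace_kdegree _ _ _)); first exact: exterior_map_degree.
  exact: lie_derivative_degree.
(* As [V w = d1 y], adding this boundary cancels the component of [w] along [l]. *)
have wE : w + d2 (wedge l (J y)) = J (Q w + Theta y).
  have := codim1_koszul_op 0 y; rewrite !(linear_map0 linJ, linear_map0 lind1) !add0r => ->.
  rewrite {1}(codim1_decomposition w) -/(V w) -dy [J (Q w + _)](linear_mapD linJ) (linear_mapN linJ).
  by rewrite linearN /=; module.
have [|c [x Px dx]] := uP (Q w + Theta y).
  split=> //; have : d2 (J (Q w + Theta y)) = 0.
    by rewrite -wE (linear_mapD lind2) dw koszul_op_square// addr0.
  rewrite -chain_exterior_map => /(congr1 Q).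
  by rewrite exterior_mapK// (linear_map0 linQ).
exists c, (J x - wedge l (J y)).
  apply: (subspaceB (subspace_kdegree _ _ _)); first exact: exterior_map_degree.
  by apply: wedge_degree; apply: exterior_map_degree.
rewrite (linear_mapB lind2) -chain_exterior_map dx.
rewrite (linear_mapB linJ) -wE (linear_map_sum linJ).
under [in LHS]eq_bigr do rewrite (linear_mapZ linJ).
by set s := \sum_(_ < _) _; module.
Qed.

Lemma codim1_homology_0 : fin_dim_homology br1 rho1 0 -> fin_dim_homology br2 rho2 0.
Proof.
rewrite !fin_dim_homologyE// => fin.
apply: (@fin_dim_quotient_sub _ _ _ Q _ _ _ _ _ _ _ fin) => //.
- exact: subspace_cycles.
- exact: subspace_boundaries.
- move=> w [Pw _]; have PQ := exterior_map_degree h Pw.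
  by split=> //; apply: koszul_op_degree0.
- move=> w [Pw _] [y Py dy]; exists (J y); first exact: exterior_map_degree.
  rewrite -chain_exterior_map dy.
  rewrite [RHS]codim1_decomposition contract_degree0// (linear_map0 linQ) (linear_map0 linJ).
  by rewrite linear0 addr0.
Qed.

(** In the sequence of the cone, the kernel of the map from homology over [L1] to homology over [L2]
    is the image of [Theta], so the cokernel of [Theta] embeds into the latter. *)
Lemma codim1_coker p : fin_dim_homology br2 rho2 p ->
  fin_dim_quotient (cycles br1 rho1 p)
    ((fun x : kchain L1 X * kchain L1 X => Theta x.1 + d1 x.2) @`
       [set x | cycles br1 rho1 p x.1 /\ kdegree p.+1 x.2]).
Proof.
rewrite fin_dim_homologyE// => fin.
apply: (@fin_dim_quotient_sub _ _ _ J _ _ _ _ _ _ _ fin) => //.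
- exact: subspace_cycles.
- exact: subspace_boundaries.
- move=> z [Pz dz]; split; first exact: exterior_map_degree.
  by rewrite -chain_exterior_map dz (linear_map0 linJ).
move=> z [Pz dz] [w Pw dw].
have /codim1_injective[] : J (d1 (Q w) + Theta (Q (contract phi w)) - z) +
    wedge l (J (- d1 (Q (contract phi w)))) = 0.
  by rewrite (linear_mapB linJ) addrAC -codim1_koszul_op -codim1_decomposition dw subrr.
move=> /eqP; rewrite subr_eq0 addrC => /eqP zE /eqP; rewrite oppr_eq0 => /eqP dv.
exists (Q (contract phi w), Q w) => //=; split; last exact: exterior_map_degree.
by split=> //; apply: exterior_map_degree; apply: contract_degree.
Qed.

End CodimensionOne.

(** * Perturbation of characters *)

Section BoundedMapsCalculus.
Variable R : realType.
Local Notation C := R[i].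
Variables (V1 V2 : lmodType C) (N1 : V1 -> R) (N2 : V2 -> R).
Hypotheses (n1 : is_norm N1) (n2 : is_norm N2).

Lemma bounded_map_comp (V3 : lmodType C) (N3 : V3 -> R) (S : V2 -> V3) (T : V1 -> V2) :
  bounded_map N2 N3 S -> bounded_map N1 N2 T -> bounded_map N1 N3 (fun u => S (T u)).
Proof.
move=> [linS [M M0 SM]] [linT [M' M'0 TM]]; split; first by move=> c u v; rewrite linT linS.
exists (M * M'); first by rewrite mulr_ge0.
by move=> u; apply: (le_trans (SM _)); rewrite -mulrA ler_wpM2l.
Qed.

Lemma bounded_mapD (S T : V1 -> V2) : bounded_map N1 N2 S -> bounded_map N1 N2 T ->
  bounded_map N1 N2 (fun u => S u + T u).
Proof.
move=> [linS [M M0 SM]] [linT [M' M'0 TM]]; split.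
  by move=> c u v; rewrite linS linT; module.
exists (M + M'); first by rewrite addr_ge0.
by move=> u; apply: (le_trans (normD n2 _ _)); rewrite mulrDl lerD.
Qed.

Lemma bounded_mapZ c (T : V1 -> V2) : bounded_map N1 N2 T ->
  bounded_map N1 N2 (fun u => c *: T u).
Proof.
move=> [linT [M M0 TM]]; split; first by move=> a u v; rewrite linT; module.
exists (rnorm c * M); first by rewrite mulr_ge0 ?rnorm_ge0.
by move=> u; rewrite (normZ n2) -mulrA ler_wpM2l ?rnorm_ge0.
Qed.

Lemma bounded_map_sum (I : finType) (T : I -> V1 -> V2) :
  (forall i, bounded_map N1 N2 (T i)) -> bounded_map N1 N2 (fun u => \sum_i T i u).
Proof.
move=> bT; split.
  move=> c u v; rewrite scaler_sumr -big_split; apply: eq_bigr => i _.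
  by rewrite (bT i).1.
have /choice[M MP] : forall i, exists M, 0 <= M /\ forall u, N2 (T i u) <= M * N1 u.
  by move=> i; have [_ [M M0 MP]] := bT i; exists M.
exists (\sum_i M i); first by apply: sumr_ge0 => i _; have [] := MP i.
move=> u; apply: (le_trans (norm_sum n2 _ _ _)); rewrite mulr_suml.
by apply: ler_sum => i _; have [_] := MP i; apply.
Qed.

Lemma banach_kernel (P : set V1) (T : V1 -> V2) : is_banach N1 P -> bounded_map N1 N2 T ->
  is_banach N1 [set u | P u /\ T u = 0].
Proof.
move=> [_ sP cP] [linT [M M0 TM]]; split=> //.
  split=> [|c u v [Pu Tu] [Pv Tv]]; first by split; [exact: subspace0 | exact: linear_map0].
  by split; [exact: sP.2 | rewrite linT Tu Tv scaler0 addr0].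
move=> u K Pu uK; have [l Pl lim] := cP u K (fun n => (Pu n).1) uK.
exists l => //; split=> //; apply/(norm_le0 n2)/ler_addgt0Pr => eps e0.
have M1 : 0 < M + 1 by rewrite ltr_wpDl.
have [|n0 h] := lim (eps / (M + 1)); first by rewrite divr_gt0.
have -> : T l = T (l - u n0) by rewrite (linear_mapB linT) (Pu n0).2 subr0.
rewrite add0r; apply: (le_trans (TM _)); rewrite (norm_distC n1).
have := h n0 (leqnn n0); rewrite ler_pdivlMr// => h'.
by have := norm_ge0 n1 (u n0 - l); lra.
Qed.

End BoundedMapsCalculus.

Section ChainNorm.
Variable R : realType.
Local Notation C := R[i].
Variables (L : vectType C) (X : completeNormedModType C).
Local Notation n := (\dim {:L}).
Local Notation kchain := (kchain L X).
Implicit Types (u v : kchain) (S : {set 'I_n}) (i : 'I_n) (p : nat).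

Definition chain_norm u : R := \sum_S rnorm (u S).
Local Notation bounded := (bounded_map chain_norm chain_norm).

Lemma chain_norm_is_norm : is_norm chain_norm.
Proof.
split=> [u v|c u|u].
- rewrite /chain_norm -big_split /=; apply: ler_sum => S _.
  by rewrite ffunE ler_rnormD.
- by rewrite /chain_norm mulr_sumr; apply: eq_bigr => S _; rewrite ffunE rnormZ.
- move=> /eqP; rewrite psumr_eq0 => [/allP u0|S _]; last exact: rnorm_ge0.
  apply/ffunP => S; rewrite ffunE; apply/rnorm_eq0/eqP/u0.
  by rewrite mem_index_enum.
Qed.

Lemma rnorm_le_chain_norm u S : rnorm (u S) <= chain_norm u.
Proof.
by rewrite /chain_norm (bigD1 S)//= lerDl; apply: sumr_ge0 => T _; apply: rnorm_ge0.
Qed.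

Lemma banach_kdegree p : is_banach chain_norm (kdegree p : set kchain).
Proof.
split; [exact: chain_norm_is_norm | exact: subspace_kdegree|].
move=> u K Pu uK.
have uS m S : rnorm (u m.+1 S - u m S) <= K * 2^-1 ^+ m.
  by apply: le_trans (uK m); have := rnorm_le_chain_norm (u m.+1 - u m) S; rewrite !ffunE.
have /choice[l lP] : forall S, exists l, (#|S| <> p -> l = 0) /\ forall eps, 0 < eps ->
    exists n0, forall m, (n0 <= m)%N -> rnorm (u m S - l) <= eps.
  move=> S; have [cS|cS] := pselect (#|S| = p); last first.
    exists 0; split=> // eps e0; exists 0%N => m _.
    by rewrite Pu// subr0 rnorm0 ltW.
  have [l _ h] := banach_complete (banach_rnorm X) (fun m => Logic.I) (u := fun m => u m S) (uS ^~ S).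
  by exists l.
exists [ffun S => l S]; first by move=> S cS; rewrite ffunE; have [->] := lP S.
move=> eps e0; set c : R := #|{set 'I_n}|.+1%:R; have c0 : 0 < c by rewrite ltr0n.
have /choice[n0 n0P] : forall S, exists n0, forall m, (n0 <= m)%N ->
    rnorm (u m S - l S) <= eps / c.
  by move=> S; apply: (lP S).2; rewrite divr_gt0.
exists (\max_S n0 S)%N => m lem.
apply: (@le_trans _ _ (\sum_(S : {set 'I_n}) eps / c)).
  apply: ler_sum => S _; rewrite !ffunE; apply: n0P; apply: leq_trans lem.
  exact: leq_bigmax.
rewrite sumr_const -[X in X <= _]mulr_natr mulrAC ler_pdivrMr// ler_wpM2l ?ltW//.
by rewrite ltr_nat.
Qed.

Lemma bounded_entries (T : kchain -> kchain) K : linear T -> 0 <= K ->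
  (forall u S, rnorm (T u S) <= K * chain_norm u) -> bounded T.
Proof.
move=> linT K0 TK; split=> //; exists (#|{set 'I_n}|%:R * K).
  by rewrite mulr_ge0.
move=> u; apply: (@le_trans _ _ (\sum_(S : {set 'I_n}) K * chain_norm u)).
  exact: ler_sum.
by rewrite sumr_const -[X in X <= _]mulr_natl mulrA.
Qed.

Let chain0 u : 0 <= chain_norm u. Proof. exact: norm_ge0 chain_norm_is_norm u. Qed.

Lemma rnorm_sign_at i S : rnorm (sign_at i S : C) = 1.
Proof. by rewrite /sign_at rnormX rnormN rnorm1 expr1n. Qed.

Lemma bounded_create i : bounded (create i).
Proof.
apply: (bounded_entries (K := 1)) => // [|u S]; first exact: linear_create.
rewrite ffunE mul1r; case: ifP => _; last by rewrite rnorm0.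
by rewrite rnormZ rnorm_sign_at mul1r rnorm_le_chain_norm.
Qed.

Lemma bounded_annihilate i : bounded (annihilate i).
Proof.
apply: (bounded_entries (K := 1)) => // [|u S]; first exact: linear_annihilate.
rewrite ffunE mul1r; case: ifP => _; first by rewrite rnorm0.
by rewrite rnormZ rnorm_sign_at mul1r rnorm_le_chain_norm.
Qed.

Let nC := chain_norm_is_norm.

Lemma bounded_wedge (l : L) : bounded (wedge l).
Proof.
apply: (bounded_map_sum nC) => i; apply: (bounded_mapZ nC); exact: bounded_create.
Qed.

Lemma bounded_derive_wedge (D : L -> L) : bounded (derive_wedge D).
Proof.
apply: (bounded_map_sum nC) => i; apply: bounded_map_comp; last exact: bounded_annihilate.
exact: bounded_wedge.
Qed.

Definition bounded_operator (T : X -> X) : Prop := bounded_map (@rnorm R X) (@rnorm R X) T.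

Lemma bounded_on_coef (T : X -> X) : bounded_operator T -> bounded (on_coef T).
Proof.
move=> [linT [M M0 TM]]; apply: (bounded_entries (K := M)) => //.
  exact: linear_on_coef.
move=> u S; rewrite ffunE; apply: (le_trans (TM _)).
by apply: ler_wpM2l => //; apply: rnorm_le_chain_norm.
Qed.

Lemma bounded_lie_derivative (T : X -> X) (D : L -> L) : bounded_operator T ->
  bounded (lie_derivative T D).
Proof.
move=> bT; apply: (bounded_mapD nC); first exact: bounded_on_coef.
exact: bounded_derive_wedge.
Qed.

Lemma bounded_koszul_op br (rho : L -> X -> X) : (forall l, bounded_operator (rho l)) ->
  bounded (koszul_op br rho).
Proof.
move=> brho; apply: (bounded_map_sum nC) => i; apply: (bounded_mapD nC).
  apply: bounded_map_comp; last exact: bounded_annihilate.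
  exact: bounded_on_coef.
apply: (bounded_mapZ nC); apply: bounded_map_comp; last exact: bounded_annihilate.
exact: bounded_derive_wedge.
Qed.

(** The constant is uniform in [f]: the differentials of two characters differ by a contraction,
    which is therefore small when the characters are close. *)
Lemma contract_le : exists2 M, 0 <= M & forall (f : L -> C) u e, 0 <= e ->
  (forall i : 'I_n, rnorm (f (vbasis {:L})`_i) <= e) ->
  chain_norm (contract f u) <= M * e * chain_norm u.
Proof.
have /choice[M MP] : forall i : 'I_n, exists M, 0 <= M /\
    forall u, chain_norm (annihilate i u) <= M * chain_norm u.
  by move=> i; have [_ [M M0 MP]] := bounded_annihilate i; exists M.
exists (\sum_i M i); first by apply: sumr_ge0 => i _; have [] := MP i.
move=> f u e e0 fe; apply: (le_trans (norm_sum nC _ _ _)); rewrite !mulr_suml.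
apply: ler_sum => i _; rewrite (normZ nC) [M i * e]mulrC -mulrA.
have [_ /(_ u) h] := MP i; apply: ler_pM => //; exact: rnorm_ge0.
Qed.

End ChainNorm.

Section Shift.
Variable R : realType.
Local Notation C := R[i].
Variables (L : vectType C) (X : completeNormedModType C).
Variables (br : L -> L -> L) (rho : L -> X -> X).
Local Notation n := (\dim {:L}).
Local Notation e := (vbasis {:L}).

(** [rep_shift] for plain functions, so that characters can be given by formulas before they become
    elements of the dual. *)
Definition shift (f : L -> C) (l : L) (x : X) : X := rho l x - f l *: x.

Record bounded_module : Prop := BoundedModule {
  bounded_module_module : lie_module br rho;
  bounded_module_bounded : forall l, bounded_operator (rho l) }.

Hypothesis bmod : bounded_module.
Let mod := bounded_module_module bmod.
Let lie := module_lie mod.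
Let rhoX := module_linear mod.

Lemma shift_bounded f l : bounded_operator (shift f l).
Proof.
have nX := rnorm_is_norm X.
have [linr [M M0 rM]] := bounded_module_bounded bmod l; split.
  by move=> c x y; rewrite /shift linr; module.
exists (M + rnorm (f l)); first by rewrite addr_ge0 ?rnorm_ge0.
move=> x; apply: (le_trans (normB nX _ _)); rewrite rnormZ mulrDl lerD2r.
exact: rM.
Qed.

Lemma koszul_op_shift f (u : kchain L X) :
  koszul_op br (shift f) u = koszul_op br rho u - contract f u.
Proof.
rewrite /koszul_op /contract -sumrB; apply: eq_bigr => i _.
have -> : on_coef (shift f e`_i) (annihilate i u) =
    on_coef (rho e`_i) (annihilate i u) - f e`_i *: annihilate i u.
  by apply/ffunP => S; rewrite !ffunE.
by rewrite addrAC.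
Qed.

Lemma lie_derivative_shift (L' : vectType C) f l (D : L' -> L') (u : kchain L' X) :
  lie_derivative (shift f l) D u = lie_derivative (rho l) D u - f l *: u.
Proof.
rewrite /lie_derivative addrAC; congr (_ + _).
by apply/ffunP => S; rewrite !ffunE.
Qed.

Section Character.
Variable f : L -> C.
Hypotheses (linf : scalar f) (charf : forall a b, f (br a b) = 0).

Lemma shift_module : lie_module br (shift f).
Proof.
split=> //.
- by move=> l; have [] := shift_bounded f l.
- by move=> c a b x; rewrite /shift (module_linearl mod) linf; module.
- move=> a b x; rewrite /shift charf scale0r subr0 (module_bracket mod).
  rewrite (linear_mapB (rhoX a)) (linear_mapB (rhoX b)).
  rewrite (linear_mapZ (rhoX a)) (linear_mapZ (rhoX b)).
  set x1 := rho a (rho b x); set x2 := rho b (rho a x); set y := rho a x; set z := rho b x.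
  by module.
Qed.

Lemma banach_cycles p : is_banach (@chain_norm R L X) (cycles br (shift f) p).
Proof.
apply: banach_kernel; [exact: chain_norm_is_norm | exact: chain_norm_is_norm | exact: banach_kdegree|].
by apply: bounded_koszul_op => l; apply: shift_bounded.
Qed.

End Character.
End Shift.

Section Perturbation.
Variable R : realType.
Local Notation C := R[i].
Variables (L : vectType C) (X : completeNormedModType C).
Variables (br : L -> L -> L) (rho : L -> X -> X).
Hypothesis bmod : bounded_module br rho.
Local Notation n := (\dim {:L}).
Local Notation e := (vbasis {:L}).
Local Notation kchain := (kchain L X).
Local Notation N := (@chain_norm R L X).
Local Notation d f := (koszul_op br (shift rho f)).
Local Notation finite_homology f := (fin_dim_homology br (shift rho f)).
Let mod := bounded_module_module bmod.
Let nC := @chain_norm_is_norm R L X.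

Definition lie_character (f : L -> C) : Prop :=
  scalar f /\ forall a b, f (br a b) = 0.

Let bd f : bounded_map N N (d f).
Proof. by apply: bounded_koszul_op => l; apply: (shift_bounded bmod). Qed.

Lemma finite_homology_net f p K l : lie_character f ->
  has_net N N (kdegree p.+1) (cycles br (shift rho f) p) (d f) K l 4^-1 ->
  finite_homology f p.
Proof.
move=> [linf charf] net; have modf := shift_module bmod linf charf.
rewrite fin_dim_homologyE//; apply: net_fin_codim net => //.
- exact: banach_kdegree.
- exact: banach_cycles.
- by move=> y; apply: boundary_cycle.
Qed.

(* Cartan's formula makes [- f(l)^-1 l /\ _] an approximate contracting homotopy
   when f(l) is large. *)
Lemma far_character_homotopy l : exists B K, [/\ 0 <= B, 0 <= K &
  forall f, scalar f -> B <= rnorm (f l) -> forall p (z : kchain), kdegree p z ->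
  exists y, [/\ kdegree p.+1 y, N y <= K * N z &
    N (z - d f y) <= N z / 8 + K * N (d f z)]].
Proof.
have [_ [M M0 MP]] := bounded_lie_derivative (br l) (bounded_module_bounded bmod l).
have [_ [W W0 WP]] := bounded_wedge X l.
(* [M] bounds the Lie derivative along [l] and [W] the multiplication by [l]: after division by
   [f l] the first is at most 1/8 and the second at most [W]. The term in [d f z] is kept because
   the homotopy will also be applied to approximate cycles. *)
exists (8 * M + 1), W; split=> //; first by rewrite addr_ge0// mulr_ge0.
move=> f linf large p z Pz; set c := f l in large *.
have c1 : 1 <= rnorm c by apply: le_trans large; rewrite lerDr mulr_ge0.
have cp : 0 < rnorm c by apply: lt_le_trans c1.
have c0 : c != 0 by apply/eqP => c0; rewrite c0 rnorm0 ltxx in cp.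
have cV1 : (rnorm c)^-1 <= 1 by rewrite invf_le1.
have cV0 : 0 <= (rnorm c)^-1 by rewrite invr_ge0 ltW.
have shX m : linear (shift rho f m) by have [] := shift_bounded bmod f m.
have lind := linear_koszul_op br shX.
exists (- c^-1 *: wedge l z); split.
- by apply: (subspaceZ (subspace_kdegree _ _ _)); apply: wedge_degree.
- rewrite (normZ nC) rnormN rnormV; apply: (le_trans (ler_wpM2l cV0 (WP z))).
  by rewrite ler_piMl// mulr_ge0// norm_ge0.
- have -> : z - d f (- c^-1 *: wedge l z) =
      c^-1 *: (lie_derivative (rho l) (br l) z - wedge l (d f z)).
    rewrite (linear_mapZ lind) koszul_op_wedge//; last 2 first.
    + exact: module_lie mod.
    + by move=> a b b' x; rewrite /shift (module_linearl mod) linf; module.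
    rewrite lie_derivative_shift -/c; set t := lie_derivative _ _ _; set w := wedge _ _.
    rewrite -[X in X - _ = _](scalerK c0); set ci := c^-1; by module.
  rewrite (normZ nC) rnormV.
  have := normB nC (lie_derivative (rho l) (br l) z) (wedge l (d f z)).
  have := MP z; have := WP (d f z); set a := N (lie_derivative _ _ _); set b := N (wedge _ _).
  move=> b1 a1 ab; apply: (le_trans (ler_wpM2l cV0 ab)); rewrite mulrDr; apply: lerD.
    rewrite mulrC ler_pdivrMr//; apply: (le_trans a1).
    have := norm_ge0 nC z; nra.
  apply: le_trans b1; rewrite ler_piMl//; exact: norm_ge0.
Qed.

Lemma far_character_finite l : exists B, forall f, lie_character f ->
  B <= rnorm (f l) -> forall p, finite_homology f p.
Proof.
have [B [K [B0 K0 h]]] := far_character_homotopy l; exists B => f charf large p.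
apply: (@finite_homology_net f p K [:: 0]) => // z [Pz dz] z1.
have [y [Py yK hy]] := h f charf.1 large p z Pz.
exists y, 0; rewrite inE eqxx subr0; split=> //.
  by apply: (le_trans yK); rewrite ler_piMr.
by apply: (le_trans hy); rewrite dz norm0// mulr0; lra.
Qed.

(** In positive degree the boundaries have finite codimension in the cycles one degree lower, which
    gives bounded preimages ([fin_codim_lift]); in degree 0 the differential vanishes. *)
Lemma d_lift f p : lie_character f -> (forall q, p = q.+1 -> finite_homology f q) ->
  exists2 K, 0 <= K & forall z, kdegree p z ->
    exists z', [/\ kdegree p z', d f z' = d f z & N z' <= K * N (d f z)].
Proof.
move=> [linf charf]; have modf := shift_module bmod linf charf.
have shX := module_linear modf.
case: p => [_|q /(_ q erefl)].
  exists 0 => // z Pz; exists 0; rewrite norm0// mul0r (linear_map0 (linear_koszul_op _ shX)).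
  by rewrite koszul_op_degree0//; split=> //; apply: subspace0 (subspace_kdegree _ _ _).
rewrite fin_dim_homologyE// => fin; apply: fin_codim_lift fin => //.
- exact: banach_kdegree.
- exact: banach_cycles.
- by move=> y; apply: boundary_cycle.
Qed.

(** A cycle [z] for [f] has small [d f0 z]. Finiteness one degree lower provides a small [z'] with
    the same image, so [z - z'] is a cycle for [f0], to which the net for [f0] applies. *)
Lemma finite_homology_stable f0 p : lie_character f0 -> finite_homology f0 p ->
  (forall q, p = q.+1 -> finite_homology f0 q) ->
  exists2 delta, 0 < delta & forall f, lie_character f ->
    (forall i : 'I_n, rnorm (f e`_i - f0 e`_i) <= delta) -> finite_homology f p.
Proof.
move=> char0 fin finq; have [K' K'0 lift] := d_lift char0 finq.
have [lin0 charf0] := char0; have mod0 := shift_module bmod lin0 charf0.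
have sh0 := module_linear mod0; have lind0 := linear_koszul_op br sh0.
rewrite fin_dim_homologyE// in fin.
have bound0 y : kdegree p.+1 y -> cycles br (shift rho f0) p (d f0 y).
  exact: boundary_cycle.
have [K K0 net] := fin_codim_net (banach_kdegree L X p.+1)
  (banach_cycles bmod f0 p) (bd f0) bound0 fin.
have e16 : 0 < 16^-1 :> R by rewrite invr_gt0.
have [l lP] := net _ e16.
have [M M0 MP] := @contract_le R L X.
(* The error is [2 / 16] from the net, [K' eps] from [z'] and [2 K eps] from replacing [d f0] by
   [d f]; this choice keeps the last two at 1/8 together. Doubling comes from halving [z - z'] to
   return to the unit ball. *)
pose c := M * (8 * (K' + 2 * K) + 1) + 1.
have c0 : 0 < c by rewrite ltr_wpDl// mulr_ge0// addr_ge0// mulr_ge0// addr_ge0// mulr_ge0.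
exists c^-1; first by rewrite invr_gt0.
move=> f charf near; have [linf charf'] := charf.
have modf := shift_module bmod linf charf'; have shf := module_linear modf.
have lind := linear_koszul_op br shf.
pose eps := M * c^-1; have eps0 : 0 <= eps by rewrite mulr_ge0// invr_ge0 ltW.
have epsP : eps * (8 * (K' + 2 * K) + 1) <= 1.
  by rewrite /eps mulrAC ler_pdivrMr// mul1r /c lerDl.
have diff u : N (d f u - d f0 u) <= eps * N u.
  rewrite !koszul_op_shift//.
  have -> : koszul_op br rho u - contract f u - (koszul_op br rho u - contract f0 u) =
      - contract (fun a => f a - f0 a) u.
    have -> : contract (fun a => f a - f0 a) u = contract f u - contract f0 u.
      by rewrite /contract -sumrB; apply: eq_bigr => i _; rewrite scalerBl.
    by module.
  rewrite norm_opp//; apply: MP => //; by rewrite invr_ge0 ltW.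
apply: (@finite_homology_net f p (2 * K) [seq 2%:R *: w | w <- l]) => // z [Pz dz] z1.
have d0z : N (d f0 z) <= eps.
  have := diff z; rewrite dz sub0r norm_opp// => /le_trans; apply.
  by rewrite ler_piMr.
have [z' [Pz' dz' z'K]] := lift z Pz.
have z'e : N z' <= K' * eps by apply: (le_trans z'K); apply: ler_wpM2l.
have Kp : 0 <= K' * eps by rewrite mulr_ge0.
have Kp2 : 0 <= K * eps by rewrite mulr_ge0.
have cyc : cycles br (shift rho f0) p (2^-1 *: (z - z')).
  split; last by rewrite (linear_mapZ lind0) (linear_mapB lind0) dz' subrr scaler0.
  apply: (subspaceZ (subspace_kdegree _ _ _)).
  exact: (subspaceB (subspace_kdegree _ _ _)).
have half : rnorm (2^-1 : C) = 2^-1 by rewrite rnormV rnorm_nat.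
have le1 : N (2^-1 *: (z - z')) <= 1.
  by rewrite (normZ nC) half; have := normB nC z z'; lra.
have [y [w [Py yK lw hw]]] := lP _ cyc le1.
exists (2%:R *: y), (2%:R *: w); split.
- exact: (subspaceZ (subspace_kdegree _ _ _)).
- by rewrite (normZ nC) rnorm_nat; lra.
- by apply/mapP; exists w.
- have -> : z - d f (2%:R *: y) - 2%:R *: w = 2%:R *: (2^-1 *: (z - z') - d f0 y - w) +
      (z' - (2%:R *: (d f y - d f0 y))).
    rewrite (linear_mapZ lind) -[in LHS](subrK z' z).
    have -> : z - z' = 2%:R *: (2^-1 *: (z - z')).
      by rewrite scalerA divff ?scale1r// pnatr_eq0.
    by rewrite [in RHS]scalerA [2^-1 * _]mulrC divff ?pnatr_eq0// scale1r; module.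
  have := normD nC (2%:R *: (2^-1 *: (z - z') - d f0 y - w)) (z' - (2%:R *: (d f y - d f0 y))).
  have := normB nC z' (2%:R *: (d f y - d f0 y)).
  rewrite !(normZ nC _ (_ - _ - _)) !(normZ nC _ (d f y - d f0 y)) !rnorm_nat.
  have := diff y; have : eps * N y <= K * eps by rewrite mulrC ler_wpM2r.
  move: epsP; rewrite mulrDr mulr1; lra.
Qed.

End Perturbation.

(** * Invariance of the spectra under derivations *)

Section PartialExponential.

Lemma triangle_sum (V : nmodType) (a : nat -> nat -> V) N :
  \sum_(n < N) \sum_(k < n.+1) a (n - k)%N k = \sum_(k < N) \sum_(i < N - k) a i k.
Proof.
elim: N => [|N IH]; first by rewrite !big_ord0.
rewrite big_ord_recr [RHS]big_ord_recr /= IH subSnn big_ord1.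
rewrite [X in _ = X + _](eq_bigr (fun k : 'I_N => \sum_(i < N - k) a i k + a (N - k)%N k)); last first.
  by move=> k _; rewrite subSn ?(ltnW (ltn_ord k))// big_ord_recr.
by rewrite big_split /= -addrA; congr (_ + _); rewrite big_ord_recr /= subnn.
Qed.

Lemma square_minus_triangle (V : zmodType) (a : nat -> nat -> V) N :
  \sum_(k < N) \sum_(i < N) a i k - \sum_(n < N) \sum_(k < n.+1) a (n - k)%N k =
  \sum_(k < N) \sum_(N - k <= i < N) a i k.
Proof.
rewrite triangle_sum -sumrB; apply: eq_bigr => k _.
rewrite -(big_mkord xpredT (fun i => a i k)) -(big_mkord xpredT (fun i => a i k)).
by rewrite [X in X - _](@big_cat_nat _ _ _ (N - k)%N 0%N N)//= ?leq_subr// addrAC subrr add0r.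
Qed.

Lemma pascal_sum (K : pzRingType) (V : lmodType K) (x : nat -> V) n :
  \sum_(k < n.+1) 'C(n, k)%:R *: x k + \sum_(k < n.+1) 'C(n, k)%:R *: x k.+1 =
  \sum_(k < n.+2) 'C(n.+1, k)%:R *: x k.
Proof.
rewrite [RHS]big_ord_recl [X in X + _]big_ord_recl /= !bin0 -addrA; congr (_ + _).
rewrite [RHS](eq_bigr (fun k : 'I_n.+1 =>
    'C(n, k.+1)%:R *: x k.+1 + 'C(n, k)%:R *: x k.+1)); last first.
  by move=> k _; rewrite /bump /= add1n binS natrD scalerDl.
rewrite big_split /=; congr (_ + _); rewrite [RHS]big_ord_recr /= bin_small// scale0r addr0.
by apply: eq_bigr => k _; rewrite /bump /= add1n.
Qed.

Variable R : realType.
Local Notation C := R[i].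

Definition partial_exp N (x : R) : R := \sum_(i < N) x ^+ i / i`!%:R.

Lemma partial_exp_cvg x : partial_exp N x @[N --> \oo] --> expR x.
Proof.
have -> : (fun N => partial_exp N x) = series (exp_coeff x).
  by apply: funext => N; rewrite /partial_exp /series /= big_mkord.
exact: is_cvg_series_exp_coeff.
Qed.

Lemma partial_exp_le N x : 0 <= x -> partial_exp N x <= expR x.
Proof.
move=> x0; have -> : partial_exp N x = series (exp_coeff x) N.
  by rewrite /partial_exp /series /= big_mkord.
apply: nondecreasing_cvgn_le; last exact: is_cvg_series_exp_coeff.
apply/nondecreasing_seqP => n; rewrite /series /= big_nat_recr//= lerDl.
by rewrite divr_ge0// exprn_ge0.
Qed.

(** The truncation error in [exp x * exp y = exp (x + y)]: the terms with [i, k < N <= i + k]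
    ([exp_defectE]). It majorizes the errors of all products of truncated operator exponentials
    below. *)
Definition exp_defect N (x y : R) : R :=
  partial_exp N x * partial_exp N y - partial_exp N (x + y).

Lemma exp_defect_small x y eta : 0 < eta ->
  exists N0, forall N, (N0 <= N)%N -> exp_defect N x y <= eta.
Proof.
move=> eta0; have : exp_defect N x y @[N --> \oo] --> expR x * expR y - expR (x + y).
  by apply: cvgB; [apply: cvgM; exact: partial_exp_cvg | exact: partial_exp_cvg].
rewrite expRD subrr => /cvgrPdist_le /(_ _ eta0)[N0 _ h]; exists N0 => N /h /=.
by rewrite sub0r normrN; apply: le_trans; rewrite ler_norm.
Qed.

Let fact_neq0 (F : numFieldType) n : n`!%:R != 0 :> F.
Proof. by rewrite pnatr_eq0 -lt0n fact_gt0. Qed.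

Let bin_coef (F : numFieldType) n k : (k <= n)%N ->
  (n`!%:R : F)^-1 * 'C(n, k)%:R = (n - k)`!%:R^-1 * k`!%:R^-1.
Proof.
move=> kn; apply: (mulfI (fact_neq0 F n)); rewrite mulrA divff// mul1r.
rewrite -(bin_fact kn) !natrM; field.
by rewrite !fact_neq0.
Qed.

Lemma exp_defectE N x y : exp_defect N x y =
  \sum_(k < N) \sum_(N - k <= i < N) (x ^+ i / i`!%:R) * (y ^+ k / k`!%:R).
Proof.
rewrite -(square_minus_triangle (fun i k => (x ^+ i / i`!%:R) * (y ^+ k / k`!%:R))).
congr (_ - _).
  by rewrite mulrC /partial_exp mulr_suml; apply: eq_bigr => k _; rewrite mulrC mulr_suml.
apply: eq_bigr => n _; rewrite exprDn mulr_suml; apply: eq_bigr => k _.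
have kn : (k <= n)%N by rewrite -ltnS.
rewrite -mulr_natr -!mulrA; congr (_ * _).
rewrite [RHS]mulrCA; congr (_ * _); rewrite mulrC bin_coef//.
Qed.

Lemma square_minus_triangle_le (V : lmodType C) (N : V -> R) (nN : is_norm N)
    (a : nat -> nat -> V) B x y m :
  (forall i k, N (a i k) <= B * (x ^+ i / i`!%:R) * (y ^+ k / k`!%:R)) ->
  N (\sum_(k < m) \sum_(i < m) a i k - \sum_(n < m) \sum_(k < n.+1) a (n - k)%N k) <=
  B * exp_defect m x y.
Proof.
move=> ha; rewrite square_minus_triangle exp_defectE mulr_sumr.
apply: (le_trans (norm_sum nN _ _ _)); apply: ler_sum => k _.
apply: (le_trans (norm_sum nN _ _ _)); rewrite mulr_sumr; apply: ler_sum => i _.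
by have := ha i k; rewrite -mulrA.
Qed.

Section Operators.
Variables (V : lmodType C) (N : V -> R).
Hypothesis nN : is_norm N.

Definition operator_exp (T : V -> V) m (u : V) : V :=
  \sum_(i < m) (i`!%:R : C)^-1 *: iter i T u.

Lemma linear_iter (T : V -> V) i : linear T -> linear (iter i T).
Proof. by move=> linT; elim: i => [|i IH] c u v //=; rewrite IH linT. Qed.

Lemma norm_iter (T : V -> V) M i u : 0 <= M -> (forall u, N (T u) <= M * N u) ->
  N (iter i T u) <= M ^+ i * N u.
Proof.
move=> M0 TM; elim: i => [|i IH]; first by rewrite expr0 mul1r.
rewrite iterS exprS -mulrA; apply: (le_trans (TM _)); exact: ler_wpM2l.
Qed.

Lemma linear_operator_exp T m : linear T -> linear (operator_exp T m).
Proof.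
move=> linT c u v; rewrite /operator_exp scaler_sumr -big_split; apply: eq_bigr => i _ /=.
by rewrite (linear_iter i linT) scalerDr !scalerA mulrC.
Qed.

Lemma rnorm_fact i : rnorm ((i`!%:R : C)^-1) = i`!%:R^-1.
Proof. by rewrite rnormV rnorm_nat. Qed.

Lemma operator_exp_le T M m u : 0 <= M -> (forall u, N (T u) <= M * N u) ->
  N (operator_exp T m u) <= expR M * N u.
Proof.
move=> M0 TM; have h : N (operator_exp T m u) <= partial_exp m M * N u.
  apply: (le_trans (norm_sum nN _ _ _)); rewrite mulr_suml; apply: ler_sum => i _.
  rewrite (normZ nN) rnorm_fact -mulrAC mulrC; apply: ler_wpM2r.
    by rewrite invr_ge0.
  exact: norm_iter.
apply: (le_trans h); apply: ler_wpM2r; [exact: norm_ge0 | exact: partial_exp_le].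
Qed.

Lemma operator_exp_inverse T M m u : linear T -> 0 <= M -> (forall u, N (T u) <= M * N u) ->
  (0 < m)%N -> N (operator_exp T m (operator_exp (fun u => - T u) m u) - u) <=
    exp_defect m M M * N u.
Proof.
move=> linT M0 TM m0; set T' := fun u => - T u.
have iterT' k v : iter k T' v = (-1) ^+ k *: iter k T v.
  elim: k => [|k IH]; first by rewrite expr0 scale1r.
  by rewrite !iterS IH /T' (linear_mapZ linT) exprS mulN1r scaleNr.
pose a i k := (i`!%:R : C)^-1 *: ((k`!%:R : C)^-1 *: iter i T (iter k T' u)).
have -> : operator_exp T m (operator_exp T' m u) = \sum_(k < m) \sum_(i < m) a i k.
  rewrite exchange_big; apply: eq_bigr => i _ /=.
  rewrite /operator_exp (linear_map_sum (linear_iter i linT)) scaler_sumr.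
  by apply: eq_bigr => k _; rewrite (linear_mapZ (linear_iter i linT)).
(* The terms of total degree [n] add up to [(1 - 1)^n / n!] times the [n]-th iterate of [T], so only
   [n = 0] remains, which is why [m] must be positive. *)
have uE : u = \sum_(n < m) \sum_(k < n.+1) a (n - k)%N k.
  rewrite (eq_bigr (fun n : 'I_m => ((n`!%:R : C)^-1 * (1 - 1) ^+ n) *: iter n T u)).
    case: m m0 {a} => // m _; rewrite big_ord_recl /= expr0 invr1 mulr1 scale1r.
    by rewrite big1 ?addr0// => i _; rewrite /bump /= add1n subrr expr0n mulr0 scale0r.
  move=> n _; rewrite exprDn mulr_sumr scaler_suml; apply: eq_bigr => k _.
  have kn : (k <= n)%N by rewrite -ltnS.
  rewrite /a iterT' (linear_mapZ (linear_iter _ linT)) -iterD subnK// !scalerA.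
  rewrite expr1n mul1r -[_ *+ 'C(n, k)]mulr_natr; congr (_ *: _).
  by rewrite [RHS]mulrCA bin_coef// [RHS]mulrC.
rewrite [X in N (_ - X)]uE mulrC; apply: square_minus_triangle_le => // i k.
rewrite /a !(normZ nN) !rnorm_fact.
have h : N (iter i T (iter k T' u)) <= M ^+ i * (M ^+ k * N u).
  apply: (le_trans (norm_iter _ _ M0 TM)); apply: ler_wpM2l; first exact: exprn_ge0.
  by apply: norm_iter => // v; rewrite /T' norm_opp.
have c0 : 0 <= (i`!%:R : R)^-1 * (k`!%:R)^-1 by rewrite mulr_ge0// invr_ge0.
rewrite mulrA; apply: (le_trans (ler_wpM2l c0 h)).
by rewrite le_eqVlt; apply/orP; left; apply/eqP; ring.
Qed.

Section Intertwining.
Variables (T : V -> V) (D : nat -> V -> V) (M M0 : R).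
Hypotheses (linT : linear T) (M_ge0 : 0 <= M) (TM : forall u, N (T u) <= M * N u).
Hypotheses (linD : linear (D 0%N)) (M0_ge0 : 0 <= M0)
  (D0M : forall u, N (D 0%N u) <= M0 * N u).
Hypothesis DT : forall k u, D k (T u) = T (D k u) + D k.+1 u.

Let DM k u : N (D k u) <= M0 * (2 * M) ^+ k * N u.
Proof.
elim: k u => [|k IH] u; first by rewrite expr0 mulr1.
have -> : D k.+1 u = D k (T u) - T (D k u) by rewrite DT addrAC subrr add0r.
have c0 : 0 <= M0 * (2 * M) ^+ k by rewrite mulr_ge0// exprn_ge0// mulr_ge0.
have := ler_wpM2l M_ge0 (IH u); have := ler_wpM2l c0 (TM u).
have := IH (T u); have := TM (D k u); have := normB nN (D k (T u)) (T (D k u)).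
by rewrite exprS; set p := _ ^+ k; lra.
Qed.

Let D_iter n j u : D j (iter n T u) =
  \sum_(k < n.+1) 'C(n, k)%:R *: iter (n - k) T (D (j + k)%N u).
Proof.
elim: n j => [|n IH] j; first by rewrite big_ord1 scale1r addn0.
rewrite iterS DT !IH -(pascal_sum (fun k => iter (n.+1 - k) T (D (j + k)%N u))).
congr (_ + _).
  rewrite (linear_map_sum linT); apply: eq_bigr => k _; rewrite (linear_mapZ linT).
  by rewrite -iterS subSn// -ltnS.
by apply: eq_bigr => k _; rewrite addSnnS.
Qed.

(** The truncated series of [exp(-T) (D 0) exp(T)]: by [DT], [D k] is the [k]-th iterated commutator
    of [D 0] with [T], which also explains the powers of [2 M] in its bound. *)
Definition exp_conjugate m (u : V) : V := \sum_(k < m) (k`!%:R : C)^-1 *: D k u.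

Lemma exp_intertwine m u :
  N (D 0%N (operator_exp T m u) - operator_exp T m (exp_conjugate m u)) <=
  M0 * exp_defect m M (2 * M) * N u.
Proof.
pose a i k := (i`!%:R : C)^-1 *: ((k`!%:R : C)^-1 *: iter i T (D k u)).
have -> : operator_exp T m (exp_conjugate m u) = \sum_(k < m) \sum_(i < m) a i k.
  rewrite exchange_big; apply: eq_bigr => i _ /=.
  rewrite /exp_conjugate (linear_map_sum (linear_iter i linT)) scaler_sumr.
  by apply: eq_bigr => k _; rewrite (linear_mapZ (linear_iter i linT)).
have -> : D 0%N (operator_exp T m u) = \sum_(n < m) \sum_(k < n.+1) a (n - k)%N k.
  rewrite (linear_map_sum linD); apply: eq_bigr => n _; rewrite (linear_mapZ linD) D_iter.
  rewrite scaler_sumr; apply: eq_bigr => k _; rewrite /a !scalerA bin_coef//.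
  by rewrite -ltnS.
rewrite (norm_distC nN) [M0 * _]mulrC -mulrA mulrC.
apply: square_minus_triangle_le => // i k.
rewrite /a !(normZ nN) !rnorm_fact.
have h : N (iter i T (D k u)) <= M ^+ i * (M0 * (2 * M) ^+ k * N u).
  apply: (le_trans (norm_iter _ _ M_ge0 TM)); apply: ler_wpM2l; first exact: exprn_ge0.
  exact: DM.
have c0 : 0 <= (i`!%:R : R)^-1 * (k`!%:R)^-1 by rewrite mulr_ge0// invr_ge0.
rewrite mulrA; apply: (le_trans (ler_wpM2l c0 h)).
by rewrite le_eqVlt; apply/orP; left; apply/eqP; ring.
Qed.

End Intertwining.
End Operators.
End PartialExponential.

Section Transport.
Variable R : realType.
Local Notation C := R[i].
Variables (V : lmodType C) (N : V -> R).
Hypothesis nN : is_norm N.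

(** Since [G] vanishes on the image of [G], subtracting [G y] leaves [G z] unchanged: the first
    error term halves each time, while the contributions of [G z] add up to at most
    [2 K N (G z)]. *)
Lemma homotopy_iterate (G : V -> V) (P P' : set V) K z : linear G -> is_subspace P ->
  is_subspace P' -> 0 <= K -> (forall y, P' y -> P (G y)) ->
  (forall y, P' y -> G (G y) = 0) ->
  (forall z, P z -> exists y, [/\ P' y, N y <= K * N z &
     N (z - G y) <= N z / 2 + K * N (G z)]) ->
  P z -> forall j : nat, exists y, [/\ P' y, N y <= j%:R * (K * (N z + 2 * K * N (G z))) &
     N (z - G y) <= 2^-1 ^+ j * N z + 2 * K * N (G z)].
Proof.
move=> linG sP sP' K0 GP GG h Pz; elim=> [|j [y [Py yK hy]]].
  exists 0; rewrite (norm0 nN) mul0r (linear_map0 linG) subr0 expr0 mul1r lerDl.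
  by split=> //; [exact: subspace0 | rewrite !mulr_ge0// norm_ge0].
have Pr : P (z - G y) by apply: subspaceB => //; apply: GP.
have [w [Pw wK hw]] := h _ Pr; exists (y + w).
have Gr : G (z - G y) = G z by rewrite (linear_mapB linG) GG// subr0.
rewrite Gr in hw; split; first exact: subspaceD.
  apply: (le_trans (normD nN _ _)); rewrite -natr1 mulrDl mul1r; apply: lerD => //.
  apply: (le_trans wK); apply: ler_wpM2l => //; apply: (le_trans hy).
  rewrite lerD2r ler_piMl ?norm_ge0// exprn_ile1 ?invr_ge0// invf_le1 ?ler1n//.
have -> : z - G (y + w) = z - G y - G w by rewrite (linear_mapD linG) opprD addrA.
apply: (le_trans hw); rewrite exprS; set p := _ ^+ j in hy *.
have : 0 <= K * N (G z) by rewrite mulr_ge0// norm_ge0.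
lra.
Qed.

Variables (P P' : set V) (T : V -> V) (D : nat -> V -> V) (M M0 K : R).
Hypotheses (sP : is_subspace P) (sP' : is_subspace P').
Hypotheses (linT : linear T) (M_ge0 : 0 <= M) (TM : forall u, N (T u) <= M * N u).
Hypotheses (linD : linear (D 0%N)) (M0_ge0 : 0 <= M0)
  (D0M : forall u, N (D 0%N u) <= M0 * N u).
Hypothesis DT : forall k u, D k (T u) = T (D k u) + D k.+1 u.
Local Notation G m := (exp_conjugate D m).
Hypotheses (TP : forall u, P u -> P (T u)) (TP' : forall u, P' u -> P' (T u)).
Hypotheses (K_ge0 : 0 <= K) (linG : forall m, linear (G m))
  (GP : forall m y, P' y -> P (G m y))
  (GG : forall m y, (1 < m)%N -> P' y -> G m (G m y) = 0)
  (contraction : forall m z, (1 < m)%N -> P z -> exists y,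
     [/\ P' y, N y <= K * N z & N (z - G m y) <= N z / 2 + K * N (G m z)]).

Let subspace_operator_exp (Q : set V) (S : V -> V) m u : is_subspace Q ->
  (forall u, Q u -> Q (S u)) -> Q u -> Q (operator_exp S m u).
Proof.
move=> sQ SQ Qu; apply: subspace_sum => // i _; apply: subspaceZ => //.
by elim: (i : nat) => //= j; apply: SQ.
Qed.

(* With E = exp(T) and E' = exp(-T), truncated at order m, a cycle z of D 0 yields
   the approximate cycle E' z of G m, which is G m y up to a small error; then z is
   close to D 0 (E y). *)
Lemma exp_transport : exists K', forall z, P z -> D 0%N z = 0 -> N z <= 1 ->
  exists y, [/\ P' y, N y <= K' & N (z - D 0%N y) <= 4^-1].
Proof.
pose eM := expR M; have eM0 : 0 <= eM by apply: expR_ge0.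
(* The constants are chosen in this order. [J] makes the homotopy error, enlarged by the bounds [eM]
   of [E] and [E'], at most 1/16. Then [c1 eta] will bound the defect [G m z'] and [c2] the preimage
   [y], for every small [eta]. Finally [eta] makes the remaining errors [eta c] at most 1/8, and [m]
   makes both truncation errors at most [eta]. *)
have e16 : 0 < (16 * (eM * eM + 1))^-1 by rewrite invr_gt0 mulr_gt0// ltr_wpDl// mulr_ge0.
have [J hJ] := geometric_small 1 e16; have := hJ J (leqnn J); rewrite mul1r => {}hJ.
set p := 2^-1 ^+ J in hJ; have p0 : 0 <= p by rewrite exprn_ge0// invr_ge0.
have pe : p * (eM * eM) <= 16^-1.
  move: hJ; rewrite -[_^-1]mul1r ler_pdivlMr; last first.
    by rewrite mulr_gt0// ltr_wpDl// mulr_ge0.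
  by rewrite mulrDr; nra.
pose c1 := 2 * (eM * (M0 * (eM + 1))).
have c10 : 0 <= c1 by rewrite !mulr_ge0// addr_ge0.
pose c2 := J%:R * (K * (eM + 2 * K * c1)).
have c20 : 0 <= c2.
  apply: mulr_ge0 => //; apply: mulr_ge0 => //; apply: addr_ge0 => //.
  by apply: mulr_ge0 => //; apply: mulr_ge0.
pose c := 1 + eM * (2 * K * c1) + M0 * c2.
have c0 : 1 <= c.
  have a0 : 0 <= eM * (2 * K * c1).
    by apply: mulr_ge0 => //; apply: mulr_ge0 => //; apply: mulr_ge0.
  have b0 : 0 <= M0 * c2 by apply: mulr_ge0.
  by rewrite /c; lra.
have cp : 0 < c by apply: lt_le_trans c0.
pose eta := Num.min (2^-1) (8 * c)^-1.
have eta0 : 0 < eta by rewrite lt_min; apply/andP; split; rewrite invr_gt0// mulr_gt0.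
have eta2 : eta <= 2^-1 by rewrite ge_min lexx.
have etac : eta * c <= 8^-1.
  apply: (@le_trans _ _ ((8 * c)^-1 * c)); first by rewrite ler_pM2r// ge_min lexx orbT.
  by rewrite invfM -mulrA mulVf ?gt_eqF// mulr1.
have [m1 h1] := exp_defect_small M (2 * M) eta0.
have [m2 h2] := exp_defect_small M M eta0.
pose m := (maxn m1 m2).+2; have m_gt1 : (1 < m)%N by [].
have {h1} d1 : exp_defect m M (2 * M) <= eta by apply: h1; rewrite !leqW// leq_maxl.
have {h2} d2 : exp_defect m M M <= eta by apply: h2; rewrite !leqW// leq_maxr.
pose T' u := - T u; have linT' : linear T' by move=> a u v; rewrite /T' linT; module.
have T'M u : N (T' u) <= M * N u by rewrite /T' norm_opp.
pose E := operator_exp T m; pose E' := operator_exp T' m.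
have EM u : N (E u) <= eM * N u by apply: operator_exp_le.
have E'M u : N (E' u) <= eM * N u by apply: operator_exp_le.
have linE : linear E := linear_operator_exp m linT.
have EE' u : N (E (E' u) - u) <= eta * N u.
  apply: (le_trans (operator_exp_inverse nN u linT M_ge0 TM _)) => //.
  by apply: ler_wpM2r => //; apply: norm_ge0.
have E'E u : N (E' (E u) - u) <= eta * N u.
  have T'K : T = (fun u => - T' u) by apply: funext => v; rewrite /T' opprK.
  have := operator_exp_inverse nN u linT' M_ge0 T'M (isT : (0 < m)%N).
  rewrite -T'K => /le_trans; apply; apply: ler_wpM2r => //; exact: norm_ge0.
have DE u : N (D 0%N (E u) - E (G m u)) <= M0 * eta * N u.
  apply: (le_trans (exp_intertwine nN linT M_ge0 TM linD M0_ge0 D0M DT m u)).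
  by apply: ler_wpM2r; [exact: norm_ge0 | apply: ler_wpM2l].
exists (eM * c2) => z Pz Dz z1; pose z' := E' z.
have Pz' : P z'.
  by apply: subspace_operator_exp => // u Pu; apply: subspaceN => //; apply: TP.
have z'M : N z' <= eM by apply: (le_trans (E'M z)); rewrite ler_piMr.
pose r := G m z'; have r0 : 0 <= N r by apply: norm_ge0.
have Er : N (E r) <= M0 * (eM + 1) * eta.
  have -> : E r = - (D 0%N (E z') - E r) + D 0%N (E z' - z).
    by rewrite (linear_mapB linD) Dz; module.
  apply: (le_trans (normD nN _ _)); rewrite norm_opp//.
  have a1 := DE z'; have a2 := D0M (E z' - z); have a3 := EE' z.
  have a4 : M0 * eta * N z' <= M0 * eta * eM.
    by apply: ler_wpM2l => //; rewrite mulr_ge0// ltW.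
  have a5 : M0 * N (E z' - z) <= M0 * eta.
    apply: ler_wpM2l => //; apply: (le_trans a3); rewrite ler_piMr// ltW//.
  by move: a1; rewrite -/r; lra.
(* The estimate of [E r] passes to [r] because [E'] inverts [E] up to [eta <= 1/2]; this accounts
   for the factor 2 in [c1]. *)
have rc : N r <= c1 * eta.
  have := norm_le_dist nN r (E' (E r)); rewrite (norm_distC nN r).
  have := E'E r; have := E'M (E r); have := ler_wpM2l eM0 Er.
  have := ler_wpM2r r0 eta2; rewrite /c1; lra.
have rc1 : N r <= c1 by apply: (le_trans rc); rewrite ler_piMr//; lra.
have [y [Py yK hy]] := homotopy_iterate (linG m) sP sP' K_ge0 (GP m)
  (fun y Py => GG m_gt1 Py) (fun z Pz => contraction m_gt1 Pz) Pz' J.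
rewrite -/r -/p in yK hy.
have yc : N y <= c2.
  apply: (le_trans yK); apply: ler_wpM2l => //; apply: ler_wpM2l => //.
  by apply: lerD => //; apply: ler_wpM2l => //; rewrite mulr_ge0.
exists (E y); split.
- exact: subspace_operator_exp.
- by apply: (le_trans (EM y)); apply: ler_wpM2l.
- have -> : z - D 0%N (E y) = - (E z' - z) + E (z' - G m y) - (D 0%N (E y) - E (G m y)).
    by rewrite (linear_mapB linE); module.
  apply: (le_trans (normB nN _ _)).
  have a0 := normD nN (- (E z' - z)) (E (z' - G m y)); rewrite norm_opp// in a0.
  have a1 : N (E z' - z) <= eta.
    by apply: (le_trans (EE' z)); rewrite ler_piMr// ltW.
  have a2 : N (E (z' - G m y)) <= 16^-1 + eta * (eM * (2 * K * c1)).
    apply: (le_trans (EM _)).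
    have b1 : p * N z' <= p * eM by apply: ler_wpM2l.
    have b2 : 2 * K * N r <= 2 * K * (c1 * eta) by apply: ler_wpM2l => //; rewrite mulr_ge0.
    have := ler_wpM2l eM0 (le_trans hy (lerD b1 b2)).
    by move: pe; lra.
  have a3 : N (D 0%N (E y) - E (G m y)) <= eta * (M0 * c2).
    apply: (le_trans (DE y)); rewrite mulrAC mulrC; apply: ler_wpM2l; first exact: ltW.
    exact: ler_wpM2l.
  move: etac; rewrite /c; lra.
Qed.

End Transport.

Section FunctionalEigenvector.
Variables (K : closedFieldType) (L : vectType K) (D : L -> L) (phi : L -> K).
Hypotheses (linD : linear D) (linphi : scalar phi).

Let polop (p : {poly K}) (a : L) : L := \sum_(k < size p) p`_k *: iter k D a.

Let polopE m (p : {poly K}) a : (size p <= m)%N -> polop p a = \sum_(k < m) p`_k *: iter k D a.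
Proof.
move=> le_pm; rewrite /polop (big_ord_widen m (fun k => p`_k *: iter k D a))// big_mkcond.
by apply: eq_bigr => k _; case: ltnP => // le_pk; rewrite nth_default// scale0r.
Qed.

Let polop_mulXsubC (q : {poly K}) mu a : polop (q * ('X - mu%:P)) a = polop q (D a - mu *: a).
Proof.
have szq : (size (q * ('X - mu%:P))%R <= (size q).+1)%N.
  by apply: (leq_trans (size_polyMleq _ _)); rewrite size_XsubC addnC.
have linI k : linear (iter k D) by elim: k => [|k IH] c u v //=; rewrite IH linD.
rewrite (polopE a szq) (eq_bigr (fun k : 'I_(size q).+1 =>
    (if (k : nat) is k'.+1 then q`_k' *: iter k D a else 0) - (q`_k * mu) *: iter k D a)).
  rewrite sumrB big_ord_recl [X in _ - X]big_ord_recr /= add0r.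
  rewrite [q`_(size q)]nth_default// mul0r scale0r addr0 -sumrB; apply: eq_bigr => k _.
  by rewrite -iterS iterSr (linear_mapB (linI k)) (linear_mapZ (linI k)) scalerBr scalerA.
move=> [k ltk] _ /=; rewrite mulrBr coefB coefMX coefMC scalerBl; congr (_ - _).
by case: k ltk => //= _; rewrite scale0r.
Qed.

(** Among the nonzero polynomials [p] with [phi o p(D) = 0] take one of minimal size and split off a
    linear factor, [p = q (X - mu)]. Then [phi o q(D)] is a nonzero eigenvector of the transpose of
    [D], and [a] is the value of [q(D)] at a vector where it does not vanish. *)
Lemma functional_eigenvector b : phi b != 0 ->
  exists a mu, phi a != 0 /\ forall k, phi (iter k D a) = mu ^+ k * phi a.
Proof.
move=> phib; have linI k : linear (iter k D) by elim: k => [|k IH] c u v //=; rewrite IH linD.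
have phisum I (r : seq I) P F : phi (\sum_(i <- r | P i) F i) = \sum_(i <- r | P i) phi (F i).
  exact: (linear_map_sum (V2 := K^o) linphi).
have phiZ c x : phi (c *: x) = c * phi x by apply: (linear_mapZ (V2 := K^o) linphi).
pose kills s := `[< exists p : {poly K}, [/\ p != 0, size p = s & forall a, phi (polop p a) = 0] >].
have exk : exists s, kills s.
  (* The [n + 1] functionals [phi o D^k] on a space of dimension [n] are linearly dependent. *)
  pose n := \dim {:L}; pose A := \matrix_(k < n.+1, i < n) phi (iter k D (vbasis {:L})`_i).
  have ker0 : kermx A != 0.
    rewrite -mxrank_eq0 mxrank_ker -lt0n subn_gt0 ltnS; exact: rank_leq_col.
  pose c := nz_row (kermx A); have c0 : c != 0 by rewrite nz_row_eq0.
  have cA : c *m A = 0 by apply/sub_kermxP/nz_row_sub.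
  pose p := \poly_(k < n.+1) c 0 (inord k).
  exists (size p); apply/asboolP; exists p; split=> //.
    have [k ck] : exists k, c 0 k != 0 by apply/rV0Pn.
    apply: contra_neq ck => p0; have := congr1 (fun q : {poly K} => q`_k) p0.
    by rewrite coef0 coef_poly ltn_ord inord_val.
  move=> a; rewrite (polopE a (size_poly _ _)) phisum.
  rewrite (coord_vbasis (memvf a)).
  rewrite (eq_bigr (fun k : 'I_n.+1 => \sum_(i < n) coord (vbasis {:L}) i a * (c 0 k * A k i))).
    rewrite exchange_big big1// => i _; rewrite -mulr_sumr.
    by have := congr1 (fun B : 'rV_n => B 0 i) cA; rewrite !mxE => ->; rewrite mulr0.
  move=> k _; rewrite coef_poly ltn_ord inord_val phiZ (linear_map_sum (linI k)) phisum mulr_sumr.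
  by apply: eq_bigr => i _; rewrite (linear_mapZ (linI k)) phiZ mxE mulrCA.
have [s /asboolP[p [p0 sp pP]] mins] := ex_minnP exk.
have sp1 : size p != 1%N.
  apply/negP => /size_poly1P[c c0 pc]; have := pP b; rewrite pc /polop size_polyC c0 big_ord1.
  by rewrite coefC eqxx phiZ => /eqP; rewrite mulf_eq0 (negbTE c0) (negbTE phib).
have [mu /factor_theorem[q pq]] := closed_rootP _ sp1.
have q0 : q != 0 by apply: contra_neq p0 => q0; rewrite pq q0 mul0r.
have [a0 pa0] : exists a, phi (polop q a) != 0.
  apply: contrapT => no; have /mins : kills (size q).
    apply/asboolP; exists q; split=> // a; apply/eqP; apply: contrapT => /negP h.
    by apply: no; exists a.
  by rewrite -sp pq size_Mmonic ?monicXsubC// size_XsubC addnC /= ltnn.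
exists (polop q a0), mu; split=> // k.
have step x : phi (polop q (D x)) = mu * phi (polop q x).
  have linq : linear (polop q).
    move=> c u v; rewrite /polop scaler_sumr -big_split; apply: eq_bigr => i _ /=.
    by rewrite linI scalerDr !scalerA mulrC.
  have := pP x; rewrite pq polop_mulXsubC (linear_mapB linq) (linear_mapZ linq).
  rewrite -scaleNr addrC linphi => /eqP; rewrite mulNr addrC subr_eq0.
  by move=> /eqP.
have comm x : iter k D (polop q x) = polop q (iter k D x).
  rewrite /polop (linear_map_sum (linI k)); apply: eq_bigr => i _.
  by rewrite (linear_mapZ (linI k)) -!iterD addnC.
rewrite comm; elim: k {comm} => [|k IH]; first by rewrite expr0 mul1r.
by rewrite iterS step IH exprS mulrA.
Qed.

End FunctionalEigenvector.

Section Invariance.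
Variable R : realType.
Local Notation C := R[i].
Variables (L : vectType C) (X : completeNormedModType C).
Variables (br : L -> L -> L) (rho : L -> X -> X).
Hypothesis bmod : bounded_module br rho.
Variables (delta : L -> L) (S : X -> X).
Hypotheses (lin_delta : linear delta) (bS : bounded_operator S)
  (Srho : forall l x, S (rho l x) = rho (delta l) x + rho l (S x))
  (delta_br : forall a b, delta (br a b) = br (delta a) b + br a (delta b)).
Local Notation kchain := (kchain L X).
Local Notation N := (@chain_norm R L X).
Local Notation d f := (koszul_op br (shift rho f)).
Local Notation Lie := (lie_derivative S delta).
Let mod := bounded_module_module bmod.
Let nC := @chain_norm_is_norm R L X.
Let linS : linear S. Proof. by case: bS. Qed.
Let linLie : linear (Lie : kchain -> kchain). Proof. exact: linear_lie_derivative. Qed.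

Lemma contract_lie_derivative (f : L -> C) (u : kchain) : scalar f ->
  contract f (Lie u) = Lie (contract f u) + contract (fun a => f (delta a)) u.
Proof.
move=> linf; have linfd : scalar (fun a => f (delta a)).
  by move=> c a b; rewrite lin_delta linf.
move: u; apply: linear_eq => [c u v|c u v|x|l u IH].
- by rewrite linLie linearP.
- by rewrite linearP linLie linearP /=; module.
- by rewrite lie_derivative_scalars// !contract_scalars (linear_map0 linLie) addr0.
- rewrite lie_derivative_wedge// linearD /= !contract_wedge// IH.
  rewrite (linear_mapB linLie) (linear_mapZ linLie) lie_derivative_wedge//.
  rewrite [wedge l (_ + _)]linearD /=.
  by module.
Qed.

Section Flow.
Variables (f : L -> C) (t : C).
Hypothesis charf : lie_character br f.

Definition flow_coef k (a : L) : C := t ^+ k * f (iter k delta a).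

(** [f o exp(t delta)] truncated at order [m]. It is still exactly a character, because each term
    vanishes on brackets. *)
Definition flow m (a : L) : C := \sum_(k < m) (k`!%:R)^-1 * flow_coef k a.

(** The iterated commutators of [d f] with [t *: Lie]. [Lie] commutes with the unshifted
    differential, so only the contraction by [f] contributes from order one on. *)
Definition flow_op k (u : kchain) : kchain :=
  if k is _.+1 then - contract (flow_coef k) u else d f u.

Let linI k : linear (iter k delta).
Proof. exact: linear_iter. Qed.

Lemma flow_coef_scalar k : scalar (flow_coef k).
Proof. by move=> c a b; rewrite /flow_coef linI charf.1; ring. Qed.

Lemma flow_character m : lie_character br (flow m).
Proof.
split=> [c a b|a b].
  rewrite /flow mulr_sumr -big_split; apply: eq_bigr => k _ /=.
  by rewrite flow_coef_scalar; ring.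
apply: big1 => k _; rewrite /flow_coef.
have -> : f (iter k delta (br a b)) = 0; last by rewrite !mulr0.
elim: (k : nat) a b => [|j IH] a b; first by rewrite charf.2.
rewrite iterSr delta_br (linear_mapD (linI j)).
by rewrite (linear_mapD (V2 := C^o) charf.1) /= !IH addr0.
Qed.

Lemma flow_op_comm k u : flow_op k (t *: Lie u) = t *: Lie (flow_op k u) + flow_op k.+1 u.
Proof.
have lin_d : linear (d f).
  by apply: linear_koszul_op => l; have [] := shift_bounded bmod f l.
have coefS j : contract (flow_coef j.+1) u =
    t *: contract (fun a => flow_coef j (delta a)) u.
  rewrite /contract scaler_sumr; apply: eq_bigr => i _; rewrite scalerA.
  by congr (_ *: _); rewrite /flow_coef iterSr exprS mulrA.
case: k => [|k]; rewrite /flow_op; last first.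
  rewrite linearZ /= contract_lie_derivative; last exact: flow_coef_scalar.
  by rewrite (linear_mapN linLie) (coefS k.+1); module.
rewrite (linear_mapZ lin_d) !koszul_op_shift// contract_lie_derivative ?charf.1//; last first.
  exact: charf.1.
rewrite -(lie_derivative_comm (module_lie mod))//; last 2 first.
- exact: module_linear mod.
- exact: module_linearl mod.
rewrite (linear_mapB linLie) coefS.
have -> : contract (fun a => flow_coef 0 (delta a)) u = contract (fun a => f (delta a)) u.
  by rewrite /contract; apply: eq_bigr => i _; rewrite /flow_coef expr0 mul1r.
by module.
Qed.

Lemma exp_conjugate_flow m u : exp_conjugate flow_op m.+1 u = d (flow m.+1) u.
Proof.
rewrite koszul_op_shift// /exp_conjugate big_ord_recl /= invr1 scale1r koszul_op_shift//.
rewrite -addrA; congr (_ + _).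
have -> : contract (flow m.+1) u = \sum_(k < m.+1) (k`!%:R : C)^-1 *: contract (flow_coef k) u.
  rewrite /contract (eq_bigr (fun k : 'I_m.+1 => \sum_(i < \dim {:L}) ((k`!%:R : C)^-1 *
      flow_coef k (vbasis {:L})`_i) *: annihilate i u)); last first.
    by move=> k _; rewrite scaler_sumr; apply: eq_bigr => i _; rewrite scalerA.
  by rewrite exchange_big; apply: eq_bigr => i _ /=; rewrite -scaler_suml.
rewrite big_ord_recl /= invr1 scale1r opprD; congr (_ + _); last first.
  by rewrite -sumrN; apply: eq_bigr => k _; rewrite scalerN.
congr (- _); apply: eq_bigr => i _; congr (_ *: _).
by rewrite /flow_coef expr0 mul1r.
Qed.

End Flow.

Lemma rescaled_exp_sum m (x : R) (mu w : C) : mu != 0 ->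
  \sum_(k < m) (k.+1`!%:R)^-1 * ((x%:C%C / mu) ^+ k.+1 * (mu ^+ k * w)) =
    (w / mu) * (\sum_(k < m) (k.+1`!%:R)^-1 * x ^+ k.+1)%:C%C.
Proof.
move=> mu0; rewrite rmorph_sum mulr_sumr; apply: eq_bigr => k _ /=.
rewrite (rmorphM (real_complex R)) /=.
have -> : (x ^+ k.+1)%:C%C = x%:C%C ^+ k.+1 by rewrite rmorphXn.
have -> : ((k.+1`!%:R)^-1)%:C%C = (k.+1`!%:R)^-1 :> C by rewrite fmorphV rmorph_nat.
rewrite expr_div_n [mu ^+ k.+1]exprS.
have muk : mu ^+ k != 0 by rewrite expf_neq0.
field; rewrite muk mu0 /=.
by rewrite pnatr_eq0 -lt0n fact_gt0.
Qed.

(** One [t] has to serve all truncation orders. With [t = x / mu] and [x >= 0], the variable part is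
    [w / mu] times a truncation of [exp x - 1], whose terms are nonnegative and whose linear term
    [x] is present once [m > 1]. For [mu = 0] only the term linear in [t] survives. *)
Lemma flow_far f a (mu : C) B : f (delta a) != 0 ->
  (forall k, f (iter k.+1 delta a) = mu ^+ k * f (delta a)) ->
  exists t, forall m, (1 < m)%N -> B <= rnorm (flow f t m a).
Proof.
move=> fa fk; set w := f (delta a) in fa fk; have nC1 := rnorm_is_norm (R[i] : numFieldType).
have far (x y : C) : B + rnorm x <= rnorm y -> B <= rnorm (x + y).
  by have := ler_rnormD (x + y) (- x); rewrite rnormN addrAC subrr add0r; lra.
have flowE t m : flow f t m.+1 a = f a + \sum_(k < m) (k.+1`!%:R)^-1 * (t ^+ k.+1 * (mu ^+ k * w)).
  rewrite /flow big_ord_recl /flow_coef /= expr0 mul1r invr1 mul1r; congr (_ + _).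
  by apply: eq_bigr => k _; rewrite /bump /= add1n fk.
pose r := `|B| + rnorm (f a); have r0 : 0 <= r by rewrite addr_ge0 ?rnorm_ge0.
have rB : B + rnorm (f a) <= r by rewrite lerD2r ler_norm.
have [mu0|mu0] := eqVneq mu 0.
  exists (r%:C%C / w) => -[|[|m]]// _; rewrite flowE big_ord_recl big1 ?addr0; last first.
    by move=> k _; rewrite mu0 lift0 expr0n mul0r !mulr0.
  rewrite /= expr1 mul1r invr1 mul1r divfK//; apply: far.
  by rewrite rnorm_real ger0_norm.
have wmu : 0 < rnorm (w / mu).
  rewrite lt_neqAle rnorm_ge0 andbT eq_sym; apply/eqP => /rnorm_eq0/eqP.
  by rewrite mulf_eq0 (negbTE fa) invr_eq0 (negbTE mu0).
pose x := r / rnorm (w / mu); have x0 : 0 <= x by rewrite divr_ge0// ltW.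
exists (x%:C%C / mu) => -[|[|m]]// _; rewrite flowE; apply: far.
rewrite (rescaled_exp_sum _ x w mu0).
rewrite rnormM rnorm_real ger0_norm; last first.
  by apply: sumr_ge0 => k _; rewrite mulr_ge0 ?invr_ge0// exprn_ge0.
apply: (le_trans rB); rewrite big_ord_recl /= invr1 mul1r expr1 mulrDr.
rewrite {1}/x mulrC divfK ?gt_eqF// lerDl; apply: mulr_ge0; first exact: ltW.
by apply: sumr_ge0 => k _; rewrite mulr_ge0 ?invr_ge0// exprn_ge0.
Qed.

(* The characters f o exp(t delta) have conjugate Koszul complexes; unless
   f o delta = 0, some of them are so large that their complex is acyclic. *)
Lemma spectrum_invariant f p : lie_character br f ->
  ~ fin_dim_homology br (shift rho f) p -> forall a, f (delta a) = 0.
Proof.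
move=> charf inf b; apply/eqP; apply: contrapT => /negP fb; apply: inf.
have linfd : scalar (fun a => f (delta a)) by move=> c a a'; rewrite lin_delta charf.1.
have [a [mu [fa fk]]] := functional_eigenvector lin_delta linfd fb.
have [B [K [_ K0 homotopy]]] := far_character_homotopy bmod a.
have [t far] := flow_far B fa fk.
have shX g l : linear (shift rho g l) by have [] := shift_bounded bmod g l.
have bT : bounded_map N N (fun u => t *: Lie u).
  by apply: bounded_mapZ => //; apply: bounded_lie_derivative.
have bd : bounded_map N N (d f) by apply: bounded_koszul_op => l; apply: (shift_bounded bmod).
have [linT [M M0 TM]] := bT; have [lind [M' M'0 dM]] := bd.
have linG m : linear (exp_conjugate (flow_op f t) m : kchain -> kchain).
  case: m => [|m] c u v; first by rewrite /exp_conjugate !big_ord0 scaler0 addr0.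
  rewrite !exp_conjugate_flow.
  by apply: (linear_koszul_op br (shX _)).
have GP m (y : kchain) : kdegree p.+1 y -> kdegree p (exp_conjugate (flow_op f t) m y).
  case: m => [|m] Py.
    by rewrite /exp_conjugate big_ord0; apply: subspace0 (subspace_kdegree _ _ _).
  rewrite exp_conjugate_flow.
  exact: (koszul_op_degree br (shX _) Py).
have GG m (y : kchain) : (1 < m)%N -> kdegree p.+1 y ->
    exp_conjugate (flow_op f t) m (exp_conjugate (flow_op f t) m y) = 0.
  case: m => [|m] // _ Py; rewrite !exp_conjugate_flow koszul_op_square//.
  by have [linfm charfm] := flow_character t charf m.+1; apply: shift_module.
have contraction m (y : kchain) : (1 < m)%N -> kdegree p y -> exists w, [/\ kdegree p.+1 w,
    N w <= K * N y & N (y - exp_conjugate (flow_op f t) m w) <=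
      N y / 2 + K * N (exp_conjugate (flow_op f t) m y)].
  case: m => [|m] // m1 Py; rewrite exp_conjugate_flow.
  have [linfm _] := flow_character t charf m.+1.
  have [w [Pw wK hw]] := homotopy _ linfm (far _ m1) p y Py.
  exists w; split=> //; rewrite exp_conjugate_flow.
  by apply: (le_trans hw); rewrite lerD2r; have := norm_ge0 nC y; lra.
have LieP q (u : kchain) : kdegree q u -> kdegree q (t *: Lie u).
  move=> Pu; apply: subspaceZ (subspace_kdegree _ _ _) _ _ _.
  exact: lie_derivative_degree.
have [K' K'P] := exp_transport nC (subspace_kdegree _ _ p) (subspace_kdegree _ _ p.+1)
  linT M0 TM lind M'0 dM (flow_op_comm t charf) (LieP p) (LieP p.+1) K0 linG GP GG contraction.
apply: (@finite_homology_net _ _ _ _ _ bmod f p K' [:: 0]) => // z [Pz dz] z1.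
have [y [Py yK hy]] := K'P z Pz dz z1.
by exists y, 0; rewrite inE eqxx subr0.
Qed.

End Invariance.

(** * The projection property *)

Section Projection.
Variable R : realType.
Local Notation C := R[i].
Variables (X : completeNormedModType C) (L1 L2 : vectType C).
Variables (br1 : L1 -> L1 -> L1) (br2 : L2 -> L2 -> L2).
Variables (rho1 : L1 -> X -> X) (rho2 : L2 -> X -> X).
Hypotheses (bmod1 : bounded_module br1 rho1) (bmod2 : bounded_module br2 rho2).
Variables (g : L1 -> L2) (h : L2 -> L1) (phi : L2 -> C) (l : L2).
Hypotheses (ling : linear g) (linh : linear h) (ghK : cancel g h) (hl : h l = 0)
  (linphi : scalar phi)
  (phig : forall a, phi (g a) = 0) (phil : phi l = 1)
  (dec : forall x, x = g (h x) + phi x *: l).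
Hypotheses (gbr : forall a b, g (br1 a b) = br2 (g a) (g b))
  (phibr : forall a b, phi (br2 a b) = 0) (rhog : forall a, rho1 a = rho2 (g a)).
Local Notation N1 := (@chain_norm R L1 X).
Local Notation delta := (ad_restrict br2 g h l).
Let mod1 := bounded_module_module bmod1.
Let mod2 := bounded_module_module bmod2.
Let lie1 := module_lie mod1.
Let lie2 := module_lie mod2.

Let shift_restrict (f1 : L1 -> C) (f2 : L2 -> C) : (forall a, f2 (g a) = f1 a) ->
  forall a, shift rho1 f1 a = shift rho2 f2 (g a).
Proof. by move=> fg a; apply: funext => x; rewrite /shift fg rhog. Qed.

Lemma codim1_projection_forward f p : lie_character br2 f ->
  ~ fin_dim_homology br2 (shift rho2 f) p -> exists2 q, (q <= p)%N &
    lie_character br1 (fun a => f (g a)) /\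
    ~ fin_dim_homology br1 (shift rho1 (fun a => f (g a))) q.
Proof.
move=> [linf charf] inf; have linfg : scalar (fun a => f (g a)).
  by move=> c a b; rewrite ling linf.
have charfg a b : f (g (br1 a b)) = 0 by rewrite gbr.
have mf1 := shift_module bmod1 linfg charfg; have mf2 := shift_module bmod2 linf charf.
have rfg := shift_restrict (fun a => erefl (f (g a))).
apply: contrapT => no; apply: inf.
have fin q : (q <= p)%N -> fin_dim_homology br1 (shift rho1 (fun a => f (g a))) q.
  by move=> qp; apply: contrapT => inf; apply: no; exists q.
case: p no fin => [|p] _ fin.
  by apply: (codim1_homology_0 mf1 mf2 (h := h) (phi := phi) (l := l)) => //; apply: fin.
by apply: (codim1_homology_S mf1 mf2 (h := h) (phi := phi) (l := l)) => //; apply: fin.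
Qed.

Let gad a : g (delta a) = br2 l (g a).
Proof. exact: (ad_restrictE dec). Qed.

Lemma ad_restrict_derivation a b : delta (br1 a b) = br1 (delta a) b + br1 a (delta b).
Proof.
apply: (can_inj ghK); rewrite (linear_mapD ling) !gbr !gad gbr.
have := lie_jacobi lie2 l (g a) (g b).
rewrite [br2 (g b) (br2 l (g a))](lie_brC lie2) [br2 (g b) l](lie_brC lie2).
rewrite (linear_mapN (linear_br lie2 (g a))) => /eqP.
by rewrite subr_eq0 subr_eq addrC => /eqP ->.
Qed.

(** The bracket of [a + s l] and [b + t l] is [[a, b] + s (delta b) - t (delta a)]: the first term
    is killed because [f] is a character, the others by invariance. *)
Lemma character_extension f c : lie_character br1 f -> (forall a, f (delta a) = 0) ->
  lie_character br2 (fun x => f (h x) + c * phi x).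
Proof.
move=> [linf charf] fdelta; split=> [a x y|x y].
  by rewrite linh linf linphi; ring.
rewrite phibr mulr0 addr0 [in br2 x y](dec x) [in br2 _ y](dec y).
set a := h x; set b := h y; set s := phi x; set t := phi y.
have linl := linear_br lie2; have fhl z : f (h (br2 l (g z))) = 0 by exact: fdelta.
have fD u v : f (u + v) = f u + f v by apply: (linear_mapD (V2 := C^o) linf).
have fN u : f (- u) = - f u by apply: (linear_mapN (V2 := C^o) linf).
have fZ k u : f (k *: u) = k * f u by apply: (linear_mapZ (V2 := C^o) linf).
rewrite (linear_mapD (linl _)) (linear_mapZ (linl _)) [br2 _ (g b)](lie_brC lie2).
rewrite [br2 _ l](lie_brC lie2) !(linear_mapD (linl _)) !(linear_mapZ (linl _)) (lie_alt lie2).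
rewrite scaler0 addr0 [br2 (g b) l](lie_brC lie2) [br2 (g b) (g a)](lie_brC lie2) -gbr.
rewrite !(linear_mapD linh, linear_mapN linh, linear_mapZ linh) ghK !(fD, fN, fZ).
by rewrite charf !fhl; ring.
Qed.

Lemma codim1_projection_backward f p : lie_character br1 f ->
  ~ fin_dim_homology br1 (shift rho1 f) p -> exists f2, [/\ lie_character br2 f2,
    forall a, f2 (g a) = f a & ~ fin_dim_homology br2 (shift rho2 f2) p].
Proof.
move=> charf1 inf; have [linf charf] := charf1.
have lin_delta : linear delta by exact: (linear_ad_restrict mod2 l ling linh).
have Srho a x : rho2 l (rho1 a x) = rho1 (delta a) x + rho1 a (rho2 l x).
  by rewrite !rhog gad (module_bracket mod2) subrK.
have bl := bounded_module_bounded bmod2 l.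
have fdelta := spectrum_invariant bmod1 lin_delta bl Srho ad_restrict_derivation charf1 inf.
apply: contrapT => no; apply: inf.
pose f2 c x := f (h x) + c * phi x.
have char2 c : lie_character br2 (f2 c) by apply: character_extension.
have f2g c a : f2 c (g a) = f a by rewrite /f2 ghK phig mulr0 addr0.
have fin c : fin_dim_homology br2 (shift rho2 (f2 c)) p.
  by apply: contrapT => inf; apply: no; exists (f2 c).
have mf1 := shift_module bmod1 linf charf.
have mf2 c := shift_module bmod2 (char2 c).1 (char2 c).2.
have f2l c : f2 c l = c.
  by rewrite /f2 hl phil mulr1 (linear_map0 (V2 := C^o) linf) add0r.
rewrite fin_dim_homologyE//.
have lin_l := bl.1; have Ldeg q u := lie_derivative_degree (p := q) (u := u) delta lin_l.
have comm y : lie_derivative (rho2 l) delta (koszul_op br1 (shift rho1 f) y) =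
    koszul_op br1 (shift rho1 f) (lie_derivative (rho2 l) delta y).
  rewrite !koszul_op_shift// (linear_mapB (linear_lie_derivative _ lin_l)).
  rewrite (lie_derivative_comm lie1 (module_linear mod1) (module_linearl mod1))//; last first.
    exact: ad_restrict_derivation.
  rewrite (contract_lie_derivative lin_delta bl)//.
  have -> : contract (fun a => f (delta a)) y = 0; last by rewrite addr0.
  by apply: big1 => i _; rewrite fdelta scale0r.
have lind := linear_koszul_op br1 (module_linear mf1).
have bLie := bounded_lie_derivative delta bl.
have bd : bounded_map N1 N1 (koszul_op br1 (shift rho1 f)).
  by apply: bounded_koszul_op => a; apply: (shift_bounded bmod1).
have Lcycle z : cycles br1 (shift rho1 f) p z ->
    cycles br1 (shift rho1 f) p (lie_derivative (rho2 l) delta z).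
  move=> [Pz dz]; split; first exact: Ldeg.
  by rewrite -comm dz; apply: linear_map0; apply: linear_lie_derivative.
apply: (fin_codim_spectrum (banach_kdegree L1 X p.+1) (banach_cycles bmod1 f p) bd
  (boundary_cycle mf1 (p := p)) bLie bLie (Ldeg p.+1) Lcycle (fun y _ => comm y)).
(* Since [f2 c] restricts to [f] and takes the value [c] at [l], changing [c] leaves the complex
   over [L1] fixed and turns the action of [l] into [Theta - c]. *)
move=> c; have := codim1_coker mf1 (mf2 c) ling linh ghK hl linphi phig phil dec gbr phibr
  (shift_restrict (f2g c)) (fin c).
congr (fin_dim_quotient _ (_ @` _)); apply: funext => x.
by rewrite lie_derivative_shift f2l.
Qed.

End Projection.

Lemma lfun_of_scalar (K : fieldType) (L : vectType K) (f : L -> K) : scalar f ->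
  exists F : 'Hom(L, K^o), forall a, F a = f a.
Proof.
move=> linf; exists (\sum_(i < \dim {:L}) f (vbasis {:L})`_i *:
  linfun (coord (vbasis {:L}) i : L -> K^o)) => a.
rewrite sum_lfunE [in RHS](coord_vbasis (memvf a)) (linear_map_sum (V2 := K^o) linf).
apply: eq_bigr => i _; rewrite scale_lfunE lfunE.
by rewrite (linear_mapZ (V2 := K^o) linf); apply: mulrC.
Qed.

Lemma separating_functional (K : fieldType) (L : vectType K) (W : {vspace L}) l : l \notin W ->
  exists phi : 'Hom(L, K^o), (forall w, w \in W -> phi w = 0) /\ phi l = 1.
Proof.
move=> lW; have [pi piE] : exists pi : 'Hom(L, L), forall x, pi x = x - projv W x.
  by exists (\1 - projv W)%VF => x; rewrite add_lfunE opp_lfunE id_lfunE.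
have pil : pi l != 0.
  by apply: contraNneq lW; rewrite piE => /eqP; rewrite subr_eq0 => /eqP ->; apply: memv_proj.
have [i ci] : exists i, coord (vbasis {:L}) i (pi l) != 0.
  apply: contrapT => no; move: pil; rewrite (coord_vbasis (memvf (pi l))) big1 ?eqxx// => i _.
  have [->|ci] := eqVneq (coord (vbasis {:L}) i (pi l)) 0; first by rewrite scale0r.
  by case: no; exists i.
exists ((coord (vbasis {:L}) i (pi l))^-1 *:
  (linfun (coord (vbasis {:L}) i : L -> K^o) \o pi)%VF); split=> [w wW|].
  have piw : pi w = 0 by rewrite piE projv_id// subrr.
  by rewrite scale_lfunE comp_lfunE piw linear0 scaler0.
by rewrite scale_lfunE comp_lfunE lfunE; exact: (mulVf ci).
Qed.

(** * Subspaces generated by an ideal or subalgebra and brackets *)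

Section LieSubspaces.
Variables (K : numFieldType) (L : vectType K) (br : L -> L -> L).
Hypothesis lie : is_lie_bracket br.
Implicit Types (U V W I J : {vspace L}).

Lemma mem_lie_product U V u v : u \in U -> v \in V -> br u v \in lie_product br U V.
Proof.
move=> uU vV; have linr := linear_br lie.
have linl w : linear (br^~ w) by move=> c a b; apply: lie_linearl lie _ _ _ _.
rewrite (coord_vbasis uU) (linear_map_sum (linl _)); apply: memv_suml => i _.
rewrite (linear_mapZ (linl _)); apply: memvZ.
rewrite (coord_vbasis vV) (linear_map_sum (linr _)); apply: memv_suml => j _.
rewrite (linear_mapZ (linr _)); apply: memvZ.
by apply: memv_span; apply: allpairs_f; apply: mem_nth; rewrite size_tuple.
Qed.

Lemma lie_product_sub U V W : (forall u v, u \in U -> v \in V -> br u v \in W) ->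
  (lie_product br U V <= W)%VS.
Proof.
move=> UVW; apply/span_subvP => _ /allpairsP[[u v] [/= uU vV ->]].
by apply: UVW; apply: vbasis_mem.
Qed.

(** [J] lies in [I + S k] for every [k]: this passes from [k] to [k.+1] because [J <= I + [J, J]],
    and at [k = m] only [I] is left. *)
Let series_top (S : nat -> {vspace L}) I J m : S 0%N = fullv -> S m = 0%VS ->
  (forall k u v, u \in (I + S k)%VS -> v \in (I + S k)%VS -> br u v \in (I + S k.+1)%VS) ->
  (J <= I + lie_product br J J)%VS -> (J <= I)%VS.
Proof.
move=> S0 Sm step JI; suff : (J <= I + S m)%VS by rewrite Sm addv0.
elim: (m : nat) => [|k IH]; first by rewrite S0; apply: subv_trans (addvSr _ _); apply: subvf.
apply: (subv_trans JI); rewrite subv_add addvSl; apply: lie_product_sub => u v uJ vJ.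
by apply: step; apply: (subvP IH).
Qed.

(** Here [S] is the derived series; brackets of [S k] with [I] fall into the ideal [I]. *)
Lemma solvable_ideal_top I J : lie_solvable br -> is_ideal br I ->
  (J <= I + lie_product br J J)%VS -> (J <= I)%VS.
Proof.
move=> [m Sm] idI.
apply: (series_top (S := fun k => iter k (fun U => lie_product br U U) fullv)) (Sm) _ => //.
move=> k _ _ /memv_addP[a aI [u uS ->]] /memv_addP[b bI [v vS ->]].
have -> : br (a + u) (b + v) = (br (a + u) b - br v a) + br u v.
  rewrite (linear_mapD (linear_br lie _)) (lie_brC lie _ v) (linear_mapD (linear_br lie v)).
  by rewrite (lie_brC lie u v) opprD addrA.
apply: memv_add; last exact: mem_lie_product.
by apply: rpredB; apply: idI.
Qed.

(** Here [S] is the lower central series; brackets of [S k] with [I] need not lie in [I], but they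
    lie in [S k.+1]. *)
Lemma nilpotent_subalgebra_top I J : lie_nilpotent br -> is_subalgebra br I ->
  (J <= I + lie_product br J J)%VS -> (J <= I)%VS.
Proof.
move=> [m Sm] subI.
apply: (series_top (S := fun k => iter k (lie_product br fullv) fullv)) (Sm) _ => //.
move=> k _ _ /memv_addP[a aI [u uS ->]] /memv_addP[b bI [v vS ->]].
have -> : br (a + u) (b + v) = br a b + (br (a + u) v - br b u).
  rewrite (linear_mapD (linear_br lie _)) (lie_brC lie _ b) (linear_mapD (linear_br lie b)).
  by rewrite (lie_brC lie a b) opprD [in LHS]addrAC addrA.
apply: memv_add; first exact: subI.
by rewrite rpredB//; apply: mem_lie_product => //; apply: memvf.
Qed.

End LieSubspaces.

Section Projects.
Variable R : realType.
Local Notation C := R[i].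
Variable X : completeNormedModType C.

(* The projection property, refined by degrees, for the restriction of characters
   along g : L1 -> L2. *)
Definition projects (L1 L2 : vectType C) (br1 : L1 -> L1 -> L1) (br2 : L2 -> L2 -> L2)
    (rho1 : L1 -> X -> X) (rho2 : L2 -> X -> X) (g : L1 -> L2) : Prop :=
  (forall f p, lie_character br2 f -> ~ fin_dim_homology br2 (shift rho2 f) p ->
    exists2 q, (q <= p)%N & lie_character br1 (fun a => f (g a)) /\
      ~ fin_dim_homology br1 (shift rho1 (fun a => f (g a))) q) /\
  (forall f p, lie_character br1 f -> ~ fin_dim_homology br1 (shift rho1 f) p ->
    exists f2, [/\ lie_character br2 f2, forall a, f2 (g a) = f a &
      ~ fin_dim_homology br2 (shift rho2 f2) p]).

Lemma projects_comp (L1 L2 L3 : vectType C) br1 br2 br3 rho1 rho2 rho3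
    (g : L1 -> L2) (g' : L2 -> L3) (g'' : L1 -> L3) :
  projects br1 br2 rho1 rho2 g -> projects br2 br3 rho2 rho3 g' ->
  (forall a, g'' a = g' (g a)) -> projects br1 br3 rho1 rho3 g''.
Proof.
move=> [fwd bwd] [fwd' bwd'] /funext ->; split=> f p charf inf.
  have [q qp [charq infq]] := fwd' f p charf inf.
  have [q' qq' h] := fwd _ q charq infq.
  by exists q' => //; apply: leq_trans qp.
have [f2 [char2 f2g inf2]] := bwd f p charf inf.
have [f3 [char3 f3g inf3]] := bwd' f2 p char2 inf2.
by exists f3; split=> // a; rewrite f3g.
Qed.

Lemma projects_iso (L1 L2 : vectType C) br1 br2 rho1 rho2 (g : L1 -> L2) (h : L2 -> L1) :
  bounded_module br1 rho1 -> bounded_module br2 rho2 -> linear g -> linear h ->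
  cancel g h -> cancel h g -> (forall a b, g (br1 a b) = br2 (g a) (g b)) ->
  (forall a, rho1 a = rho2 (g a)) -> projects br1 br2 rho1 rho2 g.
Proof.
move=> bmod1 bmod2 ling linh ghK hgK gbr rhog.
have hbr a b : h (br2 a b) = br1 (h a) (h b) by apply: (can_inj ghK); rewrite gbr !hgK.
have fin f1 f2 p : lie_character br1 f1 -> lie_character br2 f2 -> (forall a, f2 (g a) = f1 a) ->
    fin_dim_homology br1 (shift rho1 f1) p <-> fin_dim_homology br2 (shift rho2 f2) p.
  move=> [lin1 char1] [lin2 char2] fg.
  have m1 := shift_module bmod1 lin1 char1; have m2 := shift_module bmod2 lin2 char2.
  have r1 a : shift rho1 f1 a = shift rho2 f2 (g a).
    by apply: funext => x; rewrite /shift fg rhog.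
  have r2 a : shift rho2 f2 a = shift rho1 f1 (h a) by rewrite r1 hgK.
  split; [exact: (fin_dim_homology_retract m2 m1 linh ling hgK hbr gbr r2 r1)|].
  exact: (fin_dim_homology_retract m1 m2 ling linh ghK gbr hbr r1 r2).
split=> f p [linf charf] inf.
  have char1 : lie_character br1 (fun a => f (g a)).
    by split=> [c a b|a b]; rewrite ?ling ?linf// gbr charf.
  by exists p => //; split=> // /(fin _ f) h'; apply: inf; apply: h'.
have char2 : lie_character br2 (fun a => f (h a)).
  by split=> [c a b|a b]; rewrite ?linh ?linf// hbr charf.
exists (fun a => f (h a)); split=> [//|a|]; first by rewrite ghK.
by move=> /(fin f) h'; apply: inf; apply: h' => // a; rewrite ghK.
Qed.

End Projects.

Section Chain.
Variable R : realType.
Local Notation C := R[i].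
Variables (X : completeNormedModType C) (L : vectType C).
Variables (br : L -> L -> L) (rho : L -> X -> X).
Hypothesis bmod : bounded_module br rho.
Let mod := bounded_module_module bmod.
Let lie := module_lie mod.
Implicit Types I J : {vspace L}.

Local Notation rho_on I := (fun a : subvs_of I => rho (vsval a)).
Local Notation incl I J := (fun a : subvs_of I => vsproj J (vsval a)).

Lemma bounded_module_sub I : is_subalgebra br I -> bounded_module (sub_bracket br I) (rho_on I).
Proof.
move=> subI.
have brE (a b : subvs_of I) : vsval (sub_bracket br I a b) = br (vsval a) (vsval b).
  exact: sub_bracketE.
split; last by move=> a; apply: (bounded_module_bounded bmod).
split.
- split=> [c a b l|c a b l|a|a b c]; apply: subvs_inj.
  + by rewrite linearP /= !brE linearP /= (lie_linearl lie).
  + by rewrite linearP /= !brE linearP /= (lie_linearr lie).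
  + by rewrite brE linear0 (lie_alt lie).
  + by rewrite !linearD /= !brE (lie_jacobi lie).
- by move=> a; apply: (module_linear mod).
- by move=> c a b x; rewrite linearP /= (module_linearl mod).
- by move=> a b x; rewrite brE (module_bracket mod).
Qed.

(** Induction on the dimension of [J]. Unless [J = I], [top] leaves a vector [l] of [J] outside [W =
    I + [J, J]]; a functional that vanishes on [W] but not at [l] cuts out a hyperplane [J'] of [J],
    which is an ideal of [J] because it contains all brackets. *)
Lemma projects_sub I J : is_subalgebra br I -> is_subalgebra br J -> (I <= J)%VS ->
  (forall J', is_subalgebra br J' -> (J' <= I + lie_product br J' J')%VS -> (J' <= I)%VS) ->
  projects (sub_bracket br I) (sub_bracket br J) (rho_on I) (rho_on J) (incl I J).
Proof.
move=> subI + + top; move: {2}(\dim J).+1 (ltnSn (\dim J)) => m.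
elim: m J => // m IH J dJ subJ IJ.
have [JI|nJI] := boolP (J <= I)%VS.
  have <- : I = J by apply/eqP; rewrite eqEsubv IJ.
  apply: (projects_iso (h := id)) => //; try exact: bounded_module_sub.
  - by move=> c a b; rewrite /= !linearP.
  - by move=> a; rewrite vsvalK.
  - by move=> a; rewrite vsvalK.
  - by move=> a b; rewrite !vsvalK.
  - by move=> a; rewrite vsvalK.
pose W := (I + lie_product br J J)%VS.
have /subvPn[l lJ lW] : ~~ (J <= W)%VS by apply: contra nJI; apply: top.
have [phi [phiW phil]] := separating_functional lW.
pose J' := (J :&: lker phi)%VS.
have J'P x : (x \in J') = (x \in J) && (phi x == 0) by rewrite memv_cap memv_ker.
have WJ x : x \in W -> x \in J.
  apply/subvP; rewrite subv_add IJ /=; apply: lie_product_sub => u v; exact: subJ.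
have WJ' x : x \in W -> x \in J' by move=> xW; rewrite J'P WJ//= phiW.
have brJ a b : a \in J -> b \in J -> br a b \in W.
  by move=> aJ bJ; apply: (subvP (addvSr _ _)); apply: mem_lie_product.
have J'J x : x \in J' -> x \in J by rewrite J'P => /andP[].
have J'0 x : x \in J' -> phi x = 0 by rewrite J'P => /andP[_ /eqP].
have subJ' : is_subalgebra br J' by move=> a b /J'J aJ /J'J bJ; apply: WJ'; apply: brJ.
have IJ' : (I <= J')%VS by apply/subvP => x xI; apply: WJ'; apply: (subvP (addvSl _ _)).
have dJ' : (\dim J' < m)%N.
  rewrite -ltnS; apply: leq_trans dJ; rewrite !ltnS (ltn_leqif (dimv_leqif_eq (capvSl _ _))).
  apply: contraTneq (lJ) => <-; rewrite J'P phil lJ /=.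
  exact: oner_neq0.
apply: (projects_comp (IH J' dJ' subJ' IJ') (g' := incl J' J)); last first.
  by move=> a; rewrite /= vsprojK//; apply: (subvP IJ'); apply: subvsP.
pose lJ' := vsproj J l; have lJE : vsval lJ' = l by rewrite vsprojK.
pose h (x : subvs_of J) : subvs_of J' := vsproj J' (vsval x - phi (vsval x) *: l).
have hE x : vsval (h x) = vsval x - phi (vsval x) *: l.
  rewrite vsprojK// J'P rpredB ?rpredZ ?subvsP//= linearB linearZ /= phil.
  by rewrite [_ *: 1]mulr1 subrr.
have gE (a : subvs_of J') : vsval (vsproj J (vsval a)) = vsval a.
  by rewrite vsprojK//; apply: J'J; apply: subvsP.
have a0 (a : subvs_of J') : phi (vsval a) = 0 by apply: J'0; apply: subvsP.
have bJ := bounded_module_sub subJ; have bJ' := bounded_module_sub subJ'.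
have hyp1 : linear (incl J' J) by move=> c a b; rewrite /= !linearP.
have hyp2 : linear h.
  move=> c a b; apply: subvs_inj; rewrite linearP /= !hE linearP /= linearP /=.
  have -> : c *: phi (vsval a) = c * phi (vsval a) by [].
  by module.
have hyp3 : cancel (incl J' J) h.
  by move=> a; apply: subvs_inj; rewrite hE gE a0 scale0r subr0.
have hyp4 : h lJ' = 0 by apply: subvs_inj; rewrite hE lJE phil scale1r subrr linear0.
have hyp5 : scalar (fun x : subvs_of J => phi (vsval x) : C).
  by move=> c a b; rewrite /= !linearP.
have hyp6 a : phi (vsval (vsproj J (vsval (a : subvs_of J')))) = 0 by rewrite gE a0.
have hyp7 : phi (vsval lJ') = 1 by rewrite lJE.
have hyp8 x : x = vsproj J (vsval (h x)) + phi (vsval x) *: lJ'.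
  by apply: subvs_inj; rewrite linearD linearZ /= gE hE lJE subrK.
have hyp9 a b : vsproj J (vsval (sub_bracket br J' a b)) =
    sub_bracket br J (vsproj J (vsval a)) (vsproj J (vsval b)).
  by rewrite sub_bracketE// /sub_bracket !gE.
have hyp10 a b : phi (vsval (sub_bracket br J a b)) = 0.
  by rewrite sub_bracketE// phiW// brJ// subvsP.
have hyp11 a : rho (vsval (a : subvs_of J')) = rho (vsval (vsproj J (vsval a))) by rewrite gE.
split=> f p charf inf.
  exact: (codim1_projection_forward bJ' bJ hyp1 hyp2 hyp3 hyp4 hyp5 hyp6 hyp7 hyp8 hyp9
    hyp10 hyp11 charf inf).
exact: (codim1_projection_backward bJ' bJ hyp1 hyp2 hyp3 hyp4 hyp5 hyp6 hyp7 hyp8 hyp9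
  hyp10 hyp11 charf inf).
Qed.

Lemma projects_subalgebra I : is_subalgebra br I ->
  (forall J', is_subalgebra br J' -> (J' <= I + lie_product br J' J')%VS -> (J' <= I)%VS) ->
  projects (sub_bracket br I) br (rho_on I) rho (@vsval _ _ I).
Proof.
move=> subI top; have subL : is_subalgebra br fullv by move=> a b _ _; apply: memvf.
have vK (a : L) : vsval (vsproj fullv a) = a by rewrite vsprojK// memvf.
apply: (projects_comp (projects_sub subI subL (subvf _) top) (g' := @vsval _ _ fullv)) => //.
apply: (projects_iso (h := vsproj fullv)) => //.
- exact: bounded_module_sub.
- exact: linearP.
- exact: vsvalK.
- by move=> a b; apply: sub_bracketE.
Qed.

End Chain.

(** * Essential spectra *)

Section CompactRows.
Variable R : realType.
Local Notation C := (Num.NumField.sort (R[i] : numFieldType)).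

Lemma compact_rows n (S : set 'rV[C]_n) (B : R) :
  (forall v : 'rV[C]_n, S v -> forall i, rnorm (v 0 i) <= B) ->
  (forall v : 'rV[C]_n, (forall e : R, 0 < e -> exists2 w, S w & forall i, rnorm (w 0 i - v 0 i) <= e) ->
    S v) -> compact S.
Proof.
move=> SB clS; apply: (@subclosed_compact _ _ [set v : 'rV[C]_n | forall i, rnorm (v 0 i) <= B]).
- move=> v vS; apply: clS => e e0.
  have eC : 0 < e%:C%C :> C by rewrite ltcR.
  have [w [Sw vw]] := vS _ (nbhsx_ballx v _ eC); exists w => // i.
  by have := vw.2 0 i; rewrite -ball_normE /= rnormE ltcR -rnormN opprB => /ltW.
- exact: (rV_compact (fun=> @compact_disc R B)).
- exact: SB.
Qed.

End CompactRows.

Lemma fin_dim_homology_gt (K : numFieldType) (L : vectType K) (X : lmodType K)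
    (br : L -> L -> L) (rho : L -> X -> X) p : lie_module br rho ->
  (\dim {:L} < p)%N -> fin_dim_homology br rho p.
Proof.
move=> mod np; rewrite fin_dim_homologyE//; apply: fin_dim_quotient_full => z [Pz _].
rewrite (kdegree_gt np Pz).
by apply: subspace0; apply: subspace_boundaries.
Qed.

Lemma fin_dim_homology_dim0 (K : numFieldType) (L : vectType K) (X : lmodType K)
    (br : L -> L -> L) (rho : L -> X -> X) : lie_module br rho -> \dim {:L} = 0%N ->
  fin_dim_homology br rho 0 -> fin_dim X.
Proof.
move=> mod n0; rewrite fin_dim_homologyE// => fin.
have deg0 x : kdegree 0 (scalars L x).
  by move=> S cS; rewrite scalarsE ifF//; apply/eqP => S0; apply: cS; rewrite S0 cards0.
have lind := linear_koszul_op br (module_linear mod).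
apply: (fin_dim_quotient_sub (g := @scalars _ L X) _ _ _ fin).
- exact: linear_kwedge.
- by split.
- exact: subspace_boundaries.
- by move=> x _; split; [exact: deg0 | apply: koszul_op_degree0 => //; apply: module_linear mod].
move=> x _ [y Py]; rewrite (kdegree_gt _ Py) ?n0// (linear_map0 lind) => x0.
have := congr1 (fun u : kchain L X => u finset.set0) x0.
by rewrite scalarsE eqxx ffunE => <-.
Qed.

Lemma lie_character_hom (R : realType) (L : vectType R[i]) (br : L -> L -> L)
    (f : 'Hom(L, R[i]^o)) : is_character br f -> lie_character br f.
Proof. by split=> // c a b; rewrite linearP. Qed.

(** The projection property in degrees up to the dimension of [L] yields the spectrum of a
    subalgebra in degrees beyond its own dimension, where there is no homology. *)
Lemma sigma_delta_e_max (R : realType) (X : completeNormedModType R[i]) (L : vectType R[i])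
    (br : L -> L -> L) (rho : L -> {linear X -> X}) k : bounded_module br (fun l => rho l) ->
  (\dim {:L} <= k)%N -> sigma_delta_e br rho k = sigma_e br rho.
Proof.
move=> bmod nk; apply/seteqP; split=> f [p /= pk [charf inf]]; exists p => //=; last first.
  exact: leq_trans nk.
rewrite leqNgt; apply/negP => np; apply: inf; apply: fin_dim_homology_gt np.
have [linf charf'] := lie_character_hom charf.
exact: (shift_module bmod linf charf').
Qed.

Section Spectrum.
Variable R : realType.
Local Notation C := R[i].
Variables (X : completeNormedModType C) (L : vectType C).
Variables (br : L -> L -> L) (rho : L -> {linear X -> X}).
Hypotheses (br_lie : is_lie_bracket br) (rho_rep : is_representation br rho).
Implicit Types (I : {vspace L}) (f : 'Hom(L, C^o)) (k p : nat).

Lemma representation_module : bounded_module br (fun l => rho l).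
Proof.
split; last first.
  move=> l; split; first exact: linearP.
  have [M MP] := rep_bounded rho_rep l; exists (rnorm M); first exact: rnorm_ge0.
  move=> x; have := le_trans (MP x) (real_ler_norm (ger0_real (le_trans (normr_ge0 _) (MP x)))).
  by rewrite normrM normr_id !rnormE -rmorphM lecR.
split=> //.
- by move=> l; apply: linearP.
- exact: rep_linear rho_rep.
- exact: rep_bracket rho_rep.
Qed.

Let bmod := representation_module.

Lemma sigma_delta_e_projection I k : lie_solvable br ->
  is_ideal br I \/ lie_nilpotent br /\ is_subalgebra br I ->
  [set dual_restrict I f | f in sigma_delta_e br rho k] =
  sigma_delta_e (sub_bracket br I) (rep_restrict rho I) k.
Proof.
move=> solv hI; have subI : is_subalgebra br I.
  by case: hI => [/ideal_subalgebra|[]].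
have top J : is_subalgebra br J -> (J <= I + lie_product br J J)%VS -> (J <= I)%VS.
  by case: hI => [idI|[nilp _]] _; [exact: solvable_ideal_top | exact: nilpotent_subalgebra_top].
have [fwd bwd] := projects_subalgebra bmod subI top.
have restrE (f : 'Hom(L, C^o)) : dual_restrict I f = (fun a => f (vsval a)) :> (_ -> C).
  by apply: funext => a; rewrite comp_lfunE lfunE.
apply/seteqP; split=> [_ [f [p /= pk [charf inf]] <-]|f [p /= pk [charf inf]]].
  have [q qp [[_ charq] infq]] := fwd f p (lie_character_hom charf) inf.
  exists q; first exact: leq_trans pk.
  split=> [a b|]; first by rewrite comp_lfunE lfunE; apply: charq.
  by move: infq; rewrite -restrE.
have charI : lie_character (sub_bracket br I) f by split=> // c a b; rewrite linearP.
have [f2 [[lin2 char2] f2E inf2]] := bwd f p charI inf.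
have [F FE] := lfun_of_scalar lin2.
have {}FE : (F : L -> C) = f2 by apply: funext.
exists F; last by apply/lfunP => a; rewrite comp_lfunE lfunE FE f2E.
exists p => //; split=> [a b|]; first by rewrite FE char2.
by rewrite -FE in inf2.
Qed.

Lemma sigma_delta_e_nonempty k : lie_solvable br -> ~ fin_dim X ->
  sigma_delta_e br rho k !=set0.
Proof.
move=> solv infX; have id0 : is_ideal br 0%VS.
  by move=> a b /[!memv0] /eqP ->; rewrite (linear_map0 (linear_br br_lie a)).
have : sigma_delta_e (sub_bracket br 0%VS) (rep_restrict rho 0%VS) k 0; last first.
  by rewrite -(sigma_delta_e_projection k solv (or_introl id0)) => -[f fk _]; exists f.
exists 0%N => //; split=> [a b|fin]; first by rewrite zero_lfunE.
apply: infX; apply: fin_dim_homology_dim0 fin; last by rewrite dimvf; apply: dimv0.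
apply: (shift_module (bounded_module_sub bmod (ideal_subalgebra id0))).
  by move=> c a b; rewrite linearP.
by move=> a b; rewrite zero_lfunE.
Qed.

Lemma sigma_delta_e_compact k : dual_compact (sigma_delta_e br rho k).
Proof.
set n := \dim {:L}; pose e (i : 'I_n) := (vbasis {:L})`_i.
have lineval (g : L -> C) a : scalar g -> g a = \sum_(i < n) coord (vbasis {:L}) i a * g (e i).
  move=> ling; rewrite {1}(coord_vbasis (memvf a)) (linear_map_sum (V2 := C^o) ling).
  by apply: eq_bigr => i _; rewrite (linear_mapZ (V2 := C^o) ling).
have /choice[B BP] : forall i : 'I_n, exists B, forall f : L -> C, lie_character br f ->
    B <= rnorm (f (e i)) -> forall p, fin_dim_homology br (shift (fun l => rho l) f) p.
  by move=> i; apply: far_character_finite.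
(* One large coordinate is enough to make all homology finite-dimensional, so the sum of the [B i]
   bounds every coordinate on the spectrum. *)
apply: (@compact_rows R n _ (\sum_i `|B i|)) => [_ [f [p pk [charf inf]] <-] i|v closure_v].
  rewrite mxE leNgt; apply/negP => far; apply: inf.
  apply: (BP i f (lie_character_hom charf)); apply: le_trans (ltW far).
  rewrite (bigD1 i)//=; apply: (le_trans (ler_norm _)); rewrite lerDl.
  by apply: sumr_ge0 => j _; apply: normr_ge0.
pose f0 (a : L) : C := \sum_(i < n) coord (vbasis {:L}) i a * v 0 i.
have lin0 : scalar f0.
  move=> c a b; rewrite /f0 mulr_sumr -big_split; apply: eq_bigr => i _ /=.
  by rewrite linearP /= mulrDl mulrA.
have f0e i : f0 (e i) = v 0 i.
  rewrite /f0 (bigD1 i)//= coord_free ?(basis_free (vbasisP _))// eqxx mul1r big1 ?addr0// => j ji.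
  by rewrite coord_free ?(basis_free (vbasisP _))// eq_sym (negbTE ji) mul0r.
have approx eps : 0 < eps -> exists f, sigma_delta_e br rho k f /\
    forall i, rnorm (f (e i) - f0 (e i)) <= eps.
  move=> /closure_v[_ [f fk <-] fv]; exists f; split=> // i.
  by have := fv i; rewrite mxE f0e.
have char0 : lie_character br f0.
  split=> // a b; apply: (@rnorm_eq0 _ (R[i] : numFieldType)); apply/eqP.
  rewrite eq_le rnorm_ge0 andbT; apply/ler_addgt0Pr => eps eps0; rewrite add0r.
  pose c := \sum_(i < n) rnorm (coord (vbasis {:L}) i (br a b)) + 1.
  have c0 : 0 < c by rewrite ltr_wpDl// sumr_ge0// => i _; apply: rnorm_ge0.
  have [|f [[p _ [charf _]] fv]] := approx (eps / c); first by rewrite divr_gt0.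
  have [linf charf'] := lie_character_hom charf.
  have -> : f0 (br a b) = - \sum_(i < n) coord (vbasis {:L}) i (br a b) * (f (e i) - f0 (e i)).
    rewrite (eq_bigr (fun i => coord (vbasis {:L}) i (br a b) * f (e i) -
        coord (vbasis {:L}) i (br a b) * f0 (e i))); last by move=> i _; rewrite mulrBr.
    by rewrite sumrB -!lineval// charf' sub0r opprK.
  rewrite rnormN; apply: (@le_trans _ _ (\sum_(i < n) rnorm (coord (vbasis {:L}) i (br a b)) * (eps / c))).
    elim/big_ind2: _ => [|x y x' y' xy xy'|i _]; first by rewrite rnorm0.
      by apply: (le_trans (ler_rnormD _ _)); apply: lerD.
    by rewrite rnormM ler_wpM2l ?rnorm_ge0.
  rewrite -mulr_suml mulrA ler_pdivrMr// [_ * eps]mulrC; apply: ler_wpM2l; first exact: ltW.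
  by rewrite /c lerDl.
have [F FE] := lfun_of_scalar lin0; have {}FE : (F : L -> C) = f0 by apply: funext.
exists F; last by apply/rowP => i; rewrite mxE FE f0e.
apply: contrapT => nF.
have fin p : (p <= k)%N -> fin_dim_homology br (shift (fun l => rho l) f0) p.
  move=> pk; apply: contrapT => inf; apply: nF; exists p => //.
  by split=> [a b|]; rewrite ?FE; [apply: char0.2 | rewrite -FE in inf].
(* If the limit point [f0] lay outside the spectrum, all degrees up to [k] would be finite at [f0],
   hence in a common neighbourhood, which [approx] contradicts. Stability in degree [m] uses
   finiteness at [f0] in degrees [m] and [m - 1] only, so nothing is asked of degrees above [k]. *)
have stable m : (m <= k.+1)%N -> exists2 delta : R, 0 < delta & forall f : L -> C, lie_character br f ->
    (forall i, rnorm (f (e i) - f0 (e i)) <= delta) ->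
    forall p, (p < m)%N -> fin_dim_homology br (shift (fun l => rho l) f) p.
  elim: m => [|m IH] mk; first by exists 1.
  have [delta delta0 h] := IH (ltnW mk).
  have finq q : m = q.+1 -> fin_dim_homology br (shift (fun l => rho l) f0) q.
    by move=> mq; apply: fin; rewrite -ltnS -mq ltnW.
  have [delta' delta'0 h'] := finite_homology_stable bmod char0 (fin m mk) finq.
  exists (Num.min delta delta'); first by rewrite lt_min delta0.
  move=> f charf near p; rewrite ltnS leq_eqVlt => /predU1P[->|pm].
    by apply: h' => // i; apply: (le_trans (near i)); rewrite ge_min lexx orbT.
  by apply: h pm => // i; apply: (le_trans (near i)); rewrite ge_min lexx.
have [delta delta0 h] := stable _ (leqnn _).
have [f [[p pk [charf inf]] near]] := approx delta delta0.
by apply: inf; apply: (h f (lie_character_hom charf) near).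
Qed.

End Spectrum.

Theorem theorem3p2 (R : realType) (X : completeNormedModType R[i])
    (L : vectType R[i]) (br : L -> L -> L) (rho : L -> {linear X -> X})
    (br_lie : is_lie_bracket br) (br_solvable : lie_solvable br)
    (rho_rep : is_representation br rho) :
  (forall k : nat, (k <= \dim {:L})%N ->
    [/\ dual_compact (sigma_delta_e br rho k),
        ~ fin_dim X -> sigma_delta_e br rho k !=set0 &
        forall I : {vspace L},
          is_ideal br I \/ lie_nilpotent br /\ is_subalgebra br I ->
          [set dual_restrict I f | f in sigma_delta_e br rho k] =
          sigma_delta_e (sub_bracket br I) (rep_restrict rho I) k])
  /\
  [/\ dual_compact (sigma_e br rho),
      ~ fin_dim X -> sigma_e br rho !=set0 &
      forall I : {vspace L},
        is_ideal br I \/ lie_nilpotent br /\ is_subalgebra br I ->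
        [set dual_restrict I f | f in sigma_e br rho] =
        sigma_e (sub_bracket br I) (rep_restrict rho I)].
Proof.
have main k : [/\ dual_compact (sigma_delta_e br rho k),
    ~ fin_dim X -> sigma_delta_e br rho k !=set0 &
    forall I : {vspace L}, is_ideal br I \/ lie_nilpotent br /\ is_subalgebra br I ->
      [set dual_restrict I f | f in sigma_delta_e br rho k] =
      sigma_delta_e (sub_bracket br I) (rep_restrict rho I) k].
  split; first exact: sigma_delta_e_compact.
    exact: sigma_delta_e_nonempty.
  by move=> I; apply: sigma_delta_e_projection.
split=> [k _|]; first exact: main.
have [compact_e nonempty_e projection_e] := main (\dim {:L}).
split=> [||I hI]; [exact: compact_e | exact: nonempty_e|].
have subI : is_subalgebra br I by case: hI => [/ideal_subalgebra|[]].
rewrite [LHS](projection_e I hI).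
apply: sigma_delta_e_max.
  exact: (bounded_module_sub (representation_module br_lie rho_rep) subI).
by rewrite [X in (X <= _)%N]dimvf; apply: dimvS; apply: subvf.
Qed.
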